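(* Consider a compound Poisson process with negative drift $r_1<0$, jump rate $\lambda>0$, and upward jumps with a phase-type $(n,\boldsymbol\alpha_0,\mathbf T)$ distribution, reflected at the infimum (level $0$) and at level $K>0$; let $Q$ denote the reflected process, started at $Q(0)=\tau\in[0,K]$, and let $D,U$ be the sojourn times below and above level $\tau$ defined in the context. Let $\theta_1,\theta_2\ge0$. For $q\in\{\theta_1,\theta_2\}$ let $p_1(q),\dots,p_{n+1}(q)\in\mathbb C$ be the $n+1$ roots (presupposed pairwise distinct) of $\phi(s)=q$, where $$\phi(s)=-s r_1-\lambda+\lambda\,\boldsymbol\alpha_0^{\rm T}(s\mathbf I-\mathbf T)^{-1}\mathbf t,$$ and set, for $k=1,\dots,n+1$, $$h_{k,1}(q)=1,\qquad h_{k,j}(q)=\mathbf e_{j-1}^{\rm T}\big(p_k(q)\mathbf I-\mathbf T\big)^{-1}\mathbf t\quad(j=2,\dots,n+1).$$ Then $$\mathbb E\,e^{-\theta_1D-\theta_2U}=\frac1{C(\theta_2)}\sum_{i=2}^{n+1}z_i(\theta_1)\sum_{k=1}^{n+1}(-1)^{k+1}c_k(\theta_2)\,h_{k,i}(\theta_2),$$ where: (i) $c_k(\theta_2)$ is the determinant of the $n\times n$ matrix obtained by deleting the $k$-th row from the $(n+1)\times n$ matrix with rows indexed by $m=1,\dots,n+1$, columns indexed by $j=2,\dots,n+1$, and $(m,j)$ entry $p_m(\theta_2)\,h_{m,j}(\theta_2)\,e^{-p_m(\theta_2)(K-\tau)}$, and $C(\theta_2)=\sum_{k=1}^{n+1}(-1)^{1+k}c_k(\theta_2)$;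 (ii) $z_2(\theta_1),\dots,z_{n+1}(\theta_1)$, together with an additional unknown $\ell(\theta_1)$, are determined as the solution of the system of linear equations $$\sum_{j=2}^{n+1}z_j(\theta_1)\,h_{k,j}(\theta_1)+p_k(\theta_1)e^{p_k(\theta_1)\tau}\,\ell(\theta_1)=1,\qquad k=1,\dots,n+1.$$
   Context: Phase-type distribution. A phase-type distribution with representation $(n,\boldsymbol\alpha_0,\mathbf T)$ is the law of the absorption time of a continuous-time Markov process with $n$ transient states and one absorbing state, where $\boldsymbol\alpha_0$ is the initial probability vector on the transient states, $\mathbf T$ is the $n\times n$ rate matrix among the transient states, and $\mathbf t=-\mathbf T\mathbf 1$ is the exit vector (rates to the absorbing state). Its Laplace transform is $\hat B[s]=\boldsymbol\alpha_0^{\rm T}(s\mathbf I-\mathbf T)^{-1}\mathbf t$; this rational expression is also used to define it at complex arguments $s$ for which $s\mathbf I-\mathbf T$ is invertible. $\mathbf e_j$ is the $j$-th unit column vector in $\mathbb R^n$, so $\mathbf e_{j-1}^{\rm T}(s\mathbf I-\mathbf T)^{-1}\mathbf t$ is the transform of the phase-type distribution started in phase $j-1$. Reflected process (workload of the finite-buffer M/G/1 queue). Jumps (customer arrivals) occur at the epochs of a Poisson process of rate $\lambda$; jump sizes are i.i.d. with the phase-type distribution with representation $(n,\boldsymbol\alpha_0,\mathbf T)$ and independent of the arrival process. Between jumps $Q$ decreases linearly at rate $|r_1|$ as long as $Q>0$, and stays at $0$ once it reaches $0$. At a jump epoch $t$ with jump size $S$, $Q(t)=\min\{Q(t-)+S,K\}$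 (work that does not fit is lost). The process starts at $Q(0)=\tau$ with $\tau\in[0,K]$. Sojourn times. $D$ is the first jump epoch $t$ at which $Q(t-)+S>\tau$, where $S$ is the size of that jump (for $\tau<K$ this is the first time that $Q$ exceeds $\tau$), and $U=\inf\{s\ge0:Q(D+s)=\tau\}$ is the time from then until $Q$ is back at level $\tau$. *)

(* Defs.v *)
From HB Require Import structures.
From mathcomp Require Import all_boot all_order all_algebra.
From mathcomp Require Import all_classical all_reals all_analysis.
From mathcomp.real_closed Require Import complex.

Set Implicit Arguments.
Unset Strict Implicit.
Unset Printing Implicit Defensive.

Import Order.TTheory GRing.Theory Num.Theory.
Import numFieldNormedType.Exports.

Local Open Scope classical_set_scope.
Local Open Scope ring_scope.

(* Continuous-time Markov processes on the finite state space 'I_m *)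

(* P is the standard stochastic semigroup whose infinitesimal transition rates
   are the entries of G, i.e. P h i j = (i == j) + G i j * h + o(h). *)
Definition transition_function (R : realType) (m : nat)
    (G : 'M[R]_m) (P : R -> 'M[R]_m) : Prop :=
  [/\ forall t i j, 0 <= t -> 0 <= P t i j,
      forall t i, 0 <= t -> \sum_j P t i j = 1,
      P 0 = 1%:M,
      forall s t, 0 <= s -> 0 <= t -> P (s + t) = P s *m P t
    & forall i j, h^-1 * (P h i j - (i == j)%:R) @[h --> 0^'+] --> G i j].

(* The last clause is the Markov property with initial law a and transition
   function P, in terms of the finite-dimensional distributions. *)
Definition markov_process (R : realType) (d : measure_display)
    (Omega : measurableType d) (Pr : probability Omega R) (m : nat)
    (a : 'cV[R]_m) (G : 'M[R]_m) (X : R -> Omega -> 'I_m) : Prop :=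
  exists P : R -> 'M[R]_m,
  [/\ transition_function G P,
      forall t i, 0 <= t -> measurable (X t @^-1` [set i]),
      forall w t, 0 <= t -> \forall s \near t^'+, X s w = X t w
    & forall (k : nat) (t : nat -> R) (i : nat -> 'I_m),
        t 0%N = 0 -> (forall l, t l <= t l.+1) ->
        Pr [set w | forall l, (l <= k)%N -> X (t l) w = i l] =
        (a (i 0%N) 0 *
         \prod_(l < k) P (t l.+1 - t l) (i l) (i l.+1))%:E].

Definition hitting_time (R : realType) (Omega : Type) (m : nat)
    (X : R -> Omega -> 'I_m) (i : 'I_m) (w : Omega) : \bar R :=
  ereal_inf [set t%:E | t in [set t : R | 0 <= t /\ X t w = i]].

(* Phase-type distributions. In the rate matrix of the whole process, state
   ord0 is the absorbing state and phase i is state lift ord0 i. *)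

Definition exit_vector (R : realType) (n : nat) (T : 'M[R]_n) : 'cV[R]_n :=
  - (T *m const_mx 1).

Definition absorbing_rate_matrix (R : realType) (n : nat) (T : 'M[R]_n) :
    'M[R]_(1 + n) :=
  block_mx 0 0 (exit_vector T) T.

(* The last clause says that every phase is transient: the only other state is
   absorbing and the chain is finite, so a phase is transient exactly when the
   absorbing state can be reached from it. *)
Definition phase_type_representation (R : realType) (n : nat)
    (alpha : 'cV[R]_n) (T : 'M[R]_n) : Prop :=
  [/\ forall i, 0 <= alpha i 0,
      \sum_i alpha i 0 = 1,
      forall i j, i != j -> 0 <= T i j,
      forall i, 0 <= exit_vector T i 0
    & forall i, exists2 j, connect (fun k l => 0 < T k l) i j &
        0 < exit_vector T j 0].

Definition phase_type (R : realType) (n : nat) (alpha : 'cV[R]_n)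
    (T : 'M[R]_n) (B : set R -> \bar R) : Prop :=
  phase_type_representation alpha T /\
  exists (d : measure_display) (Omega : measurableType d)
         (Pr : probability Omega R) (X : R -> Omega -> 'I_(1 + n)),
    markov_process Pr (col_mx 0 alpha) (absorbing_rate_matrix T) X /\
    forall A : set R, measurable A ->
      B A = Pr (hitting_time X ord0 @^-1` (EFin @` A)).

Section Transform.
Context (R : realType) (n : nat).
Local Notation C := R[i].
Local Notation "x %:C" := (real_complex R x).

Definition cexp (z : C) : C :=
  (expR (complex.Re z))%:C * Complex (cos (complex.Im z)) (sin (complex.Im z)).

Definition resolvent_arg (T : 'M[R]_n) (s : C) : 'M[C]_n :=
  s%:M - map_mx (real_complex R) T.

Definition phase_type_LT (alpha : 'cV[R]_n) (T : 'M[R]_n) (s : C) : C :=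
  ((map_mx (real_complex R) alpha)^T *m invmx (resolvent_arg T s)
     *m map_mx (real_complex R) (exit_vector T)) 0 0.

Definition phi (r1 lambda : R) (alpha : 'cV[R]_n) (T : 'M[R]_n) (s : C) : C :=
  - s * r1%:C - lambda%:C + lambda%:C * phase_type_LT alpha T s.

(* p enumerates without repetition the solutions of phi s = q in the domain of
   phi; there are n.+1 of them. *)
Definition distinct_roots (r1 lambda : R) (alpha : 'cV[R]_n) (T : 'M[R]_n)
    (q : R) (p : 'I_n.+1 -> C) : Prop :=
  injective p /\
  forall s, (exists k, p k = s) <->
    (resolvent_arg T s \in unitmx /\ phi r1 lambda alpha T s = q%:C).

(* Indices are shifted to start at 0: the index j in {2, ..., n+1} of the
   formulas is lift ord0 i with i = j - 2 : 'I_n. *)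
Definition h (T : 'M[R]_n) (p : 'I_n.+1 -> C) (k j : 'I_n.+1) : C :=
  if unlift ord0 j is Some i then phase_type_LT (delta_mx i 0) T (p k) else 1.

(* x stands for K - tau. *)
Definition cmx (T : 'M[R]_n) (p : 'I_n.+1 -> C) (x : R) : 'M[C]_(n.+1, n) :=
  \matrix_(m < n.+1, j < n)
    (p m * h T p m (lift ord0 j) * cexp (- p m * x%:C)).

Definition c (T : 'M[R]_n) (p : 'I_n.+1 -> C) (x : R) (k : 'I_n.+1) : C :=
  \det (row' k (cmx T p x)).

Definition Csum (T : 'M[R]_n) (p : 'I_n.+1 -> C) (x : R) : C :=
  \sum_(k < n.+1) (-1) ^+ k * c T p x k.

Definition solves_system (T : 'M[R]_n) (p : 'I_n.+1 -> C) (tau : R)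
    (z : 'rV[C]_n) (l : C) : Prop :=
  forall k : 'I_n.+1,
    \sum_(j < n) z 0 j * h T p k (lift ord0 j)
      + p k * cexp (p k * tau%:C) * l = 1.

End Transform.

(* The reflected process driven by a sequence e of interarrival times and a
   sequence b of jump sizes; jump number k.+1 has size b k and takes place at
   epoch e k.+1. *)
Section Path.
Context (R : realType) (r1 K tau : R) (e b : nat -> R).

Definition epoch (k : nat) : R := \sum_(i < k) e i.

Fixpoint level_after (k : nat) : R :=
  if k is k'.+1 then
    Num.min (Num.max (level_after k' - `|r1| * e k') 0 + b k') K
  else tau.

Definition Q (t : R) : R :=
  let k := xget 0%N [set k | epoch k <= t < epoch k.+1] in
  Num.max (level_after k - `|r1| * (t - epoch k)) 0.

Definition D : \bar R :=
  ereal_inf [set (epoch k.+1)%:E | k in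
    [set k | tau < lim (Q t @[t --> (epoch k.+1)^'-]) + b k]].

(* U = +oo when D = +oo. *)
Definition U : \bar R :=
  ereal_inf [set s%:E | s in
    [set s : R | 0 <= s /\ exists2 t : R, D = t%:E & Q (t + s) = tau]].

End Path.

Definition mutually_independent (R : realType) (d : measure_display)
    (Omega : measurableType d) (P : probability Omega R) (I : eqType)
    (X : I -> Omega -> R) : Prop :=
  forall (s : seq I) (A : I -> set R), uniq s ->
    (forall i, measurable (A i)) ->
    P [set w | forall i, i \in s -> A i (X i w)] =
    (\prod_(i <- s) P (X i @^-1` A i))%E.

(* The arrivals form a Poisson process of rate lambda: the interarrival times
   E are i.i.d. exponential; the jump sizes S are i.i.d. with law B and
   independent of the arrivals. *)
Definition marked_poisson (R : realType) (d : measure_display)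
    (Omega : measurableType d) (P : probability Omega R)
    (lambda : R) (B : set R -> \bar R) (E S : nat -> {RV P >-> R}) : Prop :=
  [/\ forall k (A : set R), measurable A ->
        distribution P (E k) A = exponential_prob lambda A,
      forall k (A : set R), measurable A -> distribution P (S k) A = B A
    & mutually_independent P
        (fun i : nat + nat =>
           match i with inl k => E k : Omega -> R | inr k => S k end)].

(* Main.v *)
Require Import Defs.
From HB Require Import structures.
From mathcomp Require Import all_boot all_order all_algebra.
From mathcomp Require Import all_classical all_reals all_analysis.
From mathcomp.real_closed Require Import complex.
From mathcomp Require Import measurable_realfun ring lra.

(** The pair of sojourn times is generated by a Markov chain: the level of the
    process just after each jump. Let [f u], for [u] below [tau], be the expected
    discount when the process is at level [u] before its first crossing of [tau],
    and [g u], for [u] above [tau], the same after the crossing. On exponential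
    sums both steps of the chain act diagonally. Averaging [cexp (- p * u)] over a
    jump multiplies it by the transform of the jump size at [p]
    ([capped_exponential], by integrating the tail of the jump against the
    derivative of the exponential), and averaging over the exponential time of
    running down divides by the same factor exactly when [phi p] is the discount
    rate ([exponential_step]). What remains are boundary terms. At the cap [K] the
    term is [cap_defect], whose vanishing is the condition written in the columns
    of [cmx]; at [tau] the value of [g] must be [1]; at level [0] reflection
    demands [\sum_k c k * p k = 0] ([step_below]); and a jump from below crosses
    [tau] in some phase and restarts there, so that [f] and [g] fit together when
    their exit averages at [tau] agree phase by phase ([jump_below]).

    If the conditions hold, the value weighted by the stage of the excursion has
    constant expectation along the chain ([value_martingale]). The stages before
    completion have geometrically small weight ([weights_decay]), so in the limit
    [f tau] is the expectation sought ([expected_discount]). The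
    discount factor itself is enclosed, at every step, between bounded measurable
    functions of finitely many jumps ([discount_bounds], [integral_sandwich]).

    It remains to solve the conditions. Coefficients that satisfy the homogeneous
    conditions belong to a value function with zero payoff, which therefore vanishes
    at its starting point ([lower_kernel], [upper_kernel]); together
    with the distinctness of the roots, through the moments of the coefficients
    ([roots_independent]), this shows that the coefficients are zero. Hence both
    linear systems are nonsingular. Cramer's rule expresses the coefficients of [g]
    by the minors [c T p x k] ([minors_system]). The system for [z] is the transpose
    of the one for the coefficients of [f], so that [z] evaluates the total weight
    [f tau] from the exit averages of [g] ([column_system]), which is the formula. *)

Set Implicit Arguments.
Unset Strict Implicit.
Unset Printing Implicit Defensive.

Import Order.TTheory GRing.Theory Num.Theory.
Import numFieldNormedType.Exports.

Local Open Scope classical_set_scope.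
Local Open Scope ring_scope.

(** * Expectations of bounded functions *)

Definition bounded_measurable (R : realType) (d : measure_display)
    (U : measurableType d) (f : U -> R) : Prop :=
  measurable_fun setT f /\ exists M, forall x, `|f x| <= M.

Section BoundedMeasurable.
Context (R : realType) (d : measure_display) (U : measurableType d).
Implicit Types f g : U -> R.

Lemma bmf_cst (c : R) : bounded_measurable (fun _ : U => c).
Proof. by split; [exact: measurable_cst | exists `|c|]. Qed.

Lemma bmfD f g : bounded_measurable f -> bounded_measurable g ->
  bounded_measurable (fun x => f x + g x).
Proof.
move=> [mf [M fM]] [mg [N gN]]; split; first exact: measurable_funD.
by exists (M + N) => x; rewrite (le_trans (ler_normD _ _))// lerD.
Qed.

Lemma bmfM f g : bounded_measurable f -> bounded_measurable g ->
  bounded_measurable (fun x => f x * g x).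
Proof.
move=> [mf [M fM]] [mg [N gN]]; split; first exact: measurable_funM.
by exists (M * N) => x; rewrite normrM ler_pM.
Qed.

Lemma bmfZ (c : R) f : bounded_measurable f ->
  bounded_measurable (fun x => c * f x).
Proof. by move=> ?; apply: bmfM => //; exact: bmf_cst. Qed.

Lemma bmfB f g : bounded_measurable f -> bounded_measurable g ->
  bounded_measurable (fun x => f x - g x).
Proof.
move=> bf bg; have := bmfD bf (bmfZ (-1) bg).
by congr bounded_measurable; apply/funext => x; rewrite mulN1r.
Qed.

Lemma bmf_sum (I : Type) (s : seq I) (F : I -> U -> R) :
  (forall i, bounded_measurable (F i)) ->
  bounded_measurable (fun x => \sum_(i <- s) F i x).
Proof.
move=> bF; elim: s => [|i s IH].
  by under eq_fun do rewrite big_nil; exact: bmf_cst.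
by under eq_fun do rewrite big_cons; exact: bmfD.
Qed.

Lemma measurable_bool_natr (b : U -> bool) : measurable_fun setT b ->
  measurable_fun setT (fun x => (b x)%:R : R).
Proof.
move=> mb; rewrite (_ : (fun _ => _) = (fun x => if b x then 1 else 0 : R)).
  by apply: measurable_fun_ifT => //; exact: measurable_cst.
by apply/funext => x; case: (b x).
Qed.

Lemma bmf_bool (b : U -> bool) : measurable_fun setT b ->
  bounded_measurable (fun x => (b x)%:R : R).
Proof.
move=> mb; split; first exact: measurable_bool_natr.
by exists 1 => x; case: (b x); rewrite ?normr0 ?normr1.
Qed.

Lemma bmf_if (b : U -> bool) f g : measurable_fun setT b ->
  bounded_measurable f -> bounded_measurable g ->
  bounded_measurable (fun x => if b x then f x else g x).
Proof.
move=> mb [mf [M fM]] [mg [N gN]]; split; first exact: measurable_fun_ifT.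
by exists (Num.max M N) => x; case: ifP => _; rewrite le_max ?fM ?gN ?orbT.
Qed.

Lemma bmf_comp (d' : measure_display) (V : measurableType d') (f : V -> R)
    (k : U -> V) :
  bounded_measurable f -> measurable_fun setT k ->
  bounded_measurable (fun x => f (k x)).
Proof.
move=> [mf [M fM]] mk; split; first exact: measurableT_comp.
by exists M.
Qed.

End BoundedMeasurable.

Section Expectation.
Context (R : realType) (d : measure_display) (U : measurableType d)
  (P : probability U R).
Implicit Types f g : U -> R.

Definition Ex f : R := \int[P]_x f x.

Lemma bmf_integrable f : bounded_measurable f ->
  P.-integrable setT (EFin \o f).
Proof.
move=> [mf [M fM]]; apply: measurable_bounded_integrable => //.
  by rewrite (_ : _ setT = 1%E) ?ltry//; exact: probability_setT.
exists M; split; first exact: num_real.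
by move=> x Mx y _ /=; rewrite (le_trans (fM y))// ltW.
Qed.

Lemma ExE f : bounded_measurable f -> (\int[P]_x (f x)%:E)%E = (Ex f)%:E.
Proof.
move=> /bmf_integrable fi; rewrite /Ex /Rintegral fineK//.
exact: integrable_fin_num fi.
Qed.

Lemma ExD f g : bounded_measurable f -> bounded_measurable g ->
  Ex (fun x => f x + g x) = Ex f + Ex g.
Proof. by move=> /bmf_integrable ? /bmf_integrable ?; exact: RintegralD. Qed.

Lemma ExB f g : bounded_measurable f -> bounded_measurable g ->
  Ex (fun x => f x - g x) = Ex f - Ex g.
Proof. by move=> /bmf_integrable ? /bmf_integrable ?; exact: RintegralB. Qed.

Lemma ExZ (c : R) f : bounded_measurable f ->
  Ex (fun x => c * f x) = c * Ex f.
Proof. by move=> /bmf_integrable ?; exact: RintegralZl. Qed.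

Lemma Ex_cst (c : R) : Ex (fun=> c) = c.
Proof.
rewrite /Ex Rintegral_cst//.
by rewrite (_ : _ setT = 1%E) ?mulr1//; exact: probability_setT.
Qed.

Lemma Ex_sum (I : Type) (s : seq I) (F : I -> U -> R) :
  (forall i, bounded_measurable (F i)) ->
  Ex (fun x => \sum_(i <- s) F i x) = \sum_(i <- s) Ex (F i).
Proof.
move=> bF; elim: s => [|i s IH].
  by under eq_fun do rewrite big_nil; rewrite big_nil Ex_cst.
under eq_fun do rewrite big_cons.
by rewrite ExD// ?IH ?big_cons//; exact: bmf_sum.
Qed.

Lemma Ex_le f g : bounded_measurable f -> bounded_measurable g ->
  (forall x, f x <= g x) -> Ex f <= Ex g.
Proof. by move=> /bmf_integrable ? /bmf_integrable ? fg; exact: le_Rintegral. Qed.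

Lemma Ex_ge0 f : (forall x, 0 <= f x) -> 0 <= Ex f.
Proof. by move=> f0; exact: Rintegral_ge0. Qed.

Lemma Ex_norm_le f g : bounded_measurable f -> bounded_measurable g ->
  (forall x, `|f x| <= g x) -> `|Ex f| <= Ex g.
Proof.
move=> bf bg fg; rewrite ler_norml -[- Ex g]mulN1r -ExZ//.
apply/andP; split; apply: Ex_le => //; first exact: bmfZ.
- by move=> x; rewrite mulN1r; move: (fg x); rewrite ler_norml => /andP[].
- by move=> x; move: (fg x); rewrite ler_norml => /andP[].
Qed.

Lemma measurable_set_bool (b : U -> bool) : measurable_fun setT b ->
  measurable [set x | b x].
Proof.
move=> mb; rewrite (_ : [set x | b x] = setT `&` b @^-1` [set true]).
  exact: mb.
by rewrite setTI.
Qed.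

Lemma Ex_bool (b : U -> bool) : measurable_fun setT b ->
  P [set x | b x] = (Ex (fun x => (b x)%:R))%:E.
Proof.
move=> mb; rewrite -ExE; last exact: bmf_bool.
rewrite -[X in P X]setIT -(integral_indic P measurableT (measurable_set_bool mb)).
apply: eq_integral => x _; congr EFin; rewrite indicE.
by case bx: (b x); [rewrite mem_set | rewrite memNset//= bx].
Qed.

(** The integral of a nonnegative function is a supremum over the simple
    functions below it, so it is monotone in arbitrary functions; the null set is
    absorbed by changing the bounds on it. *)
Lemma integral_sandwich (Z : U -> \bar R) f g (N : set U) :
  bounded_measurable f -> bounded_measurable g -> measurable N -> P N = 0%E ->
  (forall x, 0 <= Z x)%E -> (forall x, 0 <= f x) -> (forall x, 0 <= g x) ->
  (forall x, ~ N x -> (f x)%:E <= Z x <= (g x)%:E)%E ->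
  Ex f <= fine (\int[P]_x Z x)%E <= Ex g.
Proof.
move=> bf bg mN N0 Z0 f0 g0 fZg.
have mNb : measurable_fun setT (fun x => x \in N).
  apply: (measurable_fun_bool true); rewrite setTI.
  rewrite (_ : _ @^-1` _ = N)//; apply/seteqP; split => x /=; first by move/set_mem.
  by move/mem_set.
pose h1 x := if x \in N then 0%E else (f x)%:E.
pose h2 x := if x \in N then +oo%E else (g x)%:E.
have h10 x : (0 <= h1 x)%E by rewrite /h1; case: ifP; rewrite // lee_fin.
have h20 x : (0 <= h2 x)%E by rewrite /h2; case: ifP; rewrite ?leey// lee_fin.
have mh1 : measurable_fun setT h1.
  apply: (measurable_fun_ifT mNb); first exact: measurable_cst.
  by apply/measurable_EFinP; case: bf.
have mh2 : measurable_fun setT h2.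
  apply: (measurable_fun_ifT mNb); first exact: measurable_cst.
  by apply/measurable_EFinP; case: bg.
have off (k h : U -> \bar R) : (forall x, ~ N x -> k x = h x) -> ae_eq P setT k h.
  move=> kh; exists N; split => // x /= nx; apply: contrapT => Nx.
  by apply: nx => _; exact: kh.
have I1 : (\int[P]_x h1 x = (Ex f)%:E)%E.
  rewrite -ExE//; apply: ge0_ae_eq_integral => //.
  - by apply/measurable_EFinP; case: bf.
  - by move=> x _; rewrite lee_fin.
  - by apply: (off h1 (EFin \o f)) => x Nx; rewrite /h1 memNset.
have I2 : (\int[P]_x h2 x = (Ex g)%:E)%E.
  rewrite -ExE//; apply: ge0_ae_eq_integral => //.
  - by apply/measurable_EFinP; case: bg.
  - by move=> x _; rewrite lee_fin.
  - by apply: (off h2 (EFin \o g)) => x Nx; rewrite /h2 memNset.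
have l1 : ((Ex f)%:E <= \int[P]_x Z x)%E.
  rewrite -I1 !ge0_integralTE//.
  apply: le_ereal_sup => _ [h hf <-]; exists h => // x.
  apply: le_trans (hf x) _; rewrite /h1; case: ifPn => // xN.
  by have /andP[] := fZg x (fun Nx => negP xN (mem_set Nx)).
have l2 : (\int[P]_x Z x <= (Ex g)%:E)%E.
  rewrite -I2 !ge0_integralTE//.
  apply: le_ereal_sup => _ [h hf <-]; exists h => // x.
  apply: le_trans (hf x) _; rewrite /h2; case: ifPn => [_|xN]; first exact: leey.
  by have /andP[] := fZg x (fun Nx => negP xN (mem_set Nx)).
have fin : (\int[P]_x Z x)%E \is a fin_num.
  rewrite fin_numE; apply/andP; split.
    by apply/eqP => e; move: l1; rewrite e.
  by apply/eqP => e; move: l2; rewrite e.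
by move: l1 l2; rewrite -(fineK fin) !lee_fin => -> ->.
Qed.

(** Independence makes the law of the pair a product measure, to which Fubini's
    theorem applies. *)
Lemma independent_fubini (d1 : measure_display) (V : measurableType d1)
    (Y : U -> V) (X : U -> R) (h : V * R -> R) :
  measurable_fun setT Y -> measurable_fun setT X ->
  (forall A B, measurable A -> measurable B ->
    P (Y @^-1` A `&` X @^-1` B) = (P (Y @^-1` A) * P (X @^-1` B))%E) ->
  bounded_measurable h ->
  Ex (fun w => h (Y w, X w)) = Ex (fun w => Ex (fun w' => h (Y w, X w'))).
Proof.
move=> mY mX ind bh.
have mYX : measurable_fun setT (fun w => (Y w, X w)) by exact: measurable_fun_pair.
pose fY : {mfun U >-> V} := mfun_Sub (mem_set mY).
pose fX : {mfun U >-> R} := mfun_Sub (mem_set mX).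
pose fYX : {mfun U >-> (V * R)%type} := mfun_Sub (mem_set mYX).
pose PY := distribution P fY; pose PX := distribution P fX.
pose PYX := distribution P fYX.
have E1 : (\int[PYX]_z (h z)%:E = \int[P]_w (h (Y w, X w))%:E)%E.
  rewrite /PYX /distribution integral_pushforward//=.
  - by apply/measurable_EFinP; case: bh.
  - apply: bmf_integrable; exact: (bmf_comp bh mYX).
have E2 : (\int[PYX]_z (h z)%:E = \int[PY \x PX]_z (h z)%:E)%E.
  apply: eq_measure_integral => A mA _; apply/esym.
  by apply: product_measure_unique => // B C mB mC; exact: ind.
have hi : (PY \x PX)%E.-integrable setT (EFin \o h).
  case: bh => mh [M hM]; apply: measurable_bounded_integrable => //.
    rewrite -setXTT (_ : _ (_ `*` _) = PY setT * PX setT)%E.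
      by rewrite [PY _]probability_setT [PX _]probability_setT mule1 ltry.
    exact: product_measure1E.
  exists M; split; first exact: num_real.
  by move=> x Mx y _ /=; rewrite (le_trans (hM y))// ltW.
have bh2 y : bounded_measurable (fun w => h (y, X w)).
  by apply: (bmf_comp bh); apply: measurable_fun_pair.
pose k y := Ex (fun w => h (y, X w)).
have kE y : fubini_F PX (EFin \o h) y = (k y)%:E.
  rewrite /fubini_F /PX /distribution integral_pushforward//=.
  - exact: ExE.
  - apply/measurable_EFinP; case: bh => mh _.
    by apply: measurableT_comp mh _; exact: measurable_fun_pair.
  - exact: bmf_integrable.
have bk : bounded_measurable k.
  split; last first.
    case: bh => mh [M hM]; exists M => y; rewrite -[leRHS](Ex_cst M).
    by apply: Ex_norm_le => //; exact: bmf_cst.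
  apply/measurable_EFinP; rewrite (_ : EFin \o k = fubini_F PX (EFin \o h)).
    exact: measurable_fubini_F hi.
  by apply/funext => y; rewrite kE.
have := integral12_prod_meas1 hi; rewrite -[RHS]E2 E1.
under eq_integral do rewrite kE.
rewrite /PY /distribution integral_pushforward//=; last first.
- by apply: bmf_integrable; exact: (bmf_comp bk mY).
- by apply/measurable_EFinP; case: bk.
by rewrite /Ex /Rintegral => <-.
Qed.

End Expectation.

(** * Averaging over one coordinate of an independent family *)

Section Independence.
Context (R : realType) (d : measure_display) (U : measurableType d)
  (P : probability U R) (I : eqType) (X : I -> U -> R).

Definition cylinders (s : seq I) : set (set U) :=
  [set F | exists A : I -> set R, (forall i, measurable (A i)) /\
     F = [set w | forall i, i \in s -> A i (X i w)]].

(** The information carried by the coordinates in [s], as a measurable space: a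
    function is determined by them when it is measurable from this space. *)
Definition known_by (s : seq I) := g_sigma_algebraType (cylinders s).

Hypothesis mX : forall i, measurable_fun setT (X i).

Lemma measurable_cylinder s F : cylinders s F -> measurable F.
Proof.
move=> [A [mA ->]].
elim: s => [|j s IH]; first by rewrite (_ : [set w | _] = setT)//; apply/seteqP.
rewrite (_ : [set w | _] =
    X j @^-1` A j `&` [set w | forall i, i \in s -> A i (X i w)]).
  apply: measurableI => //; rewrite -[X in measurable X]setTI.
  exact: mX.
apply/seteqP; split => w /=.
  by move=> h; split; [|move=> i si]; apply: h; rewrite inE ?eqxx// si orbT.
by move=> [hj h] i; rewrite inE => /orP[/eqP -> //|]; exact: h.
Qed.

Lemma sigma_cylinders_measurable s : <<s cylinders s >> `<=` measurable.
Proof. by apply: smallest_sub => [|F]; [exact: sigma_algebra_measurable|exact: measurable_cylinder]. Qed.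

Lemma known_by_coordinate s i : i \in s ->
  measurable_fun (setT : set (known_by s)) (X i).
Proof.
move=> si _ B mB; rewrite setTI; apply: sub_sigma_algebra.
exists (fun k => if k == i then B else setT); split.
  by move=> k; case: ifP.
apply/seteqP; split => w /=.
  by move=> Bw k _; case: eqP => // ->.
by move=> /(_ i si); rewrite eqxx.
Qed.

Lemma known_by_measurable (d1 : measure_display) (V : measurableType d1)
    s (Y : U -> V) :
  measurable_fun (setT : set (known_by s)) Y -> measurable_fun setT Y.
Proof. by move=> mY _ B mB; apply: (@sigma_cylinders_measurable s); exact: mY. Qed.

Lemma known_by_sub (d1 : measure_display) (V : measurableType d1)
    s s' (Y : U -> V) : {subset s <= s'} ->
  measurable_fun (setT : set (known_by s)) Y ->
  measurable_fun (setT : set (known_by s')) Y.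
Proof.
move=> ss' mY _ B mB.
have : <<s cylinders s >> (setT `&` Y @^-1` B) by exact: mY.
apply: smallest_sub; first exact: smallest_sigma_algebra.
move=> F [A [mA ->]]; apply: sub_sigma_algebra.
exists (fun i => if i \in s then A i else setT); split.
  by move=> i; case: ifP.
apply/seteqP; split => w /= h i.
  by move=> _; case: ifP => // /h.
by move=> si; have := h i (ss' _ si); rewrite si.
Qed.

Hypothesis indX : mutually_independent P X.

(** Dynkin's pi-lambda argument: the product rule on cylinders extends to the
    sigma-algebra that they generate. *)
Lemma independent_of_known s j F B : uniq s -> j \notin s ->
  <<s cylinders s >> F -> measurable B ->
  P (F `&` X j @^-1` B) = (P F * P (X j @^-1` B))%E.
Proof.
move=> us js sF mB.
have mXB : measurable (X j @^-1` B).
  by rewrite -[X in measurable X]setTI; exact: mX.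
move: F sF.
apply: (@dynkin_induction _ (known_by s) (cylinders s)) => //.
- move=> _ _ [A [mA ->]] [A' [mA' ->]].
  exists (fun i => A i `&` A' i); split; first by move=> i; exact: measurableI.
  apply/seteqP; split => w /=.
    by move=> [h1 h2] i si; split; [exact: h1|exact: h2].
  by move=> h; split => i si; have [] := h i si.
- rewrite setTI (_ : P setT = 1%E) ?mul1e//; exact: probability_setT.
- move=> F [A [mA ->]].
  pose A' i := if i == j then B else A i.
  have A'E i : i \in s -> A' i = A i.
    by rewrite /A'; case: eqP => // ->; rewrite (negbTE js).
  have mA' i : measurable (A' i) by rewrite /A'; case: ifP.
  have /= := indX (s := j :: s) (A := A') _ mA'.
  rewrite js us => /(_ isT); rewrite big_cons {2}/A' eqxx.
  rewrite muleC; rewrite (_ : (\prod_(i <- s) _)%E =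
      (\prod_(i <- s) P (X i @^-1` A i))%E); last first.
    by apply: eq_big_seq => i si; rewrite A'E.
  rewrite -(indX us mA) => <-; congr (P _).
  apply/seteqP; split => w /=.
    move=> [h Bw] i; rewrite inE => /orP[/eqP ->|si].
      by rewrite /A' eqxx.
    by rewrite A'E//; exact: h.
  move=> h; split.
    by move=> i si; have := h i; rewrite inE si orbT A'E//; exact.
  by have := h j; rewrite inE eqxx => /(_ isT); rewrite /A' eqxx.
- move=> F /sigma_cylinders_measurable mF FE.
  have e : (~` F) `&` X j @^-1` B = X j @^-1` B `\` (F `&` X j @^-1` B).
    by rewrite setDIr setDv setU0 setIC setDE.
  have e2 : X j @^-1` B `&` (F `&` X j @^-1` B) = F `&` X j @^-1` B.
    by rewrite setIC -setIA setIid.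
  have e3 : P (X j @^-1` B `\` (F `&` X j @^-1` B)) =
      (P (X j @^-1` B) - P (F `&` X j @^-1` B))%E.
    rewrite -[in RHS]e2; apply: measureD => //; first exact: measurableI.
    exact: le_lt_trans (probability_le1 P mXB) (ltry _).
  rewrite e e3 FE.
  rewrite (_ : P (~` F) = 1 - P F)%E; last exact: probability_setC.
  rewrite muleBl ?mul1e//; first exact: fin_num_measure.
- move=> F mF tF FE.
  have mF' n : @measurable d U (F n) by apply: (@sigma_cylinders_measurable s); exact: mF.
  have e1 : P (\bigcup_k F k) = (\sum_(0 <= k <oo | k \in setT) P (F k))%E.
    exact: measure_bigcup.
  have e2 : P (\bigcup_k F k `&` X j @^-1` B) =
      (\sum_(0 <= k <oo | k \in setT) P (F k `&` X j @^-1` B))%E.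
    rewrite setI_bigcupl; apply: measure_bigcup => //.
      by move=> i _; exact: measurableI.
    apply/trivIsetP => i k _ _ ik; rewrite setIACA setIid.
    by move/trivIsetP : tF => /(_ i k Logic.I Logic.I ik) ->; rewrite set0I.
  have qfin : P (X j @^-1` B) \is a fin_num by exact: fin_num_measure.
  rewrite e2 e1 muleC; move: FE; rewrite -(fineK qfin) => FE.
  under eq_eseriesr do rewrite FE muleC.
  by rewrite nneseriesZl.
Qed.

(** Expectations can be computed by averaging first over a coordinate
    independent of everything else. *)
Lemma average_independent (d1 : measure_display) (V : measurableType d1)
    (s : seq I) (j : I) (Y : U -> V) (h : V * R -> R) : uniq s -> j \notin s ->
  measurable_fun (setT : set (known_by s)) Y -> bounded_measurable h ->
  Ex P (fun w => h (Y w, X j w)) =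
  Ex P (fun w => Ex P (fun w' => h (Y w, X j w'))).
Proof.
move=> us js mY bh; apply: independent_fubini => //.
  exact: known_by_measurable mY.
move=> A B mA mB; apply: (independent_of_known us) => //.
by rewrite -[X in <<s _ >> X]setTI; exact: mY.
Qed.

End Independence.

(** * The layer-cake formula *)

Section FundamentalTheorem.
Context (R : realType).
Local Notation mu := (@lebesgue_measure R).

Lemma ftc_segment (F f : R -> R) (a b : R) : a <= b ->
  {within `[a, b], continuous f} -> {within `[a, b], continuous F} ->
  (forall x, a < x < b -> is_derive x 1 F (f x)) ->
  (\int[mu]_(x in `[a, b]) (f x)%:E = (F b - F a)%:E)%E.
Proof.
rewrite le_eqVlt => /predU1P[<- _ _ _|ab cf cF dF].
  by rewrite set_itv1 integral_set1 subrr.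
rewrite EFinB; apply: continuous_FTC2 => //.
  have /(continuous_within_itvP _ ab)[_ Fa Fb] := cF.
  by split => // x; rewrite in_itv /= => /dF [].
by move=> x; rewrite in_itv /= => /dF [? dFx]; rewrite derive1E.
Qed.

Context (d : measure_display) (U : measurableType d) (P : probability U R).

(** Layer-cake formula: write a smooth function of the excess [X - a], capped at
    [L], as the integral of its derivative and exchange integrals, so that only
    the tail [Fb s = P (a + s < X)] matters. Its right-hand side is evaluated by
    exhibiting an antiderivative [Phi]. *)
Lemma layer_cake (X : U -> R) (a L : R) (Fb phi dphi Phi : R -> R) :
  measurable_fun setT X -> 0 <= L ->
  (forall s, 0 <= s <= L -> Ex P (fun w => (a + s < X w)%R%:R) = Fb s) ->
  continuous dphi ->
  (forall s : R, is_derive s 1 phi (dphi s)) ->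
  {within `[0, L], continuous Fb} -> {within `[0, L], continuous Phi} ->
  (forall s : R, 0 < s < L -> is_derive s 1 Phi (dphi s * Fb s)) ->
  bounded_measurable
    (fun w => (a < X w)%R%:R * phi (Num.min (X w - a) L)) /\
  Ex P (fun w => (a < X w)%R%:R * phi (Num.min (X w - a) L)) =
    phi 0 * Fb 0 + Phi L - Phi 0.
Proof.
move=> mX L0 FbE cdphi dphiE cFb cPhi dPhi.
have cphi : continuous phi.
  by move=> s; apply: differentiable_continuous; apply/derivable1_diffP; case: (dphiE s).
pose f (z : U * R) := ((z.2 \in `[0, L])%:R * dphi z.2 * (a + z.2 < X z.1)%R%:R).
have mitv : measurable_fun setT (fun s : R => s \in `[0, L]).
  under eq_fun do rewrite in_itv /=.
  by apply: measurable_and; apply: measurable_fun_ler => //; exact: measurable_cst.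
have mf : measurable_fun setT (EFin \o f).
  apply/measurable_EFinP; apply: measurable_funM; first apply: measurable_funM.
  - apply: measurable_bool_natr; exact: (measurableT_comp mitv measurable_snd).
  - apply: (measurableT_comp _ measurable_snd).
    exact: continuous_measurable_fun.
  - apply: measurable_bool_natr; apply: measurable_fun_ltr.
      by apply: measurable_funD => //; exact: measurable_snd.
    exact: (measurableT_comp mX measurable_fst).
pose g s := ((s \in `[0, L])%:R * dphi s).
have icst : mu.-integrable `[0, L] (EFin \o dphi).
  apply: continuous_compact_integrable; first exact: segment_compact.
  exact: continuous_subspaceT.
have gE : EFin \o g = (EFin \o dphi) \_ `[0, L].
  apply/funext => s; rewrite patchE /g /= mem_setE.
  by case: (_ \in _); rewrite ?mul1r ?mul0r.
have ig : mu.-integrable setT (EFin \o g).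
  by rewrite gE; apply/(integrable_mkcond _ _).1.
have ifz : (P \x mu)%E.-integrable setT (EFin \o f).
  apply/integrable12ltyP => //.
  pose I0 := (\int[mu]_s `|(g s)%:E|)%E.
  have I0lty : (I0 < +oo)%E by have /integrableP[] := ig.
  have I0ge : (0 <= I0)%E by apply: integral_ge0 => s _.
  apply: (@le_lt_trans _ _ (\int[P]_w I0)%E); last first.
    rewrite integral_cst// (_ : _ setT = 1%E) ?mule1//; exact: probability_setT.
  apply: ge0_le_integral => //.
  - by move=> w _; apply: integral_ge0.
  - have mff : measurable_fun setT (abse \o (EFin \o f)) by exact: measurableT_comp.
    by apply: (@measurable_fun_fubini_tonelli_F _ _ _ _ _ mu _ mff) => z; exact: abse_ge0.
  - move=> w _; apply: ge0_le_integral => //.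
    + apply: measurableT_comp => //.
      exact: (measurable_fun_pair2 w mf).
    + by apply: measurableT_comp => //; have /integrableP[] := ig.
    + move=> s _; rewrite /f /g /= lee_fin normrM ler_piMr//.
      by case: (a + s < X w); rewrite ?normr1 ?normr0.
have E1 w : (\int[mu]_s (f (w, s))%:E =
    ((a < X w)%R%:R * (phi (Num.min (X w - a) L) - phi 0))%:E)%E.
  rewrite /f /=; have [aX|Xa] := ltP a (X w); last first.
    rewrite mul0r; apply: integral0_eq => s _; rewrite in_itv /=.
    have [s0|_] := leP 0 s; last by rewrite !mul0r.
    by rewrite ltNge (le_trans Xa) ?lerDl// mulr0.
  set t := Num.min (X w - a) L.
  have t0 : 0 <= t by rewrite le_min L0 subr_ge0 ltW.
  rewrite mul1r.
  have <- : (\int[mu]_(x in `[0%R, t]) (dphi x)%:E = (phi t - phi 0)%R%:E)%E.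
    apply: ftc_segment => //; first exact: continuous_subspaceT.
    exact: continuous_subspaceT.
  have [XL|LX] := leP (X w - a) L.
    have tE : t = X w - a by rewrite /t; apply/min_idPl.
    rewrite -integral_itv_bndo_bndc; last first.
      apply/measurable_EFinP; apply: measurable_funTS.
      exact: continuous_measurable_fun.
    rewrite [RHS]integral_mkcond; apply: eq_integral => s _.
    rewrite patchE mem_setE !in_itv /= -ltrBrDl -tE.
    have [s0|//] := leP 0 s; last by rewrite !mul0r.
    have [st|ts] := ltP s t; last by rewrite mulr0.
    by rewrite (le_trans (ltW st)) ?tE// mul1r mulr1.
  have tE : t = L by rewrite /t; apply/min_idPr; exact: ltW.
  rewrite [RHS]integral_mkcond; apply: eq_integral => s _.
  rewrite patchE mem_setE !in_itv /= -ltrBrDl tE.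
  have [/andP[s0 sL]|] := boolP (0 <= s <= L); last by rewrite !mul0r.
  by rewrite (le_lt_trans sL)// mul1r mulr1.
have [M phiM] : exists M, forall s, 0 <= s <= L -> `|phi s| <= M.
  have [|c _ cM] := @EVT_max R (fun s => `|phi s|) 0 L L0.
    apply: continuous_subspaceT => s.
    by apply: (@continuous_comp _ _ _ phi Num.norm); [exact: cphi|exact: norm_continuous].
  by exists `|phi c| => s sL; apply: cM; rewrite in_itv.
have maX : measurable_fun setT (fun w => a < X w).
  by apply: measurable_fun_ltr => //; exact: measurable_cst.
have bI : bounded_measurable (fun w => (a < X w)%R%:R : R) by exact: bmf_bool.
have bphi : bounded_measurable
    (fun w => (a < X w)%R%:R * phi (Num.min (X w - a) L)).
  split.
    apply: measurable_funM; first by case: bI.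
    apply: (measurableT_comp (continuous_measurable_fun cphi)).
    apply: measurable_minr; last exact: measurable_cst.
    by apply: measurable_funB => //; exact: measurable_cst.
  exists M => w; have [aX|Xa] := ltP a (X w).
    rewrite mul1r; apply: phiM; rewrite le_min L0 subr_ge0 (ltW aX) /=.
    by rewrite ge_min lexx orbT.
  by rewrite mul0r normr0; apply: le_trans (phiM 0 _); rewrite ?lexx.
split=> //.
have := Fubini ifz => /=.
under eq_integral do rewrite E1.
rewrite ExE; last first.
  under eq_fun do rewrite mulrBr.
  apply: bmfB => //; under eq_fun do rewrite mulrC.
  exact: bmfZ.
under [in RHS]eq_integral => s _.
  rewrite ExE; last first.
    by rewrite /f /=; apply/bmfZ/bmf_bool; apply: measurable_fun_ltr.
  rewrite /f /= ExZ; last first.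
    by apply/bmf_bool; apply: measurable_fun_ltr.
  rewrite (_ : (_ * _)%:E = ((fun s => (dphi s * Fb s)%:E) \_ `[0, L]) s); last first.
    rewrite patchE mem_setE /=; case: ifPn => sL; last by rewrite !mul0r.
    by rewrite mul1r FbE//; move: sL; rewrite in_itv.
  over.
rewrite -integral_mkcond (ftc_segment (F := Phi))//; last first.
  move=> s; apply: (@cvgM _ (subspace _)); last exact: cFb.
  by apply: continuous_subspaceT => ?; exact: cdphi.
move=> [].
under eq_fun do rewrite mulrBr.
rewrite ExB//; last by under eq_fun do rewrite mulrC; exact: bmfZ.
have -> : Ex P (fun w => (a < X w)%R%:R * phi 0) = phi 0 * Fb 0.
  under eq_fun do rewrite mulrC.
  by rewrite ExZ// -FbE ?lexx//; congr (_ * Ex P _); apply/funext => w; rewrite addr0.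
by move=> e; rewrite -addrA -e addrCA subrr addr0.
Qed.

End FundamentalTheorem.

(** * Complex exponentials and their real parts *)

Section ComplexExponential.
Context (R : realType).
Local Notation C := R[i].
Local Notation "x %:C" := (real_complex R x) : ring_scope.
Implicit Types (z p : C) (s u : R).

Lemma cexpD z p : cexp (z + p) = cexp z * cexp p.
Proof.
case: z p => [a b] [c d]; rewrite /cexp /= expRD cosD sinD.
by apply/eqP; rewrite eq_complex /=; apply/andP; split; apply/eqP; ring.
Qed.

Lemma cexp0 : cexp (0 : C) = 1.
Proof.
rewrite /cexp /= expR0 cos0 sin0.
by apply/eqP; rewrite eq_complex /=; apply/andP; split; apply/eqP; ring.
Qed.

Lemma cexpN_mul z : cexp (- z) * cexp z = 1.
Proof. by rewrite -cexpD addNr cexp0. Qed.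

Lemma cexp_neq0 z : cexp z != 0.
Proof.
apply/eqP => e; have := cexpN_mul z.
by rewrite e mulr0 => /eqP; rewrite eq_sym oner_eq0.
Qed.

Lemma ReD z p : complex.Re (z + p) = complex.Re z + complex.Re p.
Proof. by case: z; case: p. Qed.

Lemma ReB z p : complex.Re (z - p) = complex.Re z - complex.Re p.
Proof. by case: z; case: p. Qed.

Lemma Re_sum (I : Type) (r : seq I) (F : I -> C) :
  complex.Re (\sum_(i <- r) F i) = \sum_(i <- r) complex.Re (F i).
Proof. by elim: r => [|i r IH]; rewrite ?big_nil// !big_cons ReD IH. Qed.

Lemma ReMr z u : complex.Re (z * u%:C) = complex.Re z * u.
Proof. by case: z => a b /=; ring. Qed.

(** Value functions are real, their coefficients complex: scaling the
    coefficients by an arbitrary [y] recovers a complex identity from real ones.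
    *)
Lemma Re_eq0 z : (forall y : C, complex.Re (y * z) = 0) -> z = 0.
Proof.
move=> h; have := h 1; have := h (Complex 0 1); case: z h => a b _ /=.
rewrite !mul0r !mul1r sub0r subr0 => /eqP; rewrite oppr_eq0 => /eqP -> ->.
by [].
Qed.

(** Real parts of exponential monomials: they span the value functions and are
    closed under differentiation. *)
Definition expw z p s : R := complex.Re (z * cexp (- p * s%:C)).

Lemma is_derive_expw z p s : is_derive s 1 (expw z p) (expw (- p * z) p s).
Proof.
case: z p => [a b] [c d].
have E : expw (Complex a b) (Complex c d) = fun s => expR (- c * s) * (a * cos (d * s) + b * sin (d * s)).
  apply/funext => u; rewrite /expw /cexp /= !mulr0 add0r subr0 !mulNr cosN sinN; ring.
rewrite E; apply: is_derive_eq.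
rewrite /expw /cexp /= !mulr0 add0r subr0 !mulNr cosN sinN /GRing.scale /=; ring.
Qed.

Lemma expw0 z p : expw z p 0 = complex.Re z.
Proof. by rewrite /expw mulr0 cexp0 mulr1. Qed.

Lemma expw_shift z p u s : expw z p (u + s) = expw (z * cexp (- p * u%:C)) p s.
Proof. by rewrite /expw rmorphD mulrDr cexpD mulrA. Qed.

Lemma continuous_expw z p : continuous (expw z p).
Proof.
move=> s; apply: differentiable_continuous; apply/derivable1_diffP.
by case: (is_derive_expw z p s).
Qed.

End ComplexExponential.

(** * Resolvents of the phase generator *)

Section Resolvent.
Context (R : realType) (n : nat) (T : 'M[R]_n).
Local Notation C := R[i].
Local Notation rc := (real_complex R).
Local Notation one := (const_mx 1 : 'cV[C]_n).

(** Entry [j] is the transform of the phase-type law started in phase [j]. *)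
Definition exit_transform (s : C) : 'cV[C]_n :=
  invmx (resolvent_arg T s) *m map_mx rc (exit_vector T).

Lemma phase_type_LTE (alpha : 'cV[R]_n) s :
  phase_type_LT alpha T s = \sum_i rc (alpha i 0) * exit_transform s i 0.
Proof.
rewrite /phase_type_LT -mulmxA mxE; apply: eq_bigr => i _.
by rewrite !mxE.
Qed.

Lemma h_exit_transform (p : 'I_n.+1 -> C) k j :
  h T p k (lift ord0 j) = exit_transform (p k) j 0.
Proof.
rewrite /h liftK phase_type_LTE (bigD1 j)//= big1 ?addr0.
  by rewrite mxE !eqxx rmorph1 mul1r.
by move=> i ij; rewrite mxE (negbTE ij) rmorph0 mul0r.
Qed.

Lemma map_exit_vector : map_mx rc (exit_vector T) = - (map_mx rc T *m one).
Proof. by rewrite /exit_vector map_mxN map_mxM map_const_mx rmorph1. Qed.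

Section AtPoint.
Variables (s : C) (us : resolvent_arg T s \in unitmx).

Lemma resolvent_one :
  s *: (invmx (resolvent_arg T s) *m one) = one - exit_transform s.
Proof.
apply/eqP; rewrite eq_sym subr_eq; apply/eqP.
rewrite /exit_transform scalemxAr -mulmxDr map_exit_vector.
rewrite -mul_scalar_mx -mulmxBl.
by rewrite mulmxA mulVmx// mul1mx.
Qed.

Lemma mulmx_resolvent :
  map_mx rc T *m invmx (resolvent_arg T s) =
  s *: invmx (resolvent_arg T s) - 1%:M.
Proof.
rewrite -(mulmxV us) -mul_scalar_mx -mulmxBl.
by congr (_ *m _); rewrite /resolvent_arg opprB addrCA subrr addr0.
Qed.

(** Multiplying by [T] acts on exit transforms as multiplication by [s], up to a
    vector that does not depend on [s]; this is how linear relations between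
    exit transforms at several roots are turned into others. *)
Lemma mulmx_exit_transform :
  map_mx rc T *m exit_transform s =
  s *: exit_transform s - map_mx rc (exit_vector T).
Proof.
by rewrite /exit_transform mulmxA mulmx_resolvent mulmxBl mul1mx scalemxAl.
Qed.

Lemma resolvent_comm (A : 'M[C]_n) : A *m map_mx rc T = map_mx rc T *m A ->
  A *m invmx (resolvent_arg T s) = invmx (resolvent_arg T s) *m A.
Proof.
move=> AT; have AR : A *m resolvent_arg T s = resolvent_arg T s *m A.
  by rewrite /resolvent_arg mulmxBr mulmxBl AT scalar_mxC.
rewrite -[LHS]mul1mx -(mulVmx us) -!mulmxA; congr (_ *m _).
by rewrite mulmxA -AR -mulmxA mulmxV// mulmx1.
Qed.

End AtPoint.
End Resolvent.

Section Moments.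
Context (R : realType) (n : nat) (T : 'M[R]_n).
Local Notation C := R[i].
Local Notation rc := (real_complex R).

(** The equation [phi s = q] turns a linear relation between the transforms at
    the roots into one between the next powers of the roots; so all moments of
    [a] vanish, and interpolation at the distinct roots gives [a = 0]. *)
Lemma roots_independent (r1 lambda q : R) (alpha : 'cV[R]_n)
    (p : 'I_n.+1 -> C) (a : 'I_n.+1 -> C) :
  r1 != 0 -> distinct_roots r1 lambda alpha T q p ->
  \sum_k a k = 0 -> (forall j, \sum_k a k * h T p k (lift ord0 j) = 0) ->
  forall k, a k = 0.
Proof.
move=> r10 [pinj proots] a0 ah.
have pk k : resolvent_arg T (p k) \in unitmx /\ phi r1 lambda alpha T (p k) = rc q.
  by apply/proots; exists k.
have mom m : \sum_k a k * p k ^+ m = 0 /\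
    \sum_k (a k * p k ^+ m) *: exit_transform T (p k) = 0.
  elim: m => [|m [IH1 IH2]].
    split; first by under eq_bigr do rewrite expr0 mulr1.
    apply/colP => j; rewrite summxE mxE -[RHS](ah j); apply: eq_bigr => k _.
    by rewrite expr0 mulr1 mxE h_exit_transform.
  split.
    have r10' : rc r1 != 0 by rewrite fmorph_eq0.
    apply: (mulfI r10'); rewrite mulr0 mulr_sumr.
    have E k : rc r1 * (a k * p k ^+ m.+1) = (- rc lambda - rc q) * (a k * p k ^+ m)
        + rc lambda * \sum_i rc (alpha i 0) * ((a k * p k ^+ m) *: exit_transform T (p k)) i 0.
      have [_] := pk k; rewrite /phi phase_type_LTE => <-.
      under [X in _ = _ + _ * X]eq_bigr do rewrite mxE mulrCA.
      rewrite -mulr_sumr exprSr; ring.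
    under eq_bigr do rewrite E.
    rewrite big_split /= -mulr_sumr IH1 mulr0 add0r -mulr_sumr exchange_big /=.
    rewrite big1 ?mulr0// => i _; rewrite -mulr_sumr.
    move/colP/(_ i) : IH2; rewrite summxE mxE => ->; exact: mulr0.
  have := congr1 (fun v => map_mx rc T *m v) IH2.
  rewrite mulmx0 mulmx_sumr.
  under eq_bigr => k _.
    rewrite -scalemxAr mulmx_exit_transform ?(pk k).1// scalerBr scalerA -mulrA -exprSr.
    over.
  rewrite sumrB -[X in _ - X]scaler_suml IH1 scale0r subr0; exact.
have hor (P : {poly C}) : \sum_k a k * P.[p k] = 0.
  under eq_bigr do rewrite horner_coef mulr_sumr.
  rewrite exchange_big /= big1// => i _.
  under eq_bigr do rewrite mulrCA.
  by rewrite -mulr_sumr (mom i).1 mulr0.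
move=> k; pose P := \prod_(j | j != k) ('X - (p j)%:P).
have Pj j : j != k -> P.[p j] = 0.
  by move=> jk; rewrite /P horner_prod (bigD1 j)//= hornerXsubC subrr mul0r.
have Pk : P.[p k] != 0.
  rewrite /P horner_prod; apply/prodf_neq0 => j jk.
  by rewrite hornerXsubC subr_eq0 (inj_eq pinj) eq_sym.
have := hor P; rewrite (bigD1 k)//= (big1 _ (fun i => i != k)) ?addr0; last first.
  by move=> j jk; rewrite Pj// mulr0.
by move/eqP; rewrite mulf_eq0 (negbTE Pk) orbF => /eqP.
Qed.

End Moments.

Section Subgenerator.
Context (R : realType) (n : nat) (T : 'M[R]_n) (alpha : 'cV[R]_n).

(** Every phase is transient, so no nonzero vector is harmonic: the set where [|w|] is
    maximal would be closed under transitions and have no exit. *)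
Lemma subgenerator_unit : phase_type_representation alpha T -> T \in unitmx.
Proof.
move=> [_ _ T0 t0 tr]; rewrite unitmxE unitfE -det_tr; apply/negP => /det0P[v v0 vT].
pose w := v^T; have Tw : T *m w = 0.
  by apply: trmx_inj; rewrite trmx_mul /w trmxK vT trmx0.
have [j wj] : exists j, w j 0 != 0.
  apply: contrapT => h; move: v0; apply/negP; rewrite negbK; apply/eqP/rowP => j.
  rewrite mxE; apply: contrapT => vj; apply: h; exists j; rewrite mxE.
  exact/eqP.
pose i0 := [arg max_(i > j) `|w i 0|]%O.
pose m := `|w i0 0|.
have wm i : `|w i 0| <= m.
  by rewrite /m /i0; case: arg_maxP => // k _ /(_ i isT).
have m0 : 0 < m by apply: lt_le_trans (wm j); rewrite normr_gt0.
have tE i : exit_vector T i 0 = - \sum_k T i k.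
  by rewrite /exit_vector !mxE; congr (- _); apply: eq_bigr => k _; rewrite mxE mulr1.
have key i : `|w i 0| = m ->
    exit_vector T i 0 * m + \sum_(k | k != i) T i k * (m - `|w k 0|) <= 0.
  move=> wi.
  have e : T i i * w i 0 + \sum_(k | k != i) T i k * w k 0 = 0.
    by have /colP/(_ i) := Tw; rewrite [LHS]mxE [RHS]mxE (bigD1 i).
  have Tii : - T i i = exit_vector T i 0 + \sum_(k | k != i) T i k.
    by rewrite tE (bigD1 i)//= opprD addrNK.
  have Tii0 : 0 <= - T i i.
    by rewrite Tii addr_ge0// sumr_ge0// => k ki; rewrite T0// eq_sym.
  have : (- T i i) * m <= \sum_(k | k != i) T i k * `|w k 0|.
    rewrite -{1}wi -(ger0_norm Tii0) -normrM mulNr.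
    have -> : - (T i i * w i 0) = \sum_(k | k != i) T i k * w k 0.
      by apply/eqP; rewrite eq_sym -addr_eq0 addrC; apply/eqP.
    apply: le_trans (ler_norm_sum _ _ _) _; apply: ler_sum => k ki.
    by rewrite normrM ger0_norm// T0// eq_sym.
  rewrite Tii mulrDl mulr_suml => le.
  under [X in _ + X <= 0]eq_bigr do rewrite mulrBr.
  by rewrite sumrB addrA subr_le0.
have clos i k : `|w i 0| = m -> 0 < T i k -> `|w k 0| = m.
  move=> wi Tik; have [<-//|ki] := eqVneq i k.
  have := key i wi; rewrite (bigD1 k) 1?eq_sym//=.
  have a1 : 0 <= exit_vector T i 0 * m by rewrite mulr_ge0// ltW.
  have a2 : 0 <= \sum_(j0 | (j0 != i) && (j0 != k)) T i j0 * (m - `|w j0 0|).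
    apply: sumr_ge0 => l /andP[li _]; rewrite mulr_ge0 ?subr_ge0//.
    by rewrite T0// eq_sym.
  move=> le; have le2 : T i k * (m - `|w k 0|) <= 0 by lra.
  move: le2; rewrite pmulr_rle0// subr_le0 => le2.
  by apply/eqP; rewrite eq_le wm.
have path_clos s i : `|w i 0| = m -> path (fun k l => 0 < T k l) i s ->
    `|w (last i s) 0| = m.
  elim: s i => //= k s IH i wi /andP[Tik]; apply: IH; exact: clos Tik.
have [k /connectP[s ps kE] tk] := tr i0.
have wk : `|w k 0| = m by rewrite kE; exact: path_clos ps.
have := key k wk; rewrite leNgt => /negP; apply.
apply: ltr_pwDl; first exact: mulr_gt0.
apply: sumr_ge0 => l li; rewrite mulr_ge0 ?subr_ge0//.
by rewrite T0// eq_sym.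
Qed.

Lemma map_unit_ker (w : 'cV[R[i]]_n) : T \in unitmx ->
  map_mx (real_complex R) T *m w = 0 -> w = 0.
Proof.
move=> uT Tw; have uTC : map_mx (real_complex R) T \in unitmx by rewrite map_unitmx.
by rewrite -[w]mul1mx -(mulVmx uTC) -mulmxA Tw mulmx0.
Qed.

End Subgenerator.

(** * Linear systems and maximal minors *)

Section LinearSystems.
Context (F : fieldType) (n : nat).

Lemma unitmx_of_kernel (m : nat) (M : 'M[F]_m) :
  (forall b : 'rV[F]_m, b *m M = 0 -> b = 0) -> M \in unitmx.
Proof.
move=> ker; rewrite unitmxE unitfE; apply/negP => /det0P[v v0 /ker ve].
by rewrite ve eqxx in v0.
Qed.

Let aug (v : 'cV[F]_n.+1) (A : 'M[F]_(n.+1, n)) : 'M[F]_n.+1 :=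
  \matrix_(k, j) (if unlift ord0 j is Some j' then A k j' else v k 0).

Let aug0 v A k : aug v A k ord0 = v k 0.
Proof. by rewrite mxE unlift_none. Qed.

Let augS v A k j : aug v A k (lift ord0 j) = A k j.
Proof. by rewrite mxE liftK. Qed.

Let aug_unit (v : 'cV[F]_n.+1) (A : 'M[F]_(n.+1, n)) :
  (forall b : 'I_n.+1 -> F, \sum_k b k * v k 0 = 0 ->
     (forall j, \sum_k b k * A k j = 0) -> forall k, b k = 0) ->
  aug v A \in unitmx.
Proof.
move=> ker; apply: unitmx_of_kernel => b bM; apply/rowP => k; rewrite [RHS]mxE.
apply: (ker (fun k => b 0 k)) => [|j].
  have /rowP/(_ ord0) := bM; rewrite [LHS]mxE [RHS]mxE => e.
  by rewrite -[RHS]e; apply: eq_bigr => i _; rewrite aug0.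
have /rowP/(_ (lift ord0 j)) := bM; rewrite [LHS]mxE [RHS]mxE => e.
by rewrite -[RHS]e; apply: eq_bigr => i _; rewrite augS.
Qed.

(** Duality: pairing the solution [(z, l)] of the column system with a solution
    [b] of the transposed row system evaluates the total weight of [b]. *)
Lemma column_system (v : 'cV[F]_n.+1) (A : 'M[F]_(n.+1, n)) :
  (forall b : 'I_n.+1 -> F, \sum_k b k * v k 0 = 0 ->
     (forall j, \sum_k b k * A k j = 0) -> forall k, b k = 0) ->
  exists (z : 'rV[F]_n) (l : F),
  [/\ forall k, \sum_j z 0 j * A k j + v k 0 * l = 1,
      forall (z' : 'rV[F]_n) (l' : F), (forall k, \sum_j z' 0 j * A k j + v k 0 * l' = 1) ->
        z' = z /\ l' = l
    & forall G : 'I_n -> F, exists b : 'I_n.+1 -> F,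
      [/\ \sum_k b k * v k 0 = 0, forall j, \sum_k b k * A k j = G j
        & \sum_k b k = \sum_j z 0 j * G j]].
Proof.
move=> /aug_unit uM; set M := aug v A in uM.
have sysE (z : 'rV[F]_n) (l : F) (y : 'cV[F]_n.+1) : y ord0 0 = l ->
    (forall j, y (lift ord0 j) 0 = z 0 j) -> forall k,
    \sum_j z 0 j * A k j + v k 0 * l = (M *m y) k 0.
  move=> y0 yS k; rewrite mxE big_ord_recl aug0 y0 addrC; congr (_ + _).
  by apply: eq_bigr => j _; rewrite augS yS mulrC.
pose y : 'cV[F]_n.+1 := invmx M *m const_mx 1.
have My : M *m y = const_mx 1 by rewrite mulmxA mulmxV// mul1mx.
pose z := (\row_j y (lift ord0 j) 0) : 'rV[F]_n.
have zs k : \sum_j z 0 j * A k j + v k 0 * y ord0 0 = 1.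
  rewrite (sysE z (y ord0 0) y erefl); first by rewrite My mxE.
  by move=> j; rewrite [RHS]mxE.
exists z, (y ord0 0); split => //.
  move=> z' l' h.
  pose y' : 'cV[F]_n.+1 := \col_k (if unlift ord0 k is Some j then z' 0 j else l').
  have y'0 : y' ord0 0 = l' by rewrite mxE unlift_none.
  have y'S j : y' (lift ord0 j) 0 = z' 0 j by rewrite mxE liftK.
  have y'E : y' = y.
    rewrite /y -[LHS]mul1mx -(mulVmx uM) -mulmxA; congr (_ *m _).
    by apply/colP => k; rewrite -(sysE z' l')// h mxE.
  split; last by rewrite -y'E.
  by apply/rowP => j; rewrite mxE -y'E.
move=> G; pose g : 'rV[F]_n.+1 := \row_k (if unlift ord0 k is Some j then G j else 0).
pose b := g *m invmx M.
have bM : b *m M = g by rewrite -mulmxA mulVmx// mulmx1.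
have b0 : \sum_k b 0 k * v k 0 = 0.
  have /rowP/(_ ord0) := bM; rewrite [LHS]mxE [RHS]mxE unlift_none => e.
  by rewrite -[RHS]e; apply: eq_bigr => i _; rewrite aug0.
have bG j : \sum_k b 0 k * A k j = G j.
  have /rowP/(_ (lift ord0 j)) := bM; rewrite [LHS]mxE [RHS]mxE liftK => e.
  by rewrite -[RHS]e; apply: eq_bigr => i _; rewrite augS.
exists (fun k => b 0 k); split => //.
transitivity (\sum_k b 0 k * (\sum_j z 0 j * A k j + v k 0 * y ord0 0)).
  by apply: eq_bigr => k _; rewrite zs mulr1.
under eq_bigr do rewrite mulrDr mulrA.
rewrite big_split /= -mulr_suml b0 mul0r addr0.
under eq_bigr do rewrite mulr_sumr.
rewrite exchange_big /=; apply: eq_bigr => j _.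
by rewrite -bG mulr_sumr; apply: eq_bigr => k _; rewrite mulrCA.
Qed.

(** Cramer's rule for the weights of total mass one that annihilate the columns
    of [A]: they are the signed maximal minors. *)
Lemma minors_system (A : 'M[F]_(n.+1, n)) :
  (forall a : 'I_n.+1 -> F, \sum_k a k = 0 ->
     (forall j, \sum_k a k * A k j = 0) -> forall k, a k = 0) ->
  let C := \sum_(k < n.+1) (-1) ^+ k * \det (row' k A) in
  let a k := C^-1 * ((-1) ^+ (k : 'I_n.+1) * \det (row' k A)) in
  [/\ C != 0, \sum_k a k = 1 & forall j, \sum_k a k * A k j = 0].
Proof.
move=> ker C a; set M := aug (const_mx 1) A.
have uM : M \in unitmx.
  apply: aug_unit => b b0 bA; apply: ker => //.
  by rewrite -[RHS]b0; apply: eq_bigr => k _; rewrite mxE mulr1.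
have cofE k : cofactor M k ord0 = (-1) ^+ k * \det (row' k A).
  rewrite /cofactor addn0; congr (_ * \det _); apply/matrixP => i j.
  by rewrite !mxE liftK.
have CE : C = \det M.
  rewrite (expand_det_col M ord0); apply: eq_bigr => k _.
  by rewrite aug0 mxE mul1r cofE.
have C0 : C != 0 by rewrite CE -unitfE.
have aE k : a k = invmx M ord0 k.
  by rewrite /invmx uM mxE -CE mxE cofE.
have VM := mulVmx uM.
split => //.
  have /matrixP/(_ ord0 ord0) := VM; rewrite [LHS]mxE [RHS]mxE eqxx => e.
  by rewrite -[RHS]e; apply: eq_bigr => k _; rewrite aug0 mxE mulr1 aE.
move=> j; have /matrixP/(_ ord0 (lift ord0 j)) := VM.
rewrite [LHS]mxE [RHS]mxE => e.
by rewrite -[RHS]e; apply: eq_bigr => k _; rewrite augS aE.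
Qed.

End LinearSystems.

(** * Kolmogorov's backward equation *)

Lemma cvg_bigsum (K : numFieldType) (V : normedModType K) (U I : Type)
    (F : set_system U) (r : seq I) (f : I -> U -> V) (l : I -> V) : Filter F ->
  (forall i, f i x @[x --> F] --> l i) ->
  \sum_(i <- r) f i x @[x --> F] --> \sum_(i <- r) l i.
Proof.
move=> FF fl; elim: r => [|i r IH].
  by rewrite big_nil; under eq_fun do rewrite big_nil; exact: cvg_cst.
by rewrite big_cons; under eq_fun do rewrite big_cons; exact: cvgD.
Qed.

Section TransitionFunction.
Context (R : realType) (m : nat) (G : 'M[R]_m) (P : R -> 'M[R]_m).
Hypothesis tP : transition_function G P.

Lemma transition_ge0 t i j : 0 <= t -> 0 <= P t i j.
Proof. by case: tP => h _ _ _ _; exact: h. Qed.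

Lemma transition_le1 t i j : 0 <= t -> P t i j <= 1.
Proof.
move=> t0; case: tP => h1 h2 _ _ _; rewrite -(h2 t i t0) (bigD1 j)//= lerDl.
by apply: sumr_ge0 => k _; exact: h1.
Qed.

Lemma transitionD s t : 0 <= s -> 0 <= t -> P (s + t) = P s *m P t.
Proof. by case: tP => _ _ _ h _; exact: h. Qed.

Lemma transition0 : P 0 = 1%:M.
Proof. by case: tP. Qed.

Let A (h : R) : 'M[R]_m := h^-1 *: (P h - 1%:M).

Let cvgA i j : A h i j @[h --> 0^'+] --> G i j.
Proof.
by case: tP => _ _ _ _ /(_ i j); rewrite /A; under [in X in _ -> X]eq_fun do rewrite !mxE.
Qed.

Let PA h : 0 < h -> P h = 1%:M + h *: A h.
Proof. by move=> h0; rewrite /A scalerA divff ?gt_eqF// scale1r addrCA subrr addr0. Qed.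

Let cvgAM (B : 'M[R]_m) i j : (A h *m B) i j @[h --> 0^'+] --> (G *m B) i j.
Proof.
rewrite mxE; under eq_fun do rewrite mxE.
apply: cvg_bigsum => k; by apply: cvgM; [exact: cvgA|exact: cvg_cst].
Qed.

Let cvgMA (B : 'M[R]_m) i j : (B *m A h) i j @[h --> 0^'+] --> (B *m G) i j.
Proof.
rewrite mxE; under eq_fun do rewrite mxE.
apply: cvg_bigsum => k; by apply: cvgM; [exact: cvg_cst|exact: cvgA].
Qed.

Let cvgP0 i j : P h i j @[h --> 0^'+] --> P 0 i j.
Proof.
rewrite transition0.
have c : (1%:M : 'M[R]_m) i j + h * A h i j @[h --> 0^'+] --> (1%:M : 'M[R]_m) i j + 0 * G i j.
  apply: cvgD; first exact: cvg_cst.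
  apply: cvgM; last exact: cvgA.
  exact: (cvg_at_right_filter (cvg_id : x @[x --> (0:R)] --> 0)).
rewrite mul0r addr0 in c; apply: cvg_trans c; apply: near_eq_cvg.
near=> h; have h0 : 0 < h by near: h; exact: nbhs_right_gt.
have -> : P h i j = (1%:M : 'M[R]_m) i j + (h *: A h) i j by rewrite (PA h0) mxE.
by congr (_ + _); rewrite [RHS]mxE.
Unshelve. all: by end_near. Qed.

Let AP t h : 0 <= t -> 0 < h -> A h *m P t = h^-1 *: (P (t + h) - P t).
Proof.
move=> t0 h0; rewrite /A -scalemxAl mulmxBl mul1mx.
by rewrite -transitionD ?(ltW h0)// [h + t]addrC.
Qed.

Let PtA t h : 0 <= t -> 0 < h -> P t *m A h = h^-1 *: (P (t + h) - P t).
Proof.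
move=> t0 h0; rewrite /A -scalemxAr mulmxBr mulmx1.
by rewrite -transitionD ?(ltW h0).
Qed.

Lemma transition_comm t : 0 <= t -> G *m P t = P t *m G.
Proof.
move=> t0; apply/matrixP => i j.
have c : (A h *m P t) i j @[h --> 0^'+] --> (P t *m G) i j.
  have c := @cvgMA (P t) i j; apply: cvg_trans c; apply: near_eq_cvg.
  near=> h; have h0 : 0 < h by near: h; exact: nbhs_right_gt.
  by rewrite AP// PtA.
exact: (cvg_unique _ (@cvgAM (P t) i j) c).
Unshelve. all: by end_near. Qed.

Let right_derivative t i j : 0 <= t ->
  h^-1 * (P (t + h) i j - P t i j) @[h --> 0^'+] --> (G *m P t) i j.
Proof.
move=> t0; have c := @cvgAM (P t) i j; apply: cvg_trans c; apply: near_eq_cvg.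
near=> h; have h0 : 0 < h by near: h; exact: nbhs_right_gt.
by rewrite AP// !mxE.
Unshelve. all: by end_near. Qed.

Let left_continuous t i j : 0 < t -> P (t - h) i j @[h --> 0^'+] --> P t i j.
Proof.
move=> t0; apply/cvgrPdist_le => e e0.
pose b (h : R) := \sum_k `|(P h i k - P 0 i k)|.
have cb : b h @[h --> 0^'+] --> \sum_(k < m) `|P 0 i k - P 0 i k|.
  apply: cvg_bigsum => k; apply: cvg_norm; apply: cvgB; last exact: cvg_cst.
  exact: cvgP0.
rewrite big1 in cb; last by move=> k _; rewrite subrr normr0.
near=> h; have h0 : 0 < h by near: h; exact: nbhs_right_gt.
have ht : h < t by near: h; exact: nbhs_right_lt.
have th0 : 0 <= t - h by rewrite subr_ge0 ltW.
apply: (@le_trans _ _ (b h)); last first.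
  have : `|0 - b h| <= e.
    by near: h; move/cvgrPdist_le : cb; exact.
  by rewrite sub0r normrN; apply: le_trans; exact: ler_norm.
have -> : P t i j - P (t - h) i j = ((P h - P 0) *m P (t - h)) i j.
  have hth : h + (t - h) = t by rewrite addrC subrK.
  by rewrite transition0 mulmxBl mul1mx -transitionD ?(ltW h0)// hth !mxE.
rewrite mxE; apply: le_trans (ler_norm_sum _ _ _) _; apply: ler_sum => k _.
rewrite normrM !mxE ler_piMr//.
by rewrite ger0_norm ?transition_ge0// transition_le1.
Unshelve. all: by end_near. Qed.

Let left_derivative t i j : 0 < t ->
  h^-1 * (P t i j - P (t - h) i j) @[h --> 0^'+] --> (G *m P t) i j.
Proof.
move=> t0.
have c : (A h *m P (t - h)) i j @[h --> 0^'+] --> (G *m P t) i j.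
  rewrite mxE; under eq_fun do rewrite mxE.
  by apply: cvg_bigsum => k; apply: cvgM; [exact: cvgA|exact: left_continuous].
apply: cvg_trans c; apply: near_eq_cvg.
near=> h; have h0 : 0 < h by near: h; exact: nbhs_right_gt.
have ht : h < t by near: h; exact: nbhs_right_lt.
by rewrite AP ?subr_ge0 ?(ltW ht)// subrK !mxE.
Unshelve. all: by end_near. Qed.

(** Kolmogorov's backward equation. The left difference quotient needs left
    continuity, which holds because the entries stay bounded. *)
Lemma kolmogorov_backward (t : R) i j : 0 < t ->
  is_derive t 1 (fun u => P u i j) ((G *m P t) i j).
Proof.
move=> t0.
have c : (fun h => h^-1 *: (P (h *: 1 + t) i j - P t i j)) @ 0^' --> (G *m P t) i j.
  have -> : (fun h => h^-1 *: (P (h *: 1 + t) i j - P t i j)) =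
      (fun h : R => h^-1 * (P (t + h) i j - P t i j)).
    by apply/funext => h; rewrite [h *: 1]mulr1 [h + t]addrC.
  apply: (@cvg_at_right_left_dnbhs _ R^o).
    by have := @right_derivative t i j (ltW t0).
  apply/cvg_at_leftNP; rewrite oppr0.
  have -> : (fun h : R => h^-1 * (P (t + h) i j - P t i j)) \o -%R =
      (fun h : R => h^-1 * (P t i j - P (t - h) i j)).
    by apply/funext => h /=; rewrite invrN mulNr -mulrN opprB.
  by have := @left_derivative t i j t0.
apply: DeriveDef; first by apply/cvg_ex; exists ((G *m P t) i j).
exact: cvg_lim c.
Qed.

Lemma transition_continuous i j : {within `[0, +oo[, continuous (fun u => P u i j)}.
Proof.
apply/continuous_within_itvcyP; split; last exact: cvgP0.
move=> t; rewrite in_itv /= andbT => t0.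
apply: differentiable_continuous; apply/derivable1_diffP.
by case: (kolmogorov_backward i j t0).
Qed.

(** Near [0] the diagonal is close to [1], and [P (u + t) i i] is at least [P u
    i i * P t i i]. *)
Lemma transition_diag_gt0 t i : 0 <= t -> 0 < P t i i.
Proof.
move=> t0.
have [e e0 small] : exists2 e, 0 < e & forall h, 0 < h < e -> 0 < P h i i.
  have /cvgrPdist_lt/(_ 1 ltr01)[e /= e0 He] := @cvgP0 i i.
  exists e => // h /andP[h0 he]; have := He h.
  rewrite /= sub0r normrN gtr0_norm// => /(_ he h0).
  rewrite transition0 mxE eqxx ltr_norml => /andP[_].
  by rewrite ltrBlDr ltrDl.
have [N tN] : exists N : nat, t / N.+1%:R < e.
  exists (Num.bound (t / e)); rewrite ltr_pdivrMr// mulrC -ltr_pdivrMr//.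
  apply: lt_trans (archi_boundP _) _; first by rewrite divr_ge0// ltW.
  by rewrite ltr_nat.
have tE : t = (t / N.+1%:R) *+ N.+1 by rewrite -mulr_natr divfK ?pnatr_eq0.
rewrite tE; set u := t / _ in tN *.
have u0 : 0 <= u by rewrite divr_ge0.
have uu : 0 < P u i i.
  move: u0; rewrite le_eqVlt => /predU1P[<-|u0].
    by rewrite transition0 mxE eqxx.
  by apply: small; rewrite u0.
elim: N.+1 => [|k IH]; first by rewrite mulr0n transition0 mxE eqxx.
rewrite mulrS transitionD ?mulrn_wge0// mxE (bigD1 i)//=.
rewrite ltr_pwDl ?mulr_gt0//; apply: sumr_ge0 => l _.
by rewrite mulr_ge0// transition_ge0// mulrn_wge0.
Qed.

End TransitionFunction.

(** * The tail of a phase-type law *)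

(** The semigroup of the Markov process killed at absorption; the tail of the
    phase-type law is [alpha^T (Pb u) 1]. *)
Record killed_semigroup (R : realType) (n : nat) (T : 'M[R]_n)
    (Pb : R -> 'M[R]_n) : Prop := KilledSemigroup {
  killed0 : Pb 0 = 1%:M;
  killedD : forall s t, 0 <= s -> 0 <= t -> Pb (s + t) = Pb s *m Pb t;
  killed_comm : forall t, 0 <= t -> Pb t *m T = T *m Pb t;
  killed_derive : forall (t : R) i j, 0 < t ->
    is_derive t 1 (fun u => Pb u i j) ((T *m Pb t) i j);
  killed_continuous : forall i j,
    {within `[0, +oo[, continuous (fun u => Pb u i j)};
  killed_ge0 : forall t i j, 0 <= t -> 0 <= Pb t i j;
  killed_diag_gt0 : forall t i, 0 <= t -> 0 < Pb t i i }.

Definition killed_tail (R : realType) (n : nat) (alpha : 'cV[R]_n)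
    (Pb : R -> 'M[R]_n) (u : R) : R :=
  \sum_i alpha i 0 * \sum_j Pb u i j.

Section KilledSemigroup.
Context (R : realType) (n : nat) (T : 'M[R]_n) (P : R -> 'M[R]_(1 + n)).
Hypothesis tP : transition_function (absorbing_rate_matrix T) P.

Let z0 : 'I_(1 + n) := lshift n ord0.

Let rateE : absorbing_rate_matrix T = block_mx 0 0 (exit_vector T) T.
Proof. by []. Qed.

(** The row of rates out of the absorbing state vanishes, so by the backward
    equation this row is constant in time. *)
Lemma absorbing_row u j : 0 <= u -> P u z0 j = (z0 == j)%:R.
Proof.
move=> u0; have <- : P 0 z0 j = (z0 == j)%:R by rewrite (transition0 tP) mxE.
have Gz0 k : absorbing_rate_matrix T z0 k = 0.
  rewrite /absorbing_rate_matrix; case: (split_ordP k) => k' ->.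
    by rewrite block_mxEul mxE.
  by rewrite block_mxEur mxE.
have : (\int[lebesgue_measure]_(x in `[0%R, u]) (0 : R)%:E = (P u z0 j - P 0 z0 j)%R%:E)%E.
  apply: (@ftc_segment R (fun v => P v z0 j) (fun=> 0) 0 u u0).
  - by apply: continuous_subspaceT => x; exact: cst_continuous.
  - apply: continuous_subspaceW (@transition_continuous _ _ _ _ tP z0 j).
    exact: subset_itvl.
  - move=> v /andP[v0 _]; have := kolmogorov_backward tP z0 j v0.
    by rewrite mxE big1// => k _; rewrite Gz0 mul0r.
rewrite integral0 => -[] /esym /eqP; rewrite subr_eq0 => /eqP //.
Qed.

Definition phase_block u : 'M[R]_n := drsubmx (P u).

Let ur0 u : 0 <= u -> ursubmx (P u) = 0.
Proof.
move=> u0; apply/matrixP => i j; by rewrite !mxE (ord1 i) absorbing_row//.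
Qed.

Let drM (A B : 'M[R]_(1 + n)) : drsubmx (A *m B) =
  dlsubmx A *m ursubmx B + drsubmx A *m drsubmx B.
Proof. by rewrite -{1}(submxK A) -{1}(submxK B) mulmx_block block_mxKdr. Qed.

Lemma absorption_prob u i : 0 <= u ->
  P u (rshift 1 i) z0 = 1 - \sum_j phase_block u i j.
Proof.
move=> u0; case: tP => _ /(_ u (rshift 1 i) u0) + _ _ _.
have -> : \sum_j phase_block u i j = \sum_j P u (rshift 1 i) (rshift 1 j).
  by apply: eq_bigr => j _; rewrite !mxE.
rewrite big_split_ord /= big_ord1 => <-.
rewrite addrK; congr (P u _ _); exact: val_inj.
Qed.

Lemma killed_phase_block : killed_semigroup T phase_block.
Proof.
split.
- apply/matrixP => i j; rewrite !mxE (transition0 tP) mxE.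
  by rewrite (inj_eq (@rshift_inj _ _)).
- move=> s t s0 t0; rewrite /phase_block (transitionD tP)// drM ur0//.
  by rewrite mulmx0 add0r.
- move=> t t0; have := congr1 drsubmx (transition_comm tP t0).
  rewrite !drM ur0// rateE block_mxKur block_mxKdr !mulmx0 !add0r => e.
  exact: esym e.
- move=> t i j t0.
  have := kolmogorov_backward tP (rshift 1 i) (rshift 1 j) t0.
  have -> : (absorbing_rate_matrix T *m P t) (rshift 1 i) (rshift 1 j) =
      (T *m phase_block t) i j.
    have <- : drsubmx (absorbing_rate_matrix T *m P t) = T *m phase_block t.
      by rewrite drM (ur0 (ltW t0)) mulmx0 add0r rateE block_mxKdr.
    by rewrite !mxE.
  by congr is_derive; apply/funext => u; rewrite !mxE.
- move=> i j; have := @transition_continuous _ _ _ _ tP (rshift 1 i) (rshift 1 j).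
  have -> // : (fun u => P u (rshift 1 i) (rshift 1 j)) = (fun u => phase_block u i j).
  by apply/funext => u; rewrite !mxE.
- by move=> t i j t0; rewrite !mxE; exact: (transition_ge0 tP).
- by move=> t i t0; rewrite !mxE; exact: (transition_diag_gt0 tP).
Qed.

End KilledSemigroup.

Section HittingTime.
Context (R : realType) (n : nat) (T : 'M[R]_n) (alpha : 'cV[R]_n)
  (d : measure_display) (U : measurableType d) (Pr : probability U R)
  (X : R -> U -> 'I_(1 + n)) (P : R -> 'M[R]_(1 + n)).
Hypothesis tP : transition_function (absorbing_rate_matrix T) P.
Hypothesis mX : forall t i, 0 <= t -> measurable (X t @^-1` [set i]).
Hypothesis rcX : forall w t, 0 <= t -> \forall s \near t^'+, X s w = X t w.
Hypothesis fdd : forall (k : nat) (t : nat -> R) (i : nat -> 'I_(1 + n)),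
  t 0%N = 0 -> (forall l, t l <= t l.+1) ->
  Pr [set w | forall l, (l <= k)%N -> X (t l) w = i l] =
  ((col_mx 0 alpha : 'cV[R]_(1 + n)) (i 0%N) 0 *
   \prod_(l < k) P (t l.+1 - t l) (i l) (i l.+1))%:E.

Let z0 : 'I_(1 + n) := ord0.
Let a (i : 'I_(1 + n)) : R := (col_mx 0 alpha : 'cV[R]_(1 + n)) i 0.

Lemma measurable_state t i : 0 <= t -> measurable_fun setT (fun w => X t w == i).
Proof.
move=> t0; apply: (measurable_fun_bool true); rewrite setTI.
rewrite (_ : _ @^-1` _ = X t @^-1` [set i]); first exact: mX.
by apply/seteqP; split => w /= /eqP.
Qed.

Let fdd1 u i j : 0 <= u ->
  Ex Pr (fun w => ((X 0 w == i) && (X u w == j))%:R) = a i * P u i j.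
Proof.
move=> u0; apply: EFin_inj.
rewrite -Ex_bool; last by apply: measurable_and; apply: measurable_state.
have := @fdd 1%N (fun l => if l is 0%N then 0 else u) (fun l => if l is 0%N then i else j) erefl.
rewrite big_ord_recl big_ord0 mulr1 /= subr0 => <-; last by case.
congr (Pr _); apply/seteqP; split => w /=.
  by move=> /andP[/eqP Xi /eqP Xj] [|[|]].
by move=> h; rewrite (h 0%N)// (h 1%N)// !eqxx.
Qed.

Let fdd2 q u i k j : 0 <= q <= u ->
  Ex Pr (fun w => [&& X 0 w == i, X q w == k & X u w == j]%:R) =
  a i * (P q i k * P (u - q) k j).
Proof.
move=> /andP[q0 qu]; have u0 : 0 <= u by exact: le_trans qu.
apply: EFin_inj.
rewrite -Ex_bool; last first.
  by do 2 (apply: measurable_and; first exact: measurable_state); exact: measurable_state.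
have := @fdd 2%N (fun l => match l with 0%N => 0 | 1%N => q | _ => u end)
  (fun l => match l with 0%N => i | 1%N => k | _ => j end) erefl.
rewrite 2!big_ord_recl big_ord0 mulr1 /= subr0 => <-; last by case=> [|[|]].
congr (Pr _); apply/seteqP; split => w /=.
  by move=> /and3P[/eqP Xi /eqP Xk /eqP Xj] [|[|[|]]].
by move=> h; rewrite (h 0%N)// (h 1%N)// (h 2%N)// !eqxx.
Qed.

Lemma state_prob u j : 0 <= u ->
  Ex Pr (fun w => (X u w == j)%:R) = \sum_i a i * P u i j.
Proof.
move=> u0; under [RHS]eq_bigr do rewrite -fdd1//.
rewrite -Ex_sum; last first.
  by move=> i; apply/bmf_bool/measurable_and; apply: measurable_state.
congr (Ex Pr _); apply/funext => w.
rewrite (bigD1 (X 0 w))//= eqxx big1 ?addr0// => i iX.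
by rewrite eq_sym (negbTE iX).
Qed.

(** A two-time form of [absorbing_row]. It is applied at rational times, whose
    exceptional sets have a null union. *)
Lemma absorbed_stays q u : 0 <= q <= u ->
  Ex Pr (fun w => ((X q w == z0) && (X u w != z0))%:R) = 0.
Proof.
move=> /[dup] qu /andP[q0 q1]; have u0 : 0 <= u by exact: le_trans q1.
transitivity (\sum_i \sum_(j | j != z0)
    Ex Pr (fun w => [&& X 0 w == i, X q w == z0 & X u w == j]%:R)).
  under eq_bigr => i _.
    rewrite -big_filter -Ex_sum; last first.
      move=> j; apply/bmf_bool.
      by do 2 (apply: measurable_and; first exact: measurable_state); exact: measurable_state.
    over.
  rewrite -Ex_sum; last first.
    move=> i; apply: bmf_sum => j; apply/bmf_bool.
    by do 2 (apply: measurable_and; first exact: measurable_state); exact: measurable_state.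
  congr (Ex Pr _); apply/funext => w.
  rewrite (bigD1 (X 0 w))//= eqxx [X in _ = _ + X]big1 ?addr0; last first.
    move=> i iX; rewrite big1// => j _.
    by rewrite eq_sym (negbTE iX).
  rewrite big_filter; have [Xq|//] := eqVneq (X q w) z0; last first.
    by rewrite big1.
  have [Xu|Xu] /= := eqVneq (X u w) z0.
    by rewrite big1// => j jz; rewrite Xu eq_sym (negbTE jz).
  rewrite (bigD1 (X u w))//= eqxx big1 ?addr0// => j /andP[_ jX].
  by rewrite eq_sym (negbTE jX).
rewrite big1// => i _; rewrite big1// => j jz; rewrite fdd2//.
have -> : z0 = lshift n ord0 by exact: val_inj.
rewrite (absorbing_row tP) ?subr_ge0//.
rewrite (_ : lshift n ord0 == j = false) ?mulr0//.
by apply/negbTE; apply: contra jz => /eqP <-; apply/eqP/val_inj.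
Qed.

Let hit := hitting_time X z0.

Lemma right_neighbourhood w t : 0 <= t ->
  exists2 e, 0 < e & forall s, t < s < t + e -> X s w = X t w.
Proof.
move=> t0; have [e /= e0 He] := rcX w t0; exists e => // s /andP[ts st].
apply: (He s) => //=; rewrite distrC ger0_norm ?subr_ge0 ?(ltW ts)//.
by rewrite ltrBlDl.
Qed.

(** Paths are right-continuous in a discrete space, so the infimum is a minimum.
    *)
Lemma hitting_time_attained w r : hit w = r%:E -> 0 <= r /\ X r w = z0.
Proof.
move=> hr; have r0 : 0 <= r.
  rewrite -lee_fin -hr; apply: le_ereal_inf_tmp => _ [t [t0 _] <-].
  by rewrite lee_fin.
split=> //; have [e e0 He] := right_neighbourhood w r0.
have : (hit w < (r + e)%:E)%E by rewrite hr lte_fin ltrDl.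
move=> /ereal_inf_lt[_ [t [t0 Xt] <-]]; rewrite lte_fin => tre.
have : (hit w <= t%:E)%E by apply: ereal_inf_lbound; exists t.
rewrite hr lee_fin le_eqVlt => /predU1P[-> //|rt].
by rewrite -(He t) ?rt.
Qed.

Lemma hitting_time_le w s : 0 <= s -> X s w = z0 ->
  exists2 r, r <= s & r%:E = hit w.
Proof.
move=> s0 Xs.
have le : (hit w <= s%:E)%E by apply: ereal_inf_lbound; exists s.
have ge : (0%:E <= hit w)%E.
  by apply: le_ereal_inf_tmp => _ [t [t0 _] <-]; rewrite lee_fin.
have fin : hit w \is a fin_num.
  by rewrite fin_numE; apply/andP; split; apply/eqP => e; move: le ge; rewrite e.
by exists (fine (hit w)); [rewrite -lee_fin fineK|rewrite fineK].
Qed.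

(** Being absorbed before time [u] and being in the absorbing state at time [u]
    differ by a null event: a path that is absorbed and then leaves does so
    after a rational time at which it is absorbed. *)
Lemma phase_type_cdf u : 0 <= u -> \sum_i alpha i 0 = 1 ->
  Pr (hit @^-1` (EFin @` `]-oo, u])) = (1 - killed_tail alpha (phase_block P) u)%:E.
Proof.
move=> u0 alpha1.
pose N (k : nat) : set U := match unpickle k : option rat with
  | Some q => if 0 <= (ratr q : R) <= u then
      [set w | (X (ratr q) w == z0) && (X u w != z0)] else set0
  | None => set0 end.
have mN1 q : 0 <= q <= u -> measurable_fun setT (fun w => (X q w == z0) && (X u w != z0)).
  move=> /andP[q0 _]; apply: measurable_and; first exact: measurable_state.
  by apply: measurable_neg; exact: measurable_state.
have mN k : measurable (N k).
  rewrite /N; case: unpickle => // q; case: ifP => // qu.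
  exact: measurable_set_bool (mN1 _ qu).
have N0 k : Pr (N k) = 0%E.
  rewrite /N; case: unpickle => [q|]; last exact: measure0.
  case: ifP => qu; last exact: measure0.
  by rewrite Ex_bool ?absorbed_stays//; exact: mN1.
have mUN : measurable (\bigcup_k N k) by exact: bigcup_measurable.
have UN0 : Pr (\bigcup_k N k) = 0%E.
  apply/(negligibleP Pr mUN); apply: negligible_bigcup => k.
  by apply/(negligibleP Pr (mN k)); exact: N0.
have -> : hit @^-1` (EFin @` `]-oo, u]) = [set w | X u w == z0] `|` \bigcup_k N k.
  apply/seteqP; split => w /=.
    move=> [r]; rewrite in_itv /= => ru /esym /hitting_time_attained [r0 Xr].
    have [Xu|Xu] := eqVneq (X u w) z0; [by left|right].
    move: ru; rewrite le_eqVlt => /predU1P[ru|ru].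
      by move: Xu; rewrite -ru Xr eqxx.
    have [e e0 He] := right_neighbourhood w r0.
    have [q] : exists q : rat, (ratr q : R) \in `]r, Num.min u (r + e)[.
      by apply: rat_in_itvoo; rewrite lt_min ru ltrDl.
    rewrite in_itv /= lt_min => /and3P[rq qu qe].
    exists (pickle q); first exact: Logic.I.
    rewrite /N pickleK (ltW qu) (le_trans r0 (ltW rq)).
    by apply/andP; split => //; rewrite (He (ratr q)) ?rq// Xr.
  move=> [/eqP Xu|[k _]].
    have [r ru rh] := hitting_time_le u0 Xu.
    by exists r => //; rewrite in_itv.
  rewrite /N; case: unpickle => // q; case: ifP => // /andP[q0 qu] /= /andP[/eqP Xq _].
  have [r rq rh] := hitting_time_le q0 Xq.
  by exists r => //; rewrite in_itv /= (le_trans rq).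
have mA : measurable [set w | X u w == z0].
  exact: measurable_set_bool (measurable_state _ u0).
transitivity (Pr [set w | X u w == z0]); first exact: measureU0.
rewrite (Ex_bool Pr (measurable_state _ u0)).
rewrite state_prob//; congr EFin.
rewrite big_split_ord /= big_ord1 /a col_mxEu mxE mul0r add0r.
rewrite -alpha1 /killed_tail -sumrB; apply: eq_bigr => i _.
have -> : z0 = lshift n ord0 by exact: val_inj.
by rewrite col_mxEd (absorption_prob tP)// mulrBr mulr1.
Qed.

End HittingTime.

(** The law of the jumps enters the averages below only through this tail. *)
Lemma phase_type_tail (R : realType) (n : nat) (alpha : 'cV[R]_n)
    (T : 'M[R]_n) (B : set R -> \bar R) : phase_type alpha T B ->
  exists2 Pb, killed_semigroup T Pb &
    forall u, 0 <= u -> B `]-oo, u]%classic = (1 - killed_tail alpha Pb u)%:E.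
Proof.
case=> -[_ alpha1 _ _ _].
case=> dd [Om [Pr [X [[P [tP mX rcX fdd]] BE]]]].
exists (phase_block P); first exact: killed_phase_block.
by move=> u u0; rewrite BE// (phase_type_cdf tP mX rcX fdd).
Qed.

(** * Averaging an exponential over a capped jump *)

Section JumpExpectation.
Context (R : realType) (n : nat) (T : 'M[R]_n) (Pb : R -> 'M[R]_n).
Hypothesis kP : killed_semigroup T Pb.
Context (d : measure_display) (U : measurableType d) (P : probability U R).
Local Notation C := R[i].
Local Notation rc := (real_complex R).
Local Notation one := (const_mx 1 : 'cV[C]_n).
Local Notation res s := (invmx (resolvent_arg T s)).

Definition avg (al : 'cV[R]_n) (v : 'cV[C]_n) : C :=
  ((map_mx rc al)^T *m v) 0 0.

Lemma avgE al v : avg al v = \sum_i rc (al i 0) * v i 0.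
Proof. by rewrite /avg mxE; apply: eq_bigr => i _; rewrite !mxE. Qed.

Lemma avgD al v w : avg al (v + w) = avg al v + avg al w.
Proof. by rewrite /avg mulmxDr mxE. Qed.

Lemma avgB al v w : avg al (v - w) = avg al v - avg al w.
Proof. by rewrite /avg mulmxBr !mxE. Qed.

Lemma avgZ al z v : avg al (z *: v) = z * avg al v.
Proof. by rewrite /avg -scalemxAr mxE. Qed.

Lemma avg0 al : avg al 0 = 0.
Proof. by rewrite /avg mulmx0 mxE. Qed.

Lemma avg_sum al (I : Type) (r : seq I) (F : I -> 'cV[C]_n) :
  avg al (\sum_(i <- r) F i) = \sum_(i <- r) avg al (F i).
Proof.
by elim: r => [|i r IH]; rewrite ?big_nil ?avg0// !big_cons avgD IH.
Qed.

Lemma avg_mul al (A : 'M[R]_n) v :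
  avg al (map_mx rc A *m v) = avg (A^T *m al) v.
Proof. by rewrite /avg mulmxA map_mxM -matrix.map_trmx trmx_mul trmxK. Qed.

Lemma phase_type_LT_avg al s : phase_type_LT al T s = avg al (exit_transform T s).
Proof. by rewrite /phase_type_LT /avg /exit_transform mulmxA. Qed.

Definition tail_vector u : 'cV[C]_n := map_mx rc (Pb u) *m one.

Lemma tail_vectorE u i : tail_vector u i 0 = rc (\sum_j Pb u i j).
Proof.
by rewrite mxE rmorph_sum; apply: eq_bigr => j _; rewrite !mxE mulr1.
Qed.

Lemma killed_tail_avg al u : rc (killed_tail al Pb u) = avg al (tail_vector u).
Proof.
rewrite avgE /killed_tail rmorph_sum; apply: eq_bigr => i _.
by rewrite rmorphM tail_vectorE.
Qed.

Lemma killed_tailD al a s : 0 <= a -> 0 <= s ->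
  killed_tail al Pb (a + s) = killed_tail ((Pb a)^T *m al) Pb s.
Proof.
move=> a0 s0; apply: (@complexI R); rewrite !killed_tail_avg.
by rewrite /tail_vector (killedD kP)// map_mxM -mulmxA [LHS]avg_mul.
Qed.

Lemma killed_tail_continuous al :
  {within `[0, +oo[, continuous (killed_tail al Pb)}.
Proof.
move=> x; apply: cvg_bigsum => i; apply: cvgM; first exact: cvg_cst.
apply: cvg_bigsum => j; exact: (@killed_continuous _ _ _ _ kP i j x).
Qed.

Section OneRoot.
Variables (z p : C) (al : 'cV[R]_n).
Hypothesis up : resolvent_arg T p \in unitmx.

Let c (j : 'I_n) : C := ((map_mx rc al)^T *m res p) 0 j.

(** An antiderivative of the layer-cake integrand: the derivative of the
    exponential contributes [- p], that of the semigroup [T], and together they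
    cancel the resolvent. *)
Let Phi s : R := \sum_j (\sum_l Pb s j l) * expw (z * p * c j) p s.

Let PhiE s : Phi s = complex.Re (z * p * cexp (- p * rc s) * avg al (res p *m tail_vector s)).
Proof.
rewrite /avg mulmxA mxE mulr_sumr Re_sum; apply: eq_bigr => j _.
rewrite tail_vectorE /expw mulrA ReMr mulrC; congr (complex.Re _ * _).
by rewrite -/(c j) mulrAC.
Qed.

Let dPhi (s : R) : 0 < s ->
  is_derive s 1 Phi (expw (- p * z) p s * killed_tail al Pb s).
Proof.
move=> s0.
have d1 j : is_derive s 1 (fun u => (\sum_l Pb u j l) * expw (z * p * c j) p u)
    ((\sum_l Pb s j l) *: expw (- p * (z * p * c j)) p s +
     expw (z * p * c j) p s *: \sum_l (T *m Pb s) j l).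
  apply: is_deriveM; last exact: is_derive_expw.
  have := @is_derive_sum R R^o R^o n (fun l u => Pb u j l) s 1 (fun l => (T *m Pb s) j l)
    (fun l => killed_derive kP j l s0).
  by rewrite fct_sumE.
have := @is_derive_sum R R^o R^o n _ s 1 _ d1.
rewrite fct_sumE => D; apply: (is_derive_eq D).
have -> : expw (- p * z) p s * killed_tail al Pb s =
    complex.Re (- p * z * cexp (- p * rc s) * avg al (tail_vector s)).
  by rewrite -killed_tail_avg ReMr.
have e0 : tail_vector s = p *: (res p *m tail_vector s)
    - res p *m (map_mx rc T *m tail_vector s).
  rewrite -{1}(mulKmx up (tail_vector s)) {2}/resolvent_arg mulmxBl mul_scalar_mx.
  by rewrite mulmxBr -scalemxAr.
have e1 : avg al (tail_vector s) = p * avg al (res p *m tail_vector s)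
    - avg al (res p *m (map_mx rc T *m tail_vector s)).
  by rewrite {1}e0 avgB avgZ.
have Tt j : (map_mx rc T *m tail_vector s) j 0 = rc (\sum_l (T *m Pb s) j l).
  rewrite /tail_vector mulmxA -map_mxM mxE rmorph_sum.
  by apply: eq_bigr => l _; rewrite !mxE mulr1.
have a1 : avg al (res p *m tail_vector s) = \sum_j c j * rc (\sum_l Pb s j l).
  by rewrite /avg mulmxA mxE; apply: eq_bigr => j _; rewrite tail_vectorE.
have a2 : avg al (res p *m (map_mx rc T *m tail_vector s)) =
    \sum_j c j * rc (\sum_l (T *m Pb s) j l).
  by rewrite /avg mulmxA mxE; apply: eq_bigr => j _; rewrite Tt.
rewrite e1 a1 a2 mulr_sumr -sumrB mulr_sumr Re_sum; apply: eq_bigr => j _.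
rewrite /GRing.scale /= /expw mulrC -!ReMr -ReD; congr complex.Re.
ring.
Qed.

(** The boundary term at [0] is the uncapped average; the boundary term at [L]
    is what the cap adds. *)
Lemma capped_exponential (X : U -> R) (a L : R) :
  measurable_fun setT X -> 0 <= L ->
  (forall s, 0 <= s <= L ->
     Ex P (fun w => (a + s < X w)%R%:R) = killed_tail al Pb s) ->
  bounded_measurable (fun w => (a < X w)%R%:R * expw z p (Num.min (X w - a) L)) /\
  Ex P (fun w => (a < X w)%R%:R * expw z p (Num.min (X w - a) L)) =
  complex.Re (z * avg al (exit_transform T p)) +
  complex.Re (z * p * cexp (- p * rc L) * avg al (res p *m tail_vector L)).
Proof.
move=> mX L0 tail.
have sub : `[0, L] `<=` `[0, +oo[ by exact: subset_itvl.
have [//|||||bm ->] := @layer_cake R d U P X a L (killed_tail al Pb) (expw z p)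
   (expw (- p * z) p) Phi mX L0 tail.
- exact: continuous_expw.
- by move=> s; exact: is_derive_expw.
- exact: continuous_subspaceW sub (@killed_tail_continuous al).
- apply: (continuous_subspaceW sub) => x; apply: cvg_bigsum => j.
  apply: cvgM; last by apply: continuous_subspaceT; exact: continuous_expw.
  apply: cvg_bigsum => l; exact: (@killed_continuous _ _ _ _ kP j l x).
- by move=> s /andP[s0 _]; exact: dPhi.
split=> //; rewrite expw0 !PhiE mulr0 cexp0 mulr1.
have -> : tail_vector 0 = one by rewrite /tail_vector (killed0 kP) map_mx1 mul1mx.
have -> : z * p * avg al (res p *m one) = z * (avg al one - avg al (exit_transform T p)).
  by rewrite -mulrA -avgZ resolvent_one// avgB.
rewrite -ReMr killed_tail_avg /tail_vector (killed0 kP) map_mx1 mul1mx.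
by rewrite mulrBr ReB opprB addrC addrA subrK.
Qed.

End OneRoot.

End JumpExpectation.

(** * Averaging an exponential sum over a jump *)

Section ExponentialSums.
Context (R : realType).
Local Notation C := R[i].
Local Notation rc := (real_complex R).

Definition expsum (N : nat) (c p : 'I_N -> C) (u : R) : R :=
  \sum_k expw (c k) (p k) u.

Lemma continuous_expsum N (c p : 'I_N -> C) : continuous (expsum c p).
Proof. by move=> u; apply: cvg_bigsum => k; exact: continuous_expw. Qed.

Lemma expsumE N (c p : 'I_N -> C) u :
  expsum c p u = complex.Re (\sum_k c k * cexp (- p k * rc u)).
Proof. by rewrite Re_sum. Qed.

End ExponentialSums.

Section JumpStep.
Context (R : realType) (n : nat) (T : 'M[R]_n) (Pb : R -> 'M[R]_n).
Hypothesis kP : killed_semigroup T Pb.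
Context (d : measure_display) (U : measurableType d) (P : probability U R).
Local Notation C := R[i].
Local Notation rc := (real_complex R).
Local Notation one := (const_mx 1 : 'cV[C]_n).
Local Notation res s := (invmx (resolvent_arg T s)).

Lemma killed_resolvent_comm t s : 0 <= t -> resolvent_arg T s \in unitmx ->
  res s *m tail_vector Pb t = map_mx rc (Pb t) *m (res s *m one).
Proof.
move=> t0 us; rewrite /tail_vector !mulmxA; congr (_ *m _).
rewrite resolvent_comm// -!map_mxM; congr map_mx.
exact: killed_comm kP t t0.
Qed.

(** The effect of the cap on the average of an exponential sum over a jump. It
    does not depend on the level before the jump: the phase at the time when the
    jump reaches [K] is the only link between the two. *)
Definition cap_defect N (c p : 'I_N -> C) (K : R) : 'cV[C]_n :=
  \sum_k (c k * p k * cexp (- p k * rc K)) *: (res (p k) *m one).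

(** Entry [j] averages an exponential sum over an uncapped jump from level [v]
    started in phase [j]. Seen at the moment when a jump crosses [v], it contains
    all that the future of the jump depends on. *)
Definition exit_average N (c p : 'I_N -> C) (v : R) : 'cV[C]_n :=
  \sum_k (c k * cexp (- p k * rc v)) *: exit_transform T (p k).

Lemma jump_expsum N (c p : 'I_N -> C) (al : 'cV[R]_n) (X : U -> R) (a v K : R) :
  (forall k, resolvent_arg T (p k) \in unitmx) ->
  measurable_fun setT X -> v <= K ->
  (forall s, 0 <= s <= K - v ->
     Ex P (fun w => (a + s < X w)%R%:R) = killed_tail al Pb s) ->
  bounded_measurable
    (fun w => (a < X w)%R%:R * expsum c p (v + Num.min (X w - a) (K - v))) /\
  Ex P (fun w => (a < X w)%R%:R * expsum c p (v + Num.min (X w - a) (K - v))) =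
  complex.Re (avg al (exit_average c p v)) +
  complex.Re (avg al (map_mx rc (Pb (K - v)) *m cap_defect c p K)).
Proof.
move=> up mX vK tail; have L0 : 0 <= K - v by rewrite subr_ge0.
pose F k w := (a < X w)%R%:R *
  expw (c k * cexp (- p k * rc v)) (p k) (Num.min (X w - a) (K - v)).
have FE : (fun w => (a < X w)%R%:R * expsum c p (v + Num.min (X w - a) (K - v))) =
    (fun w => \sum_k F k w).
  apply/funext => w; rewrite mulr_sumr; apply: eq_bigr => k _.
  by rewrite /F expw_shift.
have G k := capped_exponential kP (c k * cexp (- p k * rc v)) (up k) mX L0 tail.
have bF k : bounded_measurable (F k) by have [] := G k.
rewrite FE; split; first exact: bmf_sum.
rewrite Ex_sum//; under eq_bigr => k _ do rewrite (G k).2.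
rewrite big_split /= -!Re_sum; congr (complex.Re _ + complex.Re _).
  by rewrite /exit_average avg_sum; apply: eq_bigr => k _; rewrite avgZ.
rewrite /cap_defect mulmx_sumr avg_sum; apply: eq_bigr => k _.
rewrite -scalemxAr avgZ killed_resolvent_comm//; congr (_ * _).
have -> : cexp (- p k * rc K) = cexp (- p k * rc v) * cexp (- p k * rc (K - v)).
  by rewrite -cexpD -mulrDr -rmorphD addrC subrK.
by rewrite mulrA [c k * p k * _]mulrAC.
Qed.

Section Law.
Variables (al : 'cV[R]_n) (X : U -> R).
Hypothesis mX : measurable_fun setT X.
Hypothesis tailX : forall u, 0 <= u ->
  Ex P (fun w => (u < X w)%R%:R) = killed_tail al Pb u.

Let tail0 s L : 0 <= s <= L -> Ex P (fun w => (0 + s < X w)%R%:R) = killed_tail al Pb s.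
Proof. by move=> /andP[s0 _]; under eq_fun do rewrite add0r; exact: tailX. Qed.

Lemma avg_exit_average N (c p : 'I_N -> C) v :
  complex.Re (avg al (exit_average c p v)) =
  expsum (fun k => c k * phase_type_LT al T (p k)) p v.
Proof.
rewrite expsumE /exit_average avg_sum; congr complex.Re; apply: eq_bigr => k _.
by rewrite avgZ phase_type_LT_avg mulrAC.
Qed.

(** Without cap defect, a jump multiplies each coefficient by the transform of
    the jump size at the exponent. *)
Lemma jump_above N (c p : 'I_N -> C) (u K : R) :
  (forall k, resolvent_arg T (p k) \in unitmx) -> u <= K ->
  cap_defect c p K = 0 ->
  bounded_measurable (fun w => (0 < X w)%R%:R * expsum c p (Num.min (u + X w) K)) /\
  Ex P (fun w => (0 < X w)%R%:R * expsum c p (Num.min (u + X w) K)) =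
  expsum (fun k => c k * phase_type_LT al T (p k)) p u.
Proof.
move=> up uK cap.
have := @jump_expsum N c p al X 0 u K up mX uK (fun s => @tail0 s _).
have -> : (fun w => (0 < X w)%R%:R * expsum c p (u + Num.min (X w - 0) (K - u))) =
    (fun w => (0 < X w)%R%:R * expsum c p (Num.min (u + X w) K)).
  by apply/funext => w; rewrite subr0 addr_minr [u + (K - u)]addrC subrK.
by rewrite cap mulmx0 avg0 addr0 avg_exit_average.
Qed.

Definition glue (tau K : R) (f g : R -> R) (u : R) : R :=
  if u <= tau then f u else g (Num.min u K).

(** A jump that crosses [tau] does so in some phase and starts afresh from
    there; if the exit averages at [tau] agree in every phase, replacing [g] by
    the continuation of [f] above [tau] does not change the expectation, and the
    jump acts as if it were uncapped. *)
Lemma jump_below N (b p : 'I_N -> C) N' (c q : 'I_N' -> C) (u tau K : R) :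
  (forall k, resolvent_arg T (p k) \in unitmx) ->
  (forall k, resolvent_arg T (q k) \in unitmx) ->
  0 <= u <= tau -> tau <= K -> cap_defect c q K = 0 ->
  exit_average b p tau = exit_average c q tau ->
  bounded_measurable (fun w => (0 < X w)%R%:R *
    glue tau K (expsum b p) (expsum c q) (u + X w)) /\
  Ex P (fun w => (0 < X w)%R%:R *
    glue tau K (expsum b p) (expsum c q) (u + X w)) =
  expsum (fun k => b k * phase_type_LT al T (p k)) p u.
Proof.
move=> up uq /andP[u0 ut] tK cap match_.
pose a := tau - u; have a0 : 0 <= a by rewrite subr_ge0.
have [b1 e1] := @jump_expsum N b p al X 0 u tau up mX ut (fun s => @tail0 s _).
have tail2 s : 0 <= s <= K - tau ->
    Ex P (fun w => (a + s < X w)%R%:R) = killed_tail ((Pb a)^T *m al) Pb s.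
  by move=> /andP[s0 _]; rewrite (tailX (addr_ge0 a0 s0)) (killed_tailD kP al a0 s0).
have [b2 e2] := @jump_expsum N' c q _ X a tau K uq mX tK tail2.
have mI : measurable_fun setT (fun w => a < X w).
  by apply: measurable_fun_ltr => //; exact: measurable_cst.
have b3 : bounded_measurable (fun w => expsum b p tau * (a < X w)%R%:R).
  by apply: bmfZ; exact: bmf_bool.
have -> : (fun w => (0 < X w)%R%:R *
    glue tau K (expsum b p) (expsum c q) (u + X w)) =
  (fun w => (0 < X w)%R%:R * expsum b p (u + Num.min (X w - 0) (tau - u))
    - expsum b p tau * (a < X w)%R%:R
    + (a < X w)%R%:R * expsum c q (tau + Num.min (X w - a) (K - tau))).
  apply/funext => w; rewrite subr0 !addr_minr.
  have -> : tau + (K - tau) = K by rewrite addrC subrK.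
  have -> : u + (tau - u) = tau by rewrite addrC subrK.
  have -> : tau + (X w - a) = u + X w by rewrite /a; ring.
  rewrite /glue /a ltrBlDl; have [le|lt] := leP (u + X w) tau.
    by rewrite mulr0 mul0r addr0 subr0.
  have X0 : 0 < X w.
    by rewrite -(ltrD2l u) addr0; exact: le_lt_trans lt.
  by rewrite X0 !mul1r mulr1 subrr add0r.
split; first by apply: bmfD => //; exact: bmfB.
rewrite ExD//; last exact: bmfB.
rewrite ExB// ExZ ?tailX//; last exact: bmf_bool.
rewrite e1 e2 cap mulmx0 avg0 addr0 -avg_exit_average.
rewrite expsumE -ReMr killed_tail_avg -/a /tail_vector.
rewrite !avg_mul -avgZ -addrA -addrA -[RHS]addr0; congr (_ + _).
have -> : cap_defect b p tau =
    (\sum_k b k * cexp (- p k * rc tau)) *: one - exit_average b p tau.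
  rewrite /cap_defect /exit_average scaler_suml -sumrB; apply: eq_bigr => k _.
  by rewrite mulrAC -[LHS]scalerA resolvent_one// scalerBr.
by rewrite match_ avgB ReB avgZ addrACA subrr add0r addNr.
Qed.

End Law.

End JumpStep.

(** * Averaging over an exponential interarrival time *)

Section Tails.
Context (R : realType) (d : measure_display) (U : measurableType d)
  (P : probability U R).

Lemma measurable_gt (X : U -> R) (u : R) : measurable_fun setT X ->
  measurable_fun setT (fun w => u < X w).
Proof. by move=> mX; apply: measurable_fun_ltr => //; exact: measurable_cst. Qed.

Lemma measurable_le (X : U -> R) (u : R) : measurable_fun setT X ->
  measurable_fun setT (fun w => X w <= u).
Proof. by move=> mX; apply: measurable_fun_ler => //; exact: measurable_cst. Qed.

Lemma tail_of_cdf (X : U -> R) (u t : R) : measurable_fun setT X ->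
  P (X @^-1` `]-oo, u]) = (1 - t)%:E -> Ex P (fun w => (u < X w)%R%:R) = t.
Proof.
move=> mX; have -> : X @^-1` `]-oo, u] = [set w | X w <= u].
  by apply/seteqP; split => w /=; rewrite in_itv.
rewrite Ex_bool; last exact: measurable_le.
move=> [e]; have bl := bmf_bool _ (measurable_le u mX).
have -> : (fun w => (u < X w)%R%:R : R) = (fun w => 1 - (X w <= u)%R%:R).
  by apply/funext => w; rewrite ltNge; case: (X w <= u); rewrite /= ?subrr ?subr0.
by rewrite ExB ?Ex_cst ?e ?subKr//; exact: bmf_cst.
Qed.

Lemma exponential_tail (lambda : R) (E : {RV P >-> R}) : 0 < lambda ->
  (forall A : set R, measurable A -> distribution P E A = exponential_prob lambda A) ->
  forall u, 0 <= u -> Ex P (fun w => (u < E w)%R%:R) = expR (- (lambda * u)).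
Proof.
move=> l0 EE u u0; apply: tail_of_cdf => //.
have lt0 : P (E @^-1` `]-oo, 0%R[) = 0%E.
  rewrite -[LHS]/(distribution P E `]-oo, 0%R[) EE// /exponential_prob.
  apply: integral0_eq => x; rewrite /= in_itv /= => x0.
  by rewrite lt0_exponential_pdf.
have ge0 : P (E @^-1` `[0%R, u]) = (1 - expR (- (lambda * u)))%:E.
  rewrite -[LHS]/(distribution P E `[0%R, u]) EE//.
  move: u0; rewrite le_eqVlt => /predU1P[<-|u0].
    rewrite set_itv1 /exponential_prob integral_set1.
    by rewrite mulr0 oppr0 expR0 subrr.
  by rewrite exponential_prob_itv0c// EFinB mulNr.
have -> : E @^-1` `]-oo, u] = E @^-1` `[0%R, u] `|` E @^-1` `]-oo, 0%R[.
  rewrite -preimage_setU; congr (_ @^-1` _); apply/seteqP; split => x /=; rewrite !in_itv /=.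
    by move=> xu; have [x0|x0] := ltP x 0; [right|left; rewrite xu].
  by move=> [/andP[]//|/ltW x0]; exact: le_trans u0.
have m1 : measurable (E @^-1` `[0%R, u]) by rewrite -[X in measurable X]setTI; apply: measurable_funPT.
have m2 : measurable (E @^-1` `]-oo, 0%R[) by rewrite -[X in measurable X]setTI; apply: measurable_funPT.
by rewrite -ge0; exact: measureU0.
Qed.

End Tails.

Section ExponentialStep.
Context (R : realType) (d : measure_display) (U : measurableType d)
  (P : probability U R) (lambda r theta : R) (E : U -> R).
Hypotheses (l0 : 0 < lambda) (r0 : 0 < r) (th0 : 0 <= theta).
Hypothesis mE : measurable_fun setT E.
Hypothesis tailE : forall u, 0 <= u ->
  Ex P (fun w => (u < E w)%R%:R) = expR (- (lambda * u)).
Local Notation C := R[i].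
Local Notation rc := (real_complex R).

Let is_derive_exp (k : R) (s : R) : is_derive s 1 (fun u => expR (- (k * u))) (- k * expR (- (k * s))).
Proof. by apply: is_derive_eq; rewrite /GRing.scale /=; ring. Qed.

Let cont_exp (k : R) : continuous (fun u : R => expR (- (k * u))).
Proof.
move=> s; apply: differentiable_continuous; apply/derivable1_diffP.
by case: (is_derive_exp k s).
Qed.

(** Running down from level [u] for an exponential time, stopped on falling by
    more than [v]: the coefficient [lambda + theta - r p] makes the integrand an
    exact derivative, so no division by it is needed. *)
Lemma exponential_step (z p : C) (u v : R) : 0 <= v ->
  let mu := rc (lambda + theta) - rc r * p in
  bounded_measurable (fun w => (0 < E w)%R%:R * (r * E w <= v)%R%:R *
    (expR (- (theta * E w)) * expw (mu * z) p (u - r * E w))) /\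
  Ex P (fun w => (0 < E w)%R%:R * (r * E w <= v)%R%:R *
    (expR (- (theta * E w)) * expw (mu * z) p (u - r * E w))) =
  lambda * (expw z p u - expR (- ((lambda + theta) * (v / r))) * expw z p (u - v)).
Proof.
move=> v0 mu; pose L := v / r; have L0 : 0 <= L by rewrite divr_ge0// ltW.
pose pt := rc theta - rc r * p.
pose y := z * cexp (- p * rc u).
have discount z' s : expR (- (theta * s)) * expw z' p (u - r * s) =
    expw (z' * cexp (- p * rc u)) pt s.
  rewrite expw_shift /expw.
  have -> : cexp (- pt * rc s) = rc (expR (- (theta * s))) * cexp (- p * rc (- (r * s))).
    rewrite (_ : - pt * rc s = rc (- (theta * s)) + (- p * rc (- (r * s)))).
      rewrite cexpD; congr (_ * _); rewrite /cexp /= cos0 sin0.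
      by rewrite (_ : Complex 1 0 = 1)// mulr1.
    rewrite /pt !rmorphN !rmorphM; ring.
  rewrite -[LHS]mulrC -ReMr; congr complex.Re; ring.
have phiE s : expR (- (theta * s)) * expw (mu * z) p (u - r * s) = expw (mu * y) pt s.
  by rewrite discount -mulrA.
pose phi := expw (mu * y) pt.
pose Psi s := lambda * expw y mu s.
pose Phi s := phi s * expR (- (lambda * s)) - Psi s.
have muE : mu = pt + rc lambda by rewrite /mu /pt rmorphD; ring.
have expwM k z' p' s : expw z' p' s * expR (- (k * s)) = expw z' (p' + rc k) s.
  rewrite /expw -ReMr -mulrA; congr (complex.Re (_ * _)).
  rewrite opprD mulrDl cexpD; congr (_ * _); rewrite -rmorphN -rmorphM mulNr.
  by rewrite /cexp /= cos0 sin0 (_ : Complex 1 0 = 1)// mulr1.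
have dPhi (s : R) : is_derive s 1 Phi (expw (- pt * (mu * y)) pt s * expR (- (lambda * s))).
  have := is_deriveB (is_deriveM (is_derive_expw (mu * y) pt s) (is_derive_exp lambda s))
    (is_deriveZ lambda (is_derive_expw y mu s)).
  move=> D; apply: (is_derive_eq D); rewrite /GRing.scale /=.
  have -> : expw (- mu * y) mu s = - (expw (mu * y) pt s * expR (- (lambda * s))).
    by rewrite expwM -muE /expw !mulNr; case: (_ * cexp _).
  ring.
have cPhi : continuous Phi.
  move=> s; apply: differentiable_continuous; apply/derivable1_diffP.
  by case: (dPhi s).
have tail0 s : 0 <= s <= L -> Ex P (fun w => (0 + s < E w)%R%:R) = expR (- (lambda * s)).
  by move=> /andP[s0 _]; under eq_fun do rewrite add0r; exact: tailE.
have [b1 e1] : bounded_measurable (fun w => (0 < E w)%R%:R * phi (Num.min (E w - 0) L)) /\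
    Ex P (fun w => (0 < E w)%R%:R * phi (Num.min (E w - 0) L)) =
    phi 0 * expR (- (lambda * 0)) + Phi L - Phi 0.
  apply: (layer_cake (Fb := fun s => expR (- (lambda * s)))
    (dphi := expw (- pt * (mu * y)) pt) mE L0 tail0).
  - exact: continuous_expw.
  - by move=> s; exact: is_derive_expw.
  - by apply: continuous_subspaceT; exact: cont_exp.
  - exact: continuous_subspaceT.
have b2 : bounded_measurable (fun w => phi L * (L < E w)%R%:R).
  by apply: bmfZ; apply: bmf_bool; exact: measurable_gt.
have -> : (fun w => (0 < E w)%R%:R * (r * E w <= v)%R%:R *
    (expR (- (theta * E w)) * expw (mu * z) p (u - r * E w))) =
  (fun w => (0 < E w)%R%:R * phi (Num.min (E w - 0) L) - phi L * (L < E w)%R%:R).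
  apply/funext => w; rewrite phiE subr0 mulrC -/phi.
  have -> : (r * E w <= v) = (E w <= L) by rewrite /L ler_pdivlMr// mulrC.
  have [EL|LE] := leP (E w) L; first by rewrite mulr1 mulr0 subr0 mulrC.
  by rewrite (le_lt_trans L0 LE) mulr0 mulr0 mulr1 mul1r subrr.
split; first exact: bmfB.
rewrite ExB// e1 ExZ; last by apply: bmf_bool; exact: measurable_gt.
rewrite tailE// /Phi /Psi mulr0 oppr0 expR0 !mulr1 /phi.
have -> : expR (- ((lambda + theta) * (v / r))) * expw z p (u - v) = expw y mu L.
  rewrite muE -expwM -/L.
  have -> : expw y pt L = expR (- (theta * L)) * expw z p (u - v).
    by rewrite -discount [r * L]mulrCA divff ?gt_eqF// mulr1.
  rewrite mulrDl opprD expRD; ring.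
have -> : expw z p u = expw y mu 0 by rewrite expw0.
ring.
Qed.

(** The range of integration is cut at [a + L]; the error is at most the tail
    there, which vanishes as [L] grows. *)
Lemma discounted_tail (a : R) : 0 <= a ->
  Ex P (fun w => (a < E w)%R%:R * expR (- (theta * E w))) =
  lambda / (lambda + theta) * expR (- ((lambda + theta) * a)).
Proof.
move=> a0; set A := Ex P _; set B := RHS.
have lt0 : 0 < lambda + theta by rewrite ltr_wpDr.
have mI c : measurable_fun setT (fun w => c < E w) by exact: measurable_gt.
have mexp : measurable_fun setT (fun w => expR (- (theta * E w))).
  apply: (@measurableT_comp _ _ _ _ _ _ (fun u => expR (- (theta * u)))) => //.
  by apply: continuous_measurable_fun; exact: cont_exp.
have bA : bounded_measurable (fun w => (a < E w)%R%:R * expR (- (theta * E w))).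
  split; first by apply: measurable_funM => //; exact: measurable_bool_natr.
  exists 1 => w; have [aE|_] := ltP a (E w); last by rewrite mul0r normr0.
  rewrite mul1r ger0_norm ?expR_ge0// -expR0 ler_expR oppr_le0 mulr_ge0//.
  by rewrite (le_trans a0)// ltW.
have bound L : 0 <= L -> `|A - B| <= 2 * expR (- (lambda * L)).
  move=> L0; pose phi s := expR (- (theta * (a + s))).
  have dphi (s : R) : is_derive s 1 phi (- theta * phi s).
    by rewrite /phi; apply: is_derive_eq; rewrite /GRing.scale /=; ring.
  have cphi : continuous phi.
    move=> s; apply: differentiable_continuous; apply/derivable1_diffP.
    by case: (dphi s).
  pose Fb s := expR (- (lambda * (a + s))).
  have dFb (s : R) : is_derive s 1 Fb (- lambda * Fb s).
    by rewrite /Fb; apply: is_derive_eq; rewrite /GRing.scale /=; ring.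
  have cFb : continuous Fb.
    move=> s; apply: differentiable_continuous; apply/derivable1_diffP.
    by case: (dFb s).
  pose Phi s := theta / (lambda + theta) * (phi s * Fb s).
  have dPhi (s : R) : is_derive s 1 Phi (- theta * phi s * Fb s).
    rewrite /Phi; apply: is_derive_eq; rewrite /GRing.scale /=.
    by field; rewrite gt_eqF.
  have cPhi : continuous Phi.
    move=> s; apply: differentiable_continuous; apply/derivable1_diffP.
    by case: (dPhi s).
  have tailL s : 0 <= s <= L -> Ex P (fun w => (a + s < E w)%R%:R) = Fb s.
    by move=> /andP[s0 _]; exact: tailE (addr_ge0 a0 s0).
  have [b1 e1] : bounded_measurable (fun w => (a < E w)%R%:R * phi (Num.min (E w - a) L)) /\
    Ex P (fun w => (a < E w)%R%:R * phi (Num.min (E w - a) L)) =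
    phi 0 * Fb 0 + Phi L - Phi 0.
    apply: (layer_cake (dphi := fun s => - theta * phi s) mE L0 tailL).
    - by move=> s; apply: cvgM; [exact: cvg_cst|exact: cphi].
    - exact: continuous_subspaceT.
    - exact: continuous_subspaceT.
  have bI : bounded_measurable (fun w => (a + L < E w)%R%:R : R) by exact: bmf_bool.
  have le1 : `|A - Ex P (fun w => (a < E w)%R%:R * phi (Num.min (E w - a) L))| <= expR (- (lambda * L)).
    rewrite -ExB//; apply: (@le_trans _ _ (Ex P (fun w => (a + L < E w)%R%:R))).
      apply: Ex_norm_le => //; first exact: bmfB.
      move=> w; have [aE|_] := ltP a (E w); last first.
        by rewrite !mul0r subrr normr0 ler0n.
      rewrite !mul1r /phi -ltrBrDl; have [EL|LE] := leP (E w - a) L.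
        by rewrite [a + _]addrC subrK subrr normr0 ler0n.
      have h1 : expR (- (theta * E w)) <= expR (- (theta * (a + L))).
        by rewrite ler_expR lerN2; apply: ler_wpM2l => //; rewrite -lerBrDl ltW.
      have h2 : expR (- (theta * (a + L))) <= 1.
        by rewrite -expR0 ler_expR oppr_le0 mulr_ge0// addr_ge0.
      have h3 := expR_ge0 (- (theta * E w)).
      rewrite /= ler_norml; lra.
    rewrite tailE ?addr_ge0// ler_expR lerN2; apply: ler_wpM2l; first exact: ltW.
    by rewrite lerDr.
  have le2 : `|phi 0 * Fb 0 + Phi L - Phi 0 - B| <= expR (- (lambda * L)).
    have -> : phi 0 * Fb 0 + Phi L - Phi 0 - B = Phi L.
      rewrite /Phi /B /phi /Fb !addr0 -expRD.
      have -> : - (theta * a) - lambda * a = - ((lambda + theta) * a) by ring.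
      by field; rewrite gt_eqF.
    have t1 : 0 <= theta / (lambda + theta) <= 1.
      by rewrite divr_ge0 ?(ltW lt0)//= ler_pdivrMr// mul1r lerDr ltW.
    have p1 : phi L <= 1.
      by rewrite /phi -expR0 ler_expR oppr_le0 mulr_ge0// addr_ge0.
    have p0 : 0 <= phi L by exact: expR_ge0.
    have F0 : 0 <= Fb L by exact: expR_ge0.
    have FL : Fb L <= expR (- (lambda * L)).
      rewrite /Fb ler_expR lerN2; apply: ler_wpM2l; first exact: ltW.
      by rewrite lerDr.
    rewrite ger0_norm; last by rewrite /Phi; move: t1 => /andP[t1 _]; apply: mulr_ge0 => //; exact: mulr_ge0.
    apply: le_trans FL; rewrite /Phi; move: t1 => /andP[t0 t1].
    by rewrite mulrA ler_piMl// mulr_ile1.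
  rewrite e1 in le1.
  have := ler_normD (A - (phi 0 * Fb 0 + Phi L - Phi 0)) (phi 0 * Fb 0 + Phi L - Phi 0 - B).
  rewrite addrA subrK => h; apply: le_trans h _.
  lra.
apply/eqP; rewrite -subr_eq0 -normr_le0 leNgt; apply/negP => x0.
set x := `|A - B| in bound x0.
have L0 : 0 <= 2 / (x * lambda) by rewrite divr_ge0// mulr_ge0// ltW.
have := bound _ L0; rewrite leNgt => /negP; apply.
have : 1 + lambda * (2 / (x * lambda)) <= expR (lambda * (2 / (x * lambda))) by exact: expR_ge1Dx.
have -> : lambda * (2 / (x * lambda)) = 2 / x.
  by field; rewrite !gt_eqF.
rewrite expRN => h.
have e0 : 0 < expR (2 / x) by exact: expR_gt0.
rewrite ltr_pdivrMr//; apply: lt_le_trans (ler_wpM2l (ltW x0) h).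
by rewrite mulrDr mulr1 mulrCA divff ?gt_eqF// mulr1 ltrDr.
Qed.

Section Roots.
Variables (N : nat) (c p lt : 'I_N -> C).
Hypothesis root : forall k, rc lambda * lt k = rc (lambda + theta) - rc r * p k.

Lemma exponential_step_expsum (u v : R) : 0 <= v ->
  bounded_measurable (fun w => (0 < E w)%R%:R * (r * E w <= v)%R%:R *
    (expR (- (theta * E w)) * expsum (fun k => c k * lt k) p (u - r * E w))) /\
  Ex P (fun w => (0 < E w)%R%:R * (r * E w <= v)%R%:R *
    (expR (- (theta * E w)) * expsum (fun k => c k * lt k) p (u - r * E w))) =
  expsum c p u - expR (- ((lambda + theta) * (v / r))) * expsum c p (u - v).
Proof.
move=> v0.
have S k := exponential_step (rc lambda^-1 * c k) (p k) u v0.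
have lc k : (rc (lambda + theta) - rc r * p k) * (rc lambda^-1 * c k) = c k * lt k.
  rewrite -root mulrACA -rmorphM divff ?gt_eqF// rmorph1 mul1r; exact: mulrC.
pose F k w := (0 < E w)%R%:R * (r * E w <= v)%R%:R *
    (expR (- (theta * E w)) * expw (c k * lt k) (p k) (u - r * E w)).
have -> : (fun w => (0 < E w)%R%:R * (r * E w <= v)%R%:R *
    (expR (- (theta * E w)) * expsum (fun k => c k * lt k) p (u - r * E w))) =
  (fun w => \sum_k F k w).
  by apply/funext => w; rewrite /expsum !mulr_sumr.
have bF k : bounded_measurable (F k) by have [] := S k; rewrite lc.
split; first exact: bmf_sum.
rewrite Ex_sum// /expsum mulr_sumr -sumrB; apply: eq_bigr => k _.
have [_] := S k; rewrite lc => ->.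
have sc x : expw (rc lambda^-1 * c k) (p k) x = lambda^-1 * expw (c k) (p k) x.
  by rewrite /expw -mulrA mulrC ReMr mulrC.
by rewrite !sc; field; rewrite gt_eqF.
Qed.

(** The boundary term at [tau] of the running-down formula is exactly the
    expected payoff [c0] discounted up to the return to [tau]. *)
Lemma step_above (u tau c0 : R) : tau <= u -> expsum c p tau = c0 ->
  bounded_measurable (fun w => (0 < E w)%R%:R *
    (if r * E w <= u - tau
     then expR (- (theta * E w)) * expsum (fun k => c k * lt k) p (u - r * E w)
     else c0 * expR (- (theta * ((u - tau) / r))))) /\
  Ex P (fun w => (0 < E w)%R%:R *
    (if r * E w <= u - tau
     then expR (- (theta * E w)) * expsum (fun k => c k * lt k) p (u - r * E w)
     else c0 * expR (- (theta * ((u - tau) / r))))) = expsum c p u.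
Proof.
move=> tu ec; have v0 : 0 <= u - tau by rewrite subr_ge0.
have [b1 e1] := exponential_step_expsum u v0.
have vr0 : 0 <= (u - tau) / r by rewrite divr_ge0// ltW.
have b2 : bounded_measurable (fun w => c0 * expR (- (theta * ((u - tau) / r))) *
    ((u - tau) / r < E w)%R%:R).
  by apply: bmfZ; apply: bmf_bool; exact: measurable_gt.
rewrite (_ : (fun w => _ * (if _ then _ else _)) = (fun w =>
    (0 < E w)%R%:R * (r * E w <= u - tau)%R%:R *
    (expR (- (theta * E w)) * expsum (fun k => c k * lt k) p (u - r * E w)) +
    c0 * expR (- (theta * ((u - tau) / r))) * ((u - tau) / r < E w)%R%:R)); last first.
  apply/funext => w; rewrite ltr_pdivrMr// [E w * r]mulrC.
  have [le|lt_] := leP (r * E w) (u - tau); first by rewrite mulr1 mulr0 addr0.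
  have E0 : 0 < E w by rewrite -(pmulr_rgt0 _ r0); exact: le_lt_trans lt_.
  by rewrite E0 mulr0 mul0r add0r mul1r mulr1.
split; first exact: bmfD.
rewrite ExD// e1 ExZ ?tailE//; last by apply: bmf_bool; exact: measurable_gt.
rewrite subKr ec -mulrA -expRD.
have -> : - (theta * ((u - tau) / r)) - lambda * ((u - tau) / r) =
  - ((lambda + theta) * ((u - tau) / r)) by ring.
by rewrite [c0 * _]mulrC subrK.
Qed.

(** At the bottom the process waits at level [0]. The condition [\sum_k c k * p
    k = 0], a reflecting boundary condition on [expsum c p], makes the boundary
    term of the running-down formula equal to the expected value of that wait.
    *)
Lemma step_below (u : R) : 0 <= u -> \sum_k c k * p k = 0 ->
  bounded_measurable (fun w => (0 < E w)%R%:R * (expR (- (theta * E w)) *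
    expsum (fun k => c k * lt k) p (Num.max (u - r * E w) 0))) /\
  Ex P (fun w => (0 < E w)%R%:R * (expR (- (theta * E w)) *
    expsum (fun k => c k * lt k) p (Num.max (u - r * E w) 0))) = expsum c p u.
Proof.
move=> u0 cp0; have [b1 e1] := exponential_step_expsum u u0.
have ur0 : 0 <= u / r by rewrite divr_ge0// ltW.
have lt0 : 0 < lambda + theta by rewrite ltr_wpDr.
pose h0 := expsum (fun k => c k * lt k) p 0.
have b0 : bounded_measurable (fun w => (u / r < E w)%R%:R * expR (- (theta * E w))).
  split.
    apply: measurable_funM; first by apply: measurable_bool_natr; exact: measurable_gt.
    apply: (@measurableT_comp _ _ _ _ _ _ (fun u => expR (- (theta * u)))) => //.
    by apply: continuous_measurable_fun; exact: cont_exp.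
  exists 1 => w; have [aE|_] := ltP (u / r) (E w); last by rewrite mul0r normr0.
  rewrite mul1r ger0_norm ?expR_ge0// -expR0 ler_expR oppr_le0 mulr_ge0//.
  by rewrite (le_trans ur0)// ltW.
have b2 := bmfZ h0 b0.
rewrite (_ : (fun w => (0 < E w)%R%:R * (_ * _)) = (fun w =>
    (0 < E w)%R%:R * (r * E w <= u)%R%:R *
    (expR (- (theta * E w)) * expsum (fun k => c k * lt k) p (u - r * E w)) +
    h0 * ((u / r < E w)%R%:R * expR (- (theta * E w))))); last first.
  apply/funext => w; rewrite ltr_pdivrMr// [E w * r]mulrC.
  have [le|lt_] := leP (r * E w) u.
    by rewrite mulr1 mul0r mulr0 addr0 (max_idPl _)// subr_ge0.
  have E0 : 0 < E w by rewrite -(pmulr_rgt0 _ r0); exact: le_lt_trans lt_.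
  rewrite E0 mulr0 mul0r add0r !mul1r (max_idPr _) ?subr_le0 ?ltW//.
  by rewrite mulrC.
split; first exact: bmfD.
rewrite ExD// e1 ExZ// discounted_tail// subrr.
have -> : h0 = (lambda + theta) / lambda * expsum c p 0.
  apply: (mulfI (lt0r_neq0 l0)); rewrite mulrA mulrCA divff ?gt_eqF// mulr1.
  rewrite /h0 !expsumE [LHS]mulrC -ReMr [RHS]mulrC -ReMr; congr complex.Re.
  rewrite !mulr_suml; apply/eqP; rewrite -subr_eq0 -sumrB.
  rewrite (eq_bigr (fun k => - rc r * (c k * p k))); last first.
    move=> k _; rewrite !mulr0 cexp0 !mulr1 -mulrA [lt k * _]mulrC root; ring.
  by rewrite -mulr_sumr cp0 mulr0.
by field; rewrite !gt_eqF.
Qed.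

End Roots.

End ExponentialStep.

(** * Weights of the stages of the excursion *)

Section WeightedAverage.
Context (R : realType) (d : measure_display) (U : measurableType d)
  (P : probability U R) (I : eqType) (X : I -> U -> R).
Hypothesis mX : forall i, measurable_fun setT (X i).
Hypothesis indX : mutually_independent P X.

Lemma weighted_average (d1 : measure_display) (V : measurableType d1)
    (s : seq I) (j : I) (W : U -> R) (Y : U -> V) (h : V * R -> R) :
  uniq s -> j \notin s ->
  measurable_fun (setT : set (known_by X s)) W -> (exists M, forall w, `|W w| <= M) ->
  measurable_fun (setT : set (known_by X s)) Y -> bounded_measurable h ->
  Ex P (fun w => W w * h (Y w, X j w)) =
  Ex P (fun w => W w * Ex P (fun w' => h (Y w, X j w'))).
Proof.
move=> us js mW [M WM] mY bh.
pose cl (x : R) := Num.max (- M) (Num.min x M).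
have clE w : cl (W w) = W w.
  have := WM w; rewrite ler_norml => /andP[h1 h2].
  by rewrite /cl (min_idPl h2) (max_idPr h1).
have bcl : bounded_measurable cl.
  split.
    apply: measurable_maxr; first exact: measurable_cst.
    by apply: measurable_minr => //; exact: measurable_cst.
  exists `|M| => x; rewrite /cl ler_norml le_max ge_max ge_min lerN2.
  by rewrite ler_norm orbT andbT -normrN ler_norm.
pose h' (z : R * V * R) := cl z.1.1 * h (z.1.2, z.2).
have bh' : bounded_measurable h'.
  apply: bmfM.
    apply: (bmf_comp bcl (k := fun z : R * V * R => z.1.1)).
    exact: (measurableT_comp measurable_fst measurable_fst).
  apply: (bmf_comp bh (k := fun z : R * V * R => (z.1.2, z.2))).
  apply: measurable_fun_pair; last exact: measurable_snd.
  exact: (measurableT_comp measurable_snd measurable_fst).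
have mWY : measurable_fun (setT : set (known_by X s)) (fun w => (W w, Y w)).
  exact: measurable_fun_pair.
have := average_independent mX indX us js mWY bh'.
under eq_fun do rewrite /h' /= clE.
move=> ->; congr (Ex P _); apply/funext => w.
under eq_fun do rewrite /h' /= clE.
by rewrite ExZ//; apply: (bmf_comp bh); exact: measurable_fun_pair.
Qed.

Lemma independent_product (s : seq I) (j : I) (W : U -> R) (h : R -> R) :
  uniq s -> j \notin s ->
  measurable_fun (setT : set (known_by X s)) W -> (exists M, forall w, `|W w| <= M) ->
  bounded_measurable h ->
  Ex P (fun w => W w * h (X j w)) = Ex P W * Ex P (fun w => h (X j w)).
Proof.
move=> us js mW bW bh.
have bh' : bounded_measurable (fun z : R * R => h z.2).
  by apply: (bmf_comp bh (k := snd)); exact: measurable_snd.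
rewrite (@weighted_average _ R s j W W (fun z => h z.2))//=.
have bW' : bounded_measurable W by split => //; exact: (known_by_measurable mX mW).
under eq_fun do rewrite mulrC.
by rewrite ExZ// mulrC.
Qed.

End WeightedAverage.

Section Skeleton.
Context (R : realType) (r K tau th1 th2 l0 b0 g0 : R).

Section Path.
Variables e b : nat -> R.

(** The excursion is observed at the jump epochs: [wbelow], [wabove] and [wdone]
    are its discounted indicators of not having crossed [tau], of being above, and
    of being back. The initial weights [b0] and [g0] allow an excursion to start
    above [tau], which uniqueness above [tau] requires. The factors [0 < e k] and
    [0 < b k] hold almost surely and keep the weights bounded everywhere. *)
Fixpoint level (k : nat) : R :=
  if k is k'.+1 then
    Num.min (Num.max (level k' - r * e k') 0 + b k') K
  else l0.

(** The level that the jump would reach without the cap: crossing [tau] is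
    decided by it, which matters when [tau = K]. *)
Definition raw (k : nat) : R := Num.max (level k - r * e k) 0 + b k.

Fixpoint wbelow (k : nat) : R :=
  if k is k'.+1 then
    wbelow k' * ((0 < e k')%R%:R * expR (- (th1 * e k'))) *
      ((0 < b k')%R%:R * (raw k' <= tau)%R%:R)
  else b0.

Fixpoint wabove (k : nat) : R :=
  if k is k'.+1 then
    wbelow k' * ((0 < e k')%R%:R * expR (- (th1 * e k'))) *
      ((0 < b k')%R%:R * (tau < raw k')%R%:R) +
    wabove k' * ((0 < e k')%R%:R * (r * e k' <= level k' - tau)%R%:R *
      expR (- (th2 * e k'))) * (0 < b k')%R%:R
  else g0.

Fixpoint wdone (k : nat) : R :=
  if k is k'.+1 then
    wdone k' + wabove k' * ((0 < e k')%R%:R * (level k' - tau < r * e k')%R%:R *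
      expR (- (th2 * (Num.max (level k' - tau) 0 / r))))
  else 0.

Hypotheses (r0 : 0 < r) (t0 : 0 <= tau) (tK : tau <= K)
  (th10 : 0 <= th1) (th20 : 0 <= th2).
Hypotheses (b00 : 0 <= b0) (g00 : 0 <= g0).
Hypothesis bl0 : b0 != 0 -> 0 <= l0 <= tau.
Hypothesis gl0 : g0 != 0 -> tau <= l0 <= K.

Lemma discount_le1 (th x : R) : 0 <= th -> (0 < x)%R%:R * expR (- (th * x)) <= 1.
Proof.
move=> th0; have [x0|_] := ltP 0 x; last by rewrite mul0r.
by rewrite mul1r -expR0 ler_expR oppr_le0 mulr_ge0// ltW.
Qed.

Lemma weights_invariant k :
  [/\ 0 <= wbelow k, 0 <= wabove k, 0 <= wdone k,
      wbelow k + wabove k + wdone k <= b0 + g0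
    & (wbelow k != 0 -> 0 <= level k <= tau) /\
      (wabove k != 0 -> tau <= level k <= K)].
Proof.
elim: k => [|k [B0 A0 D0 sum [Bl Al]]]; first by split => //=; rewrite addr0.
set B := wbelow k in B0 sum Bl *; set A := wabove k in A0 sum Al *.
set l := level k in Bl Al *.
pose x := (0 < e k)%R%:R * expR (- (th1 * e k)).
have x01 : 0 <= x <= 1 by rewrite discount_le1// andbT mulr_ge0// expR_ge0.
have [x0 x1] := andP x01.
pose y := (0 < e k)%R%:R * expR (- (th2 * e k)).
have y01 : 0 <= y <= 1 by rewrite discount_le1// andbT mulr_ge0// expR_ge0.
have [y0 y1] := andP y01.
pose v := (0 < e k)%R%:R * expR (- (th2 * (Num.max (l - tau) 0 / r))).
have v01 : 0 <= v <= 1.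
  rewrite /v mulr_ge0 ?expR_ge0//=; have [_|_] := ltP 0 (e k); last by rewrite mul0r.
  rewrite mul1r -expR0 ler_expR oppr_le0 mulr_ge0// divr_ge0 ?(ltW r0)//.
  by rewrite le_max lexx orbT.
have [v0 v1] := andP v01.
have Bx : B * x <= B by rewrite ler_piMr.
have Bx0 : 0 <= B * x by rewrite mulr_ge0.
have Ay : A * y <= A by rewrite ler_piMr.
have Ay0 : 0 <= A * y by rewrite mulr_ge0.
have Av : A * v <= A by rewrite ler_piMr.
have Av0 : 0 <= A * v by rewrite mulr_ge0.
have E1 : wbelow k.+1 = B * x * ((0 < b k)%R%:R * (raw k <= tau)%R%:R) by [].
have E2 : wabove k.+1 = B * x * ((0 < b k)%R%:R * (tau < raw k)%R%:R) +
    A * y * ((r * e k <= l - tau)%R%:R * (0 < b k)%R%:R).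
  by rewrite /= -/B -/A -/x -/l /y; congr (_ + _); rewrite -!mulrA; congr (_ * (_ * _)); exact: mulrCA.
have E3 : wdone k.+1 = wdone k + A * v * (l - tau < r * e k)%R%:R.
  by rewrite /= -/A -/l /v; congr (_ + _); rewrite -!mulrA; congr (_ * (_ * _)); exact: mulrC.
rewrite E1 E2 E3.
have lK : level k.+1 <= K by rewrite /= ge_min lexx orbT.
split.
- by rewrite !mulr_ge0.
- by rewrite addr_ge0// !mulr_ge0.
- by rewrite addr_ge0// !mulr_ge0.
- rewrite (ltNge tau) (ltNge _ (r * e k)).
  case: (0 < b k); case: (raw k <= tau); case: (r * e k <= l - tau);
  rewrite /= ?mulr0 ?mul0r ?mulr1 ?addr0 ?add0r; lra.
- split.
    move=> nz; have /andP[Bx_ /andP[]] :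
        (B * x != 0) && ((0 < b k) && (raw k <= tau)).
      move: nz; rewrite mulf_eq0 negb_or => /andP[-> /=].
      by case: (0 < b k); case: (raw k <= tau); rewrite ?mul0r ?mulr0 ?eqxx.
    move=> bk rt; rewrite /= -/(raw k) (min_idPl (le_trans rt tK)) rt andbT.
    by rewrite /raw addr_ge0 ?(ltW bk)// le_max lexx orbT.
  move=> nz; rewrite lK andbT /= -/(raw k) le_min tK andbT.
  have [lt|le] := ltP tau (raw k); first exact: ltW.
  move: nz; rewrite (ltNge tau) le /= mulr0 mulr0 add0r.
  have [re|] := leP (r * e k) (l - tau); last by rewrite mul0r mulr0 eqxx.
  have [bk|] := ltP 0 (b k); last by rewrite !mulr0 eqxx.
  move=> _; apply: le_trans (_ : l - r * e k <= _); first by lra.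
  by rewrite /raw -/l -[leLHS]addr0 lerD ?(ltW bk)// le_max lexx.
Qed.

End Path.
End Skeleton.

(** * The value martingale *)

(** Mass leaves the first stage at a geometric rate and feeds the second, which
    it leaves at a geometric rate too. *)
Lemma two_stage_decay (R : realType) (rho : R) (a b : nat -> R) : 0 <= rho < 1 ->
  (forall k, 0 <= a k) -> (forall k, 0 <= b k) ->
  (forall k, b k.+1 <= rho * b k) -> (forall k, a k.+1 <= b k + rho * a k) ->
  exists C rho', [/\ 0 <= C, 0 <= rho' < 1
    & forall k, b k + a k <= C * rho' ^+ k].
Proof.
move=> /andP[rho0 rho1] age0 bge0 bS aS.
pose rho' := (1 + rho) / 2.
(* The weight [kap] of the first stage makes the two-stage recursion contract. *)
have [kap kap1 kapE] : exists2 kap, 1 <= kap & 1 + kap * rho = rho' * kap.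
  have d0 : 0 < 1 - rho by lra.
  exists (2 / (1 - rho)); last by rewrite /rho'; field; rewrite gt_eqF.
  by rewrite ler_pdivlMr// mul1r; lra.
have kap0 : 0 <= kap by exact: le_trans kap1.
have r'0 : 0 <= rho' by rewrite /rho'; lra.
have r'1 : rho' < 1 by rewrite /rho'; lra.
exists (a 0%N + kap * b 0%N), rho'; split; [|exact/andP|move=> k].
  by rewrite addr_ge0// mulr_ge0.
suff H : a k + kap * b k <= (a 0%N + kap * b 0%N) * rho' ^+ k.
  by apply: le_trans H; rewrite addrC lerD2l ler_peMl.
elim: k => [|k IH]; first by rewrite expr0 mulr1.
apply: (@le_trans _ _ (rho' * (a k + kap * b k))); last first.
  by rewrite exprS mulrCA ler_wpM2l.
have h1 : kap * b k.+1 <= kap * (rho * b k) by rewrite ler_wpM2l.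
have h2 : rho * a k <= rho' * a k by rewrite ler_wpM2r// /rho'; lra.
have h3 := aS k; rewrite mulrDr [rho' * (kap * _)]mulrA -kapE.
rewrite mulrDl mul1r -[kap * rho * _]mulrA; lra.
Qed.

Section Martingale.
Context (R : realType) (d : measure_display) (U : measurableType d)
  (P : probability U R) (E S : nat -> U -> R).
Context (r K tau th1 th2 l0 b0 g0 : R).
Hypotheses (r0 : 0 < r) (t0 : 0 <= tau) (tK : tau <= K)
  (th10 : 0 <= th1) (th20 : 0 <= th2).
Hypotheses (b00 : 0 <= b0) (g00 : 0 <= g0).
Hypothesis bl0 : b0 != 0 -> 0 <= l0 <= tau.
Hypothesis gl0 : g0 != 0 -> tau <= l0 <= K.

Definition driver (i : nat + nat) : U -> R :=
  match i with inl k => E k | inr k => S k end.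

Hypothesis mX : forall i, measurable_fun setT (driver i).
Hypothesis indX : mutually_independent P driver.

(** The coordinates that determine the state after the jump of index [k]. *)
Definition past (k : nat) : seq (nat + nat) :=
  [seq inl i | i <- iota 0 k] ++ [seq inr i | i <- iota 0 k].

Lemma mem_past k i : (i \in past k) = (match i with inl j | inr j => j < k end)%N.
Proof.
rewrite /past mem_cat; case: i => j.
  rewrite mem_map; last by move=> x y [].
  by rewrite mem_iota orbC; case: mapP => [[]|].
rewrite [X in _ || X]mem_map; last by move=> x y [].
by rewrite mem_iota; case: mapP => [[]|].
Qed.

Lemma past_uniq k : uniq (past k).
Proof.
rewrite /past cat_uniq !map_inj_uniq ?iota_uniq /= ?andbT; try by move=> x y [].
by apply/hasPn => _ /mapP[i _ ->]; apply/mapP => -[].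
Qed.

Let lv k w := level r K l0 (E^~ w) (S^~ w) k.
Let rw_ k w := raw r K l0 (E^~ w) (S^~ w) k.
Let wb k w := wbelow r K tau th1 l0 b0 (E^~ w) (S^~ w) k.
Let wa k w := wabove r K tau th1 th2 l0 b0 g0 (E^~ w) (S^~ w) k.
Let wd k w := wdone r K tau th1 th2 l0 b0 g0 (E^~ w) (S^~ w) k.

Let known k (Y : U -> R) :=
  measurable_fun (setT : set (known_by driver (past k))) Y.

Let known_sub k Y : known k Y -> known k.+1 Y.
Proof.
apply: known_by_sub => i; rewrite !mem_past.
by case: i => j /ltnW.
Qed.

Let knownE k : known k.+1 (E k).
Proof. by apply: (known_by_coordinate (i := inl k)); rewrite mem_past ltnSn. Qed.

Let knownS k : known k.+1 (S k).
Proof. by apply: (known_by_coordinate (i := inr k)); rewrite mem_past ltnSn. Qed.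

Section Measurability.
Variables (d' : measure_display) (V : measurableType d').
Implicit Types (Y Z : V -> R).

Lemma measurable_expN Y (th : R) : measurable_fun setT Y ->
  measurable_fun setT (fun w => expR (- (th * Y w))).
Proof.
move=> mY; apply: (@measurableT_comp _ _ _ _ _ _ expR) => //.
by apply: measurable_funN; apply: measurable_funM => //; exact: measurable_cst.
Qed.

Lemma measurable_gt0 Y : measurable_fun setT Y ->
  measurable_fun setT (fun w => (0 < Y w)%R%:R : R).
Proof. by move=> mY; apply: measurable_bool_natr; exact: measurable_gt. Qed.

Lemma measurable_reflect Y Z : measurable_fun setT Y -> measurable_fun setT Z ->
  measurable_fun setT (fun w => Num.max (Y w - r * Z w) 0).
Proof.
move=> mY mZ; apply: measurable_maxr; last exact: measurable_cst.
by apply: measurable_funB => //; apply: measurable_funM => //; exact: measurable_cst.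
Qed.

Lemma measurable_ltb Y Z : measurable_fun setT Y -> measurable_fun setT Z ->
  measurable_fun setT (fun w => (Y w < Z w)%R%:R : R).
Proof. by move=> mY mZ; apply: measurable_bool_natr; exact: measurable_fun_ltr. Qed.

Lemma measurable_leb Y Z : measurable_fun setT Y -> measurable_fun setT Z ->
  measurable_fun setT (fun w => (Y w <= Z w)%R%:R : R).
Proof. by move=> mY mZ; apply: measurable_bool_natr; exact: measurable_fun_ler. Qed.

End Measurability.

Lemma weights_known k : [/\ known k (lv k), known k (wb k), known k (wa k)
  & known k (wd k)].
Proof.
elim: k => [|k [/known_sub mL /known_sub mB /known_sub mA /known_sub mD]].
  by split; exact: measurable_cst.
have mE := @knownE k; have mS := @knownS k.
have mraw : known k.+1 (rw_ k).
  by apply: measurable_funD => //; exact: measurable_reflect.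
have mc (x : R) : known k.+1 (fun=> x) by exact: measurable_cst.
split.
- exact: measurable_minr.
- apply: measurable_funM; first apply: measurable_funM => //.
    by apply: measurable_funM; [exact: measurable_gt0|exact: measurable_expN].
  by apply: measurable_funM; [exact: measurable_gt0|exact: measurable_leb].
- apply: measurable_funD; apply: measurable_funM.
  + apply: measurable_funM => //.
    by apply: measurable_funM; [exact: measurable_gt0|exact: measurable_expN].
  + by apply: measurable_funM; [exact: measurable_gt0|exact: measurable_ltb].
  + apply: measurable_funM => //; apply: measurable_funM; last exact: measurable_expN.
    apply: measurable_funM; first exact: measurable_gt0.
    by apply: measurable_leb; [exact: measurable_funM|exact: measurable_funB].
  + exact: measurable_gt0.
- apply: measurable_funD => //; apply: measurable_funM => //.
  apply: measurable_funM.
    apply: measurable_funM; first exact: measurable_gt0.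
    by apply: measurable_ltb; [exact: measurable_funB|exact: measurable_funM].
  apply: (@measurableT_comp _ _ _ _ _ _ expR) => //.
  apply: measurable_funN; apply: measurable_funM; first exact: measurable_cst.
  apply: measurable_funM; last exact: measurable_cst.
  by apply: measurable_maxr => //; exact: measurable_funB.
Qed.

Let inv k w := weights_invariant (E^~ w) (S^~ w) r0 tK th10 th20 b00 g00 bl0 gl0 k.

Lemma weights_bounded k :
  [/\ bounded_measurable (wb k), bounded_measurable (wa k)
    & bounded_measurable (wd k)].
Proof.
have [mL mB mA mD] := weights_known k.
split.
- split; first exact: (known_by_measurable mX mB).
  by exists (b0 + g0) => w; have [? ? ? ? _] := inv k w; rewrite ger0_norm// /wb; lra.
- split; first exact: (known_by_measurable mX mA).
  by exists (b0 + g0) => w; have [? ? ? ? _] := inv k w; rewrite ger0_norm// /wa; lra.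
- split; first exact: (known_by_measurable mX mD).
  by exists (b0 + g0) => w; have [? ? ? ? _] := inv k w; rewrite ger0_norm// /wd; lra.
Qed.

Section Values.
Variables (f g f1 g1 : R -> R) (c0 : R).
Hypotheses (bf : bounded_measurable f) (bg : bounded_measurable g)
  (bf1 : bounded_measurable f1) (bg1 : bounded_measurable g1).
Hypothesis jump_f : b0 != 0 -> forall k u, 0 <= u <= tau ->
  Ex P (fun w => (0 < S k w)%R%:R * glue tau K f g (u + S k w)) = f1 u.
Hypothesis run_f : b0 != 0 -> forall k u, 0 <= u <= tau ->
  Ex P (fun w => (0 < E k w)%R%:R *
    (expR (- (th1 * E k w)) * f1 (Num.max (u - r * E k w) 0))) = f u.
Hypothesis jump_g : forall k u, tau <= u <= K ->
  Ex P (fun w => (0 < S k w)%R%:R * g (Num.min (u + S k w) K)) = g1 u.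
Hypothesis run_g : forall k u, tau <= u <= K ->
  Ex P (fun w => (0 < E k w)%R%:R *
    (if r * E k w <= u - tau
     then expR (- (th2 * E k w)) * g1 (u - r * E k w)
     else c0 * expR (- (th2 * ((u - tau) / r))))) = g u.

Let wb0 k w : b0 = 0 -> wb k w = 0.
Proof. by move=> e; rewrite /wb; elim: k => //= k ->; rewrite !mul0r. Qed.

Let bglue : bounded_measurable (glue tau K f g).
Proof.
apply: bmf_if => //; first exact: measurable_le.
by apply: (bmf_comp bg); apply: measurable_minr => //; exact: measurable_cst.
Qed.

Let gt0_bmf (d' : measure_display) (V : measurableType d') (Y : V -> R) :
  measurable_fun setT Y -> bounded_measurable (fun z => (0 < Y z)%R%:R : R).
Proof. by move=> mY; apply: bmf_bool; exact: measurable_gt. Qed.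

Let disc_bmf (d' : measure_display) (V : measurableType d') (Y : V -> R) th :
  0 <= th -> measurable_fun setT Y ->
  bounded_measurable (fun z => (0 < Y z)%R%:R * expR (- (th * Y z)) : R).
Proof.
move=> th0 mY; split.
  by apply: measurable_funM; [exact: measurable_gt0|exact: measurable_expN].
exists 1 => z; rewrite ger0_norm; first exact: discount_le1.
by rewrite mulr_ge0// expR_ge0.
Qed.

Let value k w := wb k w * f (lv k w) + wa k w * g (lv k w) + c0 * wd k w.

Let vbelow k w := wb k w * ((0 < E k w)%R%:R * expR (- (th1 * E k w)) *
  ((0 < S k w)%R%:R * glue tau K f g (Num.max (lv k w - r * E k w) 0 + S k w))).

Let vabove k w := wa k w *
  ((0 < E k w)%R%:R * (r * E k w <= lv k w - tau)%R%:R * expR (- (th2 * E k w)) *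
   ((0 < S k w)%R%:R * g (Num.min (lv k w - r * E k w + S k w) K))).

Let vback k w := wa k w * ((0 < E k w)%R%:R * ((lv k w - tau < r * E k w)%R%:R *
   (c0 * expR (- (th2 * (Num.max (lv k w - tau) 0 / r)))))).

Let value_step k w :
  value k.+1 w = vbelow k w + (vabove k w + vback k w) + c0 * wd k w.
Proof.
have [_ _ _ _ [_ Al]] := inv k w.
rewrite /value /vbelow /vabove /vback.
set l := lv k w; set e := E k w; set s := S k w.
have El : lv k.+1 w = Num.min (Num.max (l - r * e) 0 + s) K by [].
have Eb : wb k.+1 w = wb k w * ((0 < e)%R%:R * expR (- (th1 * e))) *
   ((0 < s)%R%:R * (Num.max (l - r * e) 0 + s <= tau)%R%:R) by [].
have Ea : wa k.+1 w = wb k w * ((0 < e)%R%:R * expR (- (th1 * e))) *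
   ((0 < s)%R%:R * (tau < Num.max (l - r * e) 0 + s)%R%:R) +
   wa k w * ((0 < e)%R%:R * (r * e <= l - tau)%R%:R * expR (- (th2 * e))) * (0 < s)%R%:R by [].
have Ed : wd k.+1 w = wd k w + wa k w * ((0 < e)%R%:R * (l - tau < r * e)%R%:R *
   expR (- (th2 * (Num.max (l - tau) 0 / r)))) by [].
rewrite El Eb Ea Ed; set x := Num.max (l - r * e) 0 + s.
set B := wb k w; set D := (0 < e)%R%:R * expR (- (th1 * e)).
set A := wa k w.
have -> : A * ((0 < e)%R%:R * (r * e <= l - tau)%R%:R * expR (- (th2 * e)) *
    ((0 < s)%R%:R * g (Num.min (l - r * e + s) K))) =
  A * ((0 < e)%R%:R * (r * e <= l - tau)%R%:R * expR (- (th2 * e)) *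
    ((0 < s)%R%:R * g (Num.min x K))).
  have [re|_] := leP (r * e) (l - tau); last by rewrite !mulr0 !mul0r.
  have m0 : 0 <= l - r * e by rewrite subr_ge0 (le_trans re)// lerBlDr lerDl.
  by rewrite /x (max_idPl m0).
have -> : glue tau K f g x = (x <= tau)%R%:R * f (Num.min x K) +
    (tau < x)%R%:R * g (Num.min x K).
  rewrite /glue ltNge; have [xt|_] /= := leP x tau.
    by rewrite mul1r mul0r addr0 (min_idPl (le_trans xt tK)).
  by rewrite mul1r mul0r add0r.
ring.
Qed.

Let value_bounded k : bounded_measurable (value k).
Proof.
have [mL _ _ _] := weights_known k; have [bB bA bD] := weights_bounded k.
have mL' := known_by_measurable mX mL.
apply: bmfD; last exact: bmfZ.
by apply: bmfD; apply: bmfM => //; exact: bmf_comp.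
Qed.

Let mE k : measurable_fun setT (E k). Proof. exact: (mX (inl k)). Qed.
Let mS k : measurable_fun setT (S k). Proof. exact: (mX (inr k)). Qed.

Let before_jump k : uniq (inl k :: past k) /\ inr k \notin inl k :: past k.
Proof.
by rewrite /= past_uniq !inE !mem_past ltnn.
Qed.

Let known_run k Y : known k Y ->
  measurable_fun (setT : set (known_by driver (inl k :: past k))) Y.
Proof. by apply: known_by_sub => i; rewrite inE => ->; rewrite orbT. Qed.

Let knownE_run k : measurable_fun (setT : set (known_by driver (inl k :: past k))) (E k).
Proof. by apply: (known_by_coordinate (i := inl k)); rewrite inE eqxx. Qed.

Let below_average k : Ex P (vbelow k) = Ex P (fun w => wb k w * f (lv k w)).
Proof.
have [b0e|b0n] := eqVneq b0 0.
  congr (Ex P _); apply/funext => w.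
  by rewrite /vbelow wb0// !mul0r.
have [mL mB _ _] := weights_known k; have [bB _ _] := weights_bounded k.
have [us js] := before_jump k.
have mL1 := known_run mL; have mB1 := known_run mB; have mE1 := @knownE_run k.
have e1 : Ex P (vbelow k) = Ex P (fun w => wb k w *
   ((0 < E k w)%R%:R * (expR (- (th1 * E k w)) * f1 (Num.max (lv k w - r * E k w) 0)))).
  pose W w := wb k w * ((0 < E k w)%R%:R * expR (- (th1 * E k w))).
  pose h (z : R * R) := (0 < z.2)%R%:R * glue tau K f g (z.1 + z.2).
  have bW : bounded_measurable W by apply: bmfM => //; exact: disc_bmf.
  have bh : bounded_measurable h.
    apply: bmfM; first exact: gt0_bmf.
    by apply: (bmf_comp bglue); exact: measurable_funD.
  transitivity (Ex P (fun w => W w * h (Num.max (lv k w - r * E k w) 0, driver (inr k) w))).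
    by congr (Ex P _); apply/funext => w; rewrite /vbelow /W /h /= !mulrA.
  rewrite (weighted_average mX indX us js (W := W)) //; last 3 first.
  - by apply: measurable_funM => //; apply: measurable_funM;
      [exact: measurable_gt0|exact: measurable_expN].
  - by case: bW.
  - exact: measurable_reflect.
  congr (Ex P _); apply/funext => w; rewrite /W /h /=.
  have [w0|wn] := eqVneq (wb k w) 0; first by rewrite w0 !mul0r.
  have [e0|_] := ltP 0 (E k w); last by rewrite !(mul0r, mulr0).
  have [_ _ _ _ [/(_ wn) /andP[l0_ lt_] _]] := inv k w.
  rewrite jump_f ?mul1r ?mulrA// le_max lexx orbT ge_max t0 andbT.
  by rewrite (le_trans _ lt_)// lerBlDr lerDl mulr_ge0// ltW.
rewrite e1; pose h (z : R * R) := (0 < z.2)%R%:R * expR (- (th1 * z.2)) *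
  f1 (Num.max (z.1 - r * z.2) 0).
have bh : bounded_measurable h.
  apply: bmfM; first exact: disc_bmf.
  by apply: (bmf_comp bf1); exact: measurable_reflect.
transitivity (Ex P (fun w => wb k w * h (lv k w, driver (inl k) w))).
  by congr (Ex P _); apply/funext => w; rewrite /h /= !mulrA.
rewrite (weighted_average mX indX (past_uniq k) (W := wb k)) //; last 2 first.
- by rewrite mem_past ltnn.
- by case: bB.
congr (Ex P _); apply/funext => w; rewrite /h /=.
have [w0|wn] := eqVneq (wb k w) 0; first by rewrite w0 !mul0r.
have [_ _ _ _ [/(_ wn) lt_ _]] := inv k w.
by rewrite -(run_f b0n k lt_); congr (_ * Ex P _); apply/funext => w'; rewrite mulrA.
Qed.

Let vback_bounded k : bounded_measurable (vback k).
Proof.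
have [mL _ _ _] := weights_known k; have [_ bA _] := weights_bounded k.
have mL' := known_by_measurable mX mL.
apply: bmfM => //; apply: bmfM; first exact: gt0_bmf.
apply: bmfM.
  apply: bmf_bool; apply: measurable_fun_ltr; first exact: measurable_funB.
  by apply: measurable_funM => //; exact: measurable_cst.
apply: bmfZ; split.
  apply: (measurable_expN (Y := fun w => Num.max (lv k w - tau) 0 / r)).
  apply: measurable_funM; last exact: measurable_cst.
  by apply: measurable_maxr => //; exact: measurable_funB.
exists 1 => w; rewrite ger0_norm ?expR_ge0// -expR0 ler_expR oppr_le0.
by rewrite mulr_ge0// divr_ge0 ?(ltW r0)// le_max lexx orbT.
Qed.

Let vabove_bounded k : bounded_measurable (vabove k).
Proof.
have [mL _ _ _] := weights_known k; have [_ bA _] := weights_bounded k.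
have mL' := known_by_measurable mX mL.
have mrE : measurable_fun setT (fun w => r * E k w).
  by apply: measurable_funM => //; exact: measurable_cst.
apply: bmfM => //; apply: bmfM.
  have -> : (fun w => (0 < E k w)%R%:R * (r * E k w <= lv k w - tau)%R%:R *
      expR (- (th2 * E k w))) = (fun w => (r * E k w <= lv k w - tau)%R%:R *
      ((0 < E k w)%R%:R * expR (- (th2 * E k w)))).
    by apply/funext => w; ring.
  apply: bmfM; last exact: disc_bmf.
  by apply: bmf_bool; apply: measurable_fun_ler => //; exact: measurable_funB.
apply: bmfM; first exact: gt0_bmf.
apply: (bmf_comp bg); apply: measurable_minr; last exact: measurable_cst.
by apply: measurable_funD => //; exact: measurable_funB.
Qed.

Let above_average k :
  Ex P (fun w => vabove k w + vback k w) = Ex P (fun w => wa k w * g (lv k w)).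
Proof.
have [mL _ mA _] := weights_known k; have [_ bA _] := weights_bounded k.
have [us js] := before_jump k.
have mL1 := known_run mL; have mA1 := known_run mA; have mE1 := @knownE_run k.
pose W w := wa k w * ((r * E k w <= lv k w - tau)%R%:R *
  ((0 < E k w)%R%:R * expR (- (th2 * E k w)))).
pose V w := W w * g1 (lv k w - r * E k w).
have mrE1 : measurable_fun (setT : set (known_by driver (inl k :: past k))) (fun w => r * E k w).
  by apply: measurable_funM => //; exact: measurable_cst.
have mW : measurable_fun (setT : set (known_by driver (inl k :: past k))) W.
  apply: measurable_funM => //; apply: measurable_funM.
    by apply: measurable_leb => //; exact: measurable_funB.
  by apply: measurable_funM; [exact: measurable_gt0|exact: measurable_expN].
have bW : bounded_measurable W.
  apply: bmfM => //; apply: bmfM; last exact: disc_bmf.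
  apply: bmf_bool; apply: measurable_fun_ler.
    exact: (known_by_measurable mX mrE1).
  by apply: measurable_funB => //; exact: (known_by_measurable mX mL).
have e1 : Ex P (vabove k) = Ex P V.
  pose h (z : R * R) := (0 < z.2)%R%:R * g (Num.min (z.1 + z.2) K).
  have bh : bounded_measurable h.
    apply: bmfM; first exact: gt0_bmf.
    apply: (bmf_comp bg); apply: measurable_minr; last exact: measurable_cst.
    exact: measurable_funD.
  transitivity (Ex P (fun w => W w * h (lv k w - r * E k w, driver (inr k) w))).
    by congr (Ex P _); apply/funext => w; rewrite /vabove /W /h /=; ring.
  rewrite (weighted_average mX indX us js (W := W)) //; last 2 first.
  - by case: bW.
  - exact: measurable_funB.
  congr (Ex P _); apply/funext => w; rewrite /V /W /h /=.
  have [w0|wn] := eqVneq (wa k w) 0; first by rewrite w0 !mul0r.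
  have [re|_] := leP (r * E k w) (lv k w - tau); last by rewrite !(mul0r, mulr0).
  have [e0|_] := ltP 0 (E k w); last by rewrite !(mul0r, mulr0).
  have [_ _ _ _ [_ /(_ wn) /andP[tl lK]]] := inv k w.
  rewrite jump_g//; apply/andP; split; first by rewrite lerBrDr addrC -lerBrDr.
  by rewrite (le_trans _ lK)// lerBlDr lerDl mulr_ge0// ltW.
have bV : bounded_measurable V.
  apply: bmfM => //; apply: (bmf_comp bg1); apply: measurable_funB.
    exact: (known_by_measurable mX mL).
  exact: (known_by_measurable mX mrE1).
rewrite (ExD P (vabove_bounded k) (vback_bounded k)) e1.
rewrite -(ExD P bV (vback_bounded k)).
pose h (z : R * R) := if r * z.2 <= z.1 - tau
  then (0 < z.2)%R%:R * expR (- (th2 * z.2)) * g1 (z.1 - r * z.2)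
  else (0 < z.2)%R%:R * (c0 * expR (- (th2 * (Num.max (z.1 - tau) 0 / r)))).
have mr2 : measurable_fun setT (fun z : R * R => r * z.2).
  by apply: measurable_funM => //; exact: measurable_cst.
have m1t : measurable_fun setT (fun z : R * R => z.1 - tau) by exact: measurable_funB.
have bh : bounded_measurable h.
  apply: bmf_if; first exact: measurable_fun_ler.
    apply: bmfM; first exact: disc_bmf.
    by apply: (bmf_comp bg1); exact: measurable_funB.
  apply: bmfM; first exact: gt0_bmf.
  apply: bmfZ; split.
    apply: (measurable_expN (Y := fun z : R * R => Num.max (z.1 - tau) 0 / r)).
    apply: measurable_funM; last exact: measurable_cst.
    by apply: measurable_maxr.
  exists 1 => w; rewrite ger0_norm ?expR_ge0// -expR0 ler_expR oppr_le0.
  by rewrite mulr_ge0// divr_ge0 ?(ltW r0)// le_max lexx orbT.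
transitivity (Ex P (fun w => wa k w * h (lv k w, driver (inl k) w))).
  congr (Ex P _); apply/funext => w; rewrite /V /W /vback /h /=.
  by have [re|re] := leP (r * E k w) (lv k w - tau); rewrite /=; ring.
rewrite (weighted_average mX indX (past_uniq k) (W := wa k)) //; last 2 first.
- by rewrite mem_past ltnn.
- by case: bA.
congr (Ex P _); apply/funext => w; rewrite /h /=.
have [w0|wn] := eqVneq (wa k w) 0; first by rewrite w0 !mul0r.
have [_ _ _ _ [_ /(_ wn) tlK]] := inv k w.
rewrite -(run_g k tlK); congr (_ * Ex P _); apply/funext => w'.
have -> : Num.max (lv k w - tau) 0 = lv k w - tau.
  by apply/max_idPl; rewrite subr_ge0; case/andP: tlK.
by case: ifP => _; rewrite ?mulrA.
Qed.

(** The weights and the level after [k] jumps are independent of the next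
    interarrival time and jump, and the hypotheses say that averaging over these
    two steps reproduces [f] and [g]. *)
Lemma value_martingale k : Ex P (fun w => wb k w * f (lv k w) +
  wa k w * g (lv k w) + c0 * wd k w) = b0 * f l0 + g0 * g l0.
Proof.
rewrite -/(Ex P (value k)); elim: k => [|k IH].
  by rewrite /value /= mulr0 -[RHS](Ex_cst P) /=; congr (Ex P _); apply/funext => w; rewrite addr0.
have [mL _ _ _] := weights_known k; have [bB bA bD] := weights_bounded k.
have mL' := known_by_measurable mX mL.
have bvb : bounded_measurable (vbelow k).
  have -> : vbelow k = (fun w => value k.+1 w - ((vabove k w + vback k w) + c0 * wd k w)).
    by apply/funext => w; rewrite value_step; ring.
  apply: bmfB => //; apply: bmfD; last exact: bmfZ.
  by apply: bmfD; [exact: vabove_bounded|exact: vback_bounded].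
have bav : bounded_measurable (fun w => vabove k w + vback k w).
  by apply: bmfD; [exact: vabove_bounded|exact: vback_bounded].
transitivity (Ex P (fun w => vbelow k w + (vabove k w + vback k w) + c0 * wd k w)).
  by congr (Ex P _); apply/funext => w; exact: value_step.
rewrite ExD//; [|exact: bmfD|exact: bmfZ].
rewrite ExD// below_average above_average -IH /value.
rewrite ExD; [|by apply: bmfD; apply: bmfM => //; exact: bmf_comp|exact: bmfZ].
by rewrite ExD//; apply: bmfM => //; exact: bmf_comp.
Qed.

End Values.

Section Decay.
Variables (rho : R).
Hypotheses (rho0 : 0 <= rho) (rho1 : rho < 1).
Hypothesis noup : forall k, Ex P (fun w => (S k w <= tau)%R%:R) <= rho.
Hypothesis nodown : forall k, Ex P (fun w => (r * E k w <= K - tau)%R%:R) <= rho.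

Let stage_step k w :
  wb k.+1 w <= wb k w * (S k w <= tau)%R%:R /\
  wa k.+1 w <= wb k w + wa k w * (r * E k w <= K - tau)%R%:R.
Proof.
have [B0 A0 _ _ [_ Al]] := inv k w.
rewrite {1}/wb {1}/wa /= -/(rw_ k w) -/(wb k w) -/(wa k w) -/(lv k w).
set x := (0 < E k w)%R%:R * expR (- (th1 * E k w)).
have x0 : 0 <= x by rewrite mulr_ge0// expR_ge0.
have x1 : x <= 1 by exact: discount_le1.
have y1 := discount_le1 (E k w) th20.
split.
  rewrite -mulrA; apply: ler_wpM2l => //.
  have [b_|_] := ltP 0 (S k w); last by rewrite mul0r mulr0.
  have [rt|_] := leP (rw_ k w) tau; last by rewrite mulr0 mulr0.
  rewrite !mulr1 (_ : S k w <= tau) ?x1//; apply: le_trans rt.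
  by rewrite /rw_ /raw lerDr le_max lexx orbT.
apply: lerD.
  have bool01 (p q : bool) : 0 <= (p%:R * q%:R : R) <= 1.
    by case: p; case: q; rewrite ?mulr1 ?mulr0 ?mul0r ?lexx ?ler01.
  have /andP[p0 p1] := bool01 (0 < S k w) (tau < rw_ k w).
  by rewrite -mulrA ler_piMr// mulr_ile1.
rewrite -mulrA; have [->|an] := eqVneq (wa k w) 0; first by rewrite !mul0r.
apply: ler_wpM2l => //; have /andP[_ lK] := Al an.
have [re|_] := leP (r * E k w) (lv k w - tau); last by rewrite mulr0 !mul0r.
rewrite (_ : r * E k w <= K - tau); last by rewrite (le_trans re)// lerB.
rewrite [_ * true%:R]mulr1; have [_|_] := ltP 0 (S k w); first by rewrite mulr1.
by rewrite mulr0 ler01.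
Qed.

(** A jump larger than [tau] ends the stage below, and an interarrival time long
    enough to run down from [K] to [tau] ends the stage above. *)
Lemma weights_decay : exists C rho', [/\ 0 <= C, 0 <= rho' < 1
  & forall k, Ex P (wb k) + Ex P (wa k) <= C * rho' ^+ k].
Proof.
have ge0 k : 0 <= Ex P (wb k) /\ 0 <= Ex P (wa k).
  by split; apply: Ex_ge0 => w; have [] := inv k w.
suff step k : Ex P (wb k.+1) <= rho * Ex P (wb k) /\
    Ex P (wa k.+1) <= Ex P (wb k) + rho * Ex P (wa k).
  apply: (two_stage_decay (rho := rho)); first by rewrite rho0 rho1.
  - by move=> k; have [] := ge0 k.
  - by move=> k; have [] := ge0 k.
  - by move=> k; have [] := step k.
  - by move=> k; have [] := step k.
have [mL mB mA _] := weights_known k; have [bB bA _] := weights_bounded k.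
have [bB1 bA1 _] := weights_bounded k.+1.
have blS : bounded_measurable (fun x : R => (x <= tau)%R%:R : R).
  by apply: bmf_bool; exact: measurable_le.
have blE : bounded_measurable (fun x : R => (r * x <= K - tau)%R%:R : R).
  apply: bmf_bool; apply: measurable_fun_ler; last exact: measurable_cst.
  by apply: measurable_funM => //; exact: measurable_cst.
have bBS : bounded_measurable (fun w => wb k w * (S k w <= tau)%R%:R).
  by apply: bmfM => //; exact: (bmf_comp blS (mX (inr k))).
have bAE : bounded_measurable (fun w => wa k w * (r * E k w <= K - tau)%R%:R).
  by apply: bmfM => //; exact: (bmf_comp blE (mX (inl k))).
split.
  apply: (@le_trans _ _ (Ex P (fun w => wb k w * (S k w <= tau)%R%:R))).
    by apply: Ex_le => // w; have [] := stage_step k w.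
  rewrite (independent_product mX indX (j := inr k) (past_uniq k) _ mB _ blS).
  - by rewrite mulrC; apply: ler_wpM2r; [have [] := ge0 k|exact: noup].
  - by rewrite mem_past ltnn.
  - by case: bB.
apply: (@le_trans _ _ (Ex P (fun w => wb k w + wa k w * (r * E k w <= K - tau)%R%:R))).
  by apply: Ex_le => // [|w]; [exact: bmfD|have [] := stage_step k w].
rewrite ExD// lerD2l.
rewrite (independent_product mX indX (j := inl k) (past_uniq k) _ mA _ blE).
- by rewrite mulrC; apply: ler_wpM2r; [have [] := ge0 k|exact: nodown].
- by rewrite mem_past ltnn.
- by case: bA.
Qed.

End Decay.

End Martingale.

(** * Paths of the reflected process *)

Section PathAnalysis.
Context (R : realType) (r1 K tau : R) (e b : nat -> R).
Hypotheses (r10 : r1 < 0) (t0 : 0 <= tau) (tK : tau <= K).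
Hypotheses (e0 : forall k, 0 < e k) (b0 : forall k, 0 < b k).

Let r := `|r1|.
Let r0 : 0 < r. Proof. by rewrite normr_gt0 lt_eqF. Qed.
Let lv := level r K tau e b.
Let rw_ := raw r K tau e b.

Lemma level_afterE k : level_after r1 K tau e b k = lv k.
Proof. by elim: k => //= k ->. Qed.

Lemma epochS k : epoch e k.+1 = epoch e k + e k.
Proof. by rewrite /epoch big_ord_recr. Qed.

Lemma epoch_lt i k : (i < k)%N -> epoch e i < epoch e k.
Proof.
elim: k => // k IH; rewrite ltnS leq_eqVlt => /predU1P[->|/IH].
  by rewrite epochS ltrDl.
by move=> /lt_trans; apply; rewrite epochS ltrDl.
Qed.

Lemma epoch_le i k : (i <= k)%N -> epoch e i <= epoch e k.
Proof. by rewrite leq_eqVlt => /predU1P[->//|/epoch_lt/ltW]. Qed.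

Lemma epoch_index t i k : (i <= k)%N -> epoch e i <= t < epoch e k ->
  exists2 j, (i <= j < k)%N & epoch e j <= t < epoch e j.+1.
Proof.
elim: k => [|k IH].
  rewrite leqn0 => /eqP -> /andP[h1 h2].
  by move: (le_lt_trans h1 h2); rewrite ltxx.
rewrite leq_eqVlt => /predU1P[->|ik] /andP[h1 h2].
  by move: (le_lt_trans h1 h2); rewrite ltxx.
have [tk|kt] := ltP t (epoch e k).
  have [|j /andP[ij jk] h] := IH ik; first by rewrite h1.
  by exists j => //; rewrite ij ltnW.
by exists k; [apply/andP; split|rewrite kt].
Qed.

Lemma Q_between k t : epoch e k <= t < epoch e k.+1 ->
  Q r1 K tau e b t = Num.max (lv k - r * (t - epoch e k)) 0.
Proof.
move=> kt; rewrite /Q (_ : xget _ _ = k) ?level_afterE//.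
apply: xget_subset1 => // i j /= /andP[i1 i2] /andP[j1 j2].
apply/eqP; rewrite eqn_leq; apply/andP; split; rewrite leqNgt; apply/negP.
  by move=> /epoch_le ji; move: (lt_le_trans j2 (le_trans ji i1)); rewrite ltxx.
by move=> /epoch_le ij; move: (lt_le_trans i2 (le_trans ij j1)); rewrite ltxx.
Qed.

Lemma Q_left_limit k :
  lim (Q r1 K tau e b t @[t --> (epoch e k.+1)^'-]) + b k = rw_ k.
Proof.
rewrite /rw_ /raw; congr (_ + _); apply: cvg_lim; first exact: Rhausdorff.
pose F (t : R) := Num.max (lv k - r * (t - epoch e k)) 0.
have FE : F (epoch e k.+1) = Num.max (lv k - r * e k) 0.
  by rewrite /F epochS [epoch e k + _]addrC addrK.
rewrite -FE.
have cF : F t @[t --> (epoch e k.+1)^'-] --> F (epoch e k.+1).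
  apply: cvg_at_left_filter.
  apply: (@continuous_max R R^o (fun t => lv k - r * (t - epoch e k)) (fun=> 0));
    last exact: cvg_cst.
  apply: cvgB; first exact: cvg_cst.
  apply: cvgM; first exact: cvg_cst.
  by apply: cvgB; [exact: cvg_id|exact: cvg_cst].
apply: cvg_trans cF; apply: near_eq_cvg; near=> t.
rewrite (@Q_between k)//; apply/andP; split.
  near: t; apply: nbhs_left_ge; exact: epoch_lt.
by near: t; exact: nbhs_left_lt.
Unshelve. all: by end_near. Qed.

Lemma D_raw : D r1 K tau e b =
  ereal_inf [set (epoch e k.+1)%:E | k in [set k | tau < rw_ k]].
Proof.
rewrite /D; congr ereal_inf; congr image; apply/funext => k.
by have h := Q_left_limit k; congr (is_true (tau < _)).
Qed.

Definition stage_below k := forall j, (j < k)%N -> rw_ j <= tau.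

Definition upcrossing m := stage_below m /\ tau < rw_ m.

Definition stays_above m k :=
  forall j, (m < j < k)%N -> r * e j <= lv j - tau.

Definition downcrossing m j :=
  [/\ (m < j)%N, upcrossing m, stays_above m j & lv j - tau < r * e j].

Lemma level_above m k : upcrossing m -> stays_above m k -> (m < k)%N ->
  tau <= lv k.
Proof.
move=> [_ up] st; elim: k st => // k IH st; rewrite ltnS leq_eqVlt => /predU1P[<-|mk].
  by rewrite /lv /= -/(raw r K tau e b m) le_min tK andbT ltW.
rewrite /lv /= le_min tK andbT.
have := st k; rewrite mk ltnSn => /(_ isT); rewrite -/(lv k) => rek.
apply: (@le_trans _ _ (lv k - r * e k)); first by rewrite lerBrDr addrC -lerBrDr.
by rewrite -[leLHS]addr0; apply: lerD; [rewrite le_max lexx|exact: ltW].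
Qed.

Lemma D_upcrossing m : upcrossing m -> D r1 K tau e b = (epoch e m.+1)%:E.
Proof.
move=> [bel up]; rewrite D_raw; apply/eqP; rewrite eq_le; apply/andP; split.
  by apply: ereal_inf_lbound; exists m.
apply: le_ereal_inf_tmp => _ [k kup <-]; rewrite lee_fin; apply: epoch_le.
rewrite ltnS leqNgt; apply/negP => /bel; rewrite leNgt => /negP; exact.
Qed.

(** Above [tau] the process decreases between jumps and jumps only upwards, so
    it meets [tau] for the first time in the first interval long enough. *)
Lemma U_downcrossing m j : downcrossing m j ->
  U r1 K tau e b = (epoch e j + (lv j - tau) / r - epoch e m.+1)%:E.
Proof.
move=> [mj up st down]; have lj := level_above up st mj.
set T := epoch e j + (lv j - tau) / r.
have T1 : epoch e j <= T by rewrite lerDl divr_ge0 ?subr_ge0// ltW.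
have T2 : T < epoch e j.+1 by rewrite epochS ltrD2l ltr_pdivrMr// mulrC.
have T3 : epoch e m.+1 <= T by apply: le_trans T1; exact: epoch_le.
rewrite /U (D_upcrossing up); apply/eqP; rewrite eq_le; apply/andP; split.
  apply: ereal_inf_lbound; exists (T - epoch e m.+1) => //; split.
    by rewrite subr_ge0.
  exists (epoch e m.+1) => //; rewrite addrC subrK (@Q_between j) ?T1//.
  rewrite /T [epoch e j + _]addrC addrK mulrC divfK ?gt_eqF// subKr.
  exact/max_idPl.
apply: le_ereal_inf_tmp => _ [s [s0 [t [<-] Qt]] <-]; rewrite lee_fin lerBlDl.
rewrite leNgt; apply/negP => tT.
have [|i /andP[mi ij] it] := @epoch_index (epoch e m.+1 + s) m.+1 j.+1 (ltnW mj).
  by rewrite lerDl s0 (lt_trans tT).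
move: Qt; rewrite (Q_between it); set t' := epoch e m.+1 + s in it tT *.
suff gt : tau < lv i - r * (t' - epoch e i).
  move=> Qt; have : lv i - r * (t' - epoch e i) <= tau by rewrite -[leRHS]Qt le_max lexx.
  by rewrite leNgt gt.
move: ij; rewrite ltnS leq_eqVlt => /predU1P[ij|ij].
  rewrite ij ltrBrDl -ltrBrDr mulrC -ltr_pdivlMr// ltrBlDl.
  exact: tT.
have le := st i; rewrite mi ij in le; have {}le := le isT.
have : r * (t' - epoch e i) < r * e i.
  by rewrite ltr_pM2l// ltrBlDl -epochS; case/andP: it.
move=> h; rewrite ltrBrDl -ltrBrDr; exact: lt_le_trans le.
Qed.

Let wb th1 := wbelow r K tau th1 tau 1 e b.
Let wa th1 th2 := wabove r K tau th1 th2 tau 1 0 e b.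
Let wd th1 th2 := wdone r K tau th1 th2 tau 1 0 e b.

(** The weights read off the stage of the excursion at each jump epoch; the
    stage itself does not depend on the discount rates. *)
Lemma weights_stage k :
  [\/ forall th1 th2, [/\ stage_below k, wb th1 k = expR (- (th1 * epoch e k)),
       wa th1 th2 k = 0 & wd th1 th2 k = 0],
   exists m, [/\ (m < k)%N, upcrossing m, stays_above m k & forall th1 th2,
     [/\ wb th1 k = 0, wd th1 th2 k = 0 & wa th1 th2 k =
       expR (- (th1 * epoch e m.+1) - th2 * (epoch e k - epoch e m.+1))]] |
   exists m j, downcrossing m j /\ forall th1 th2,
     [/\ wb th1 k = 0, wa th1 th2 k = 0 & wd th1 th2 k =
       expR (- (th1 * epoch e m.+1)
        - th2 * (epoch e j + (lv j - tau) / r - epoch e m.+1))]].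
Proof.
elim: k => [|k IH].
  apply: Or31 => th1 th2; split => //.
  by rewrite /wb /= /epoch big_ord0 mulr0 oppr0 expR0.
have Eb th1 : wb th1 k.+1 = wb th1 k * expR (- (th1 * e k)) * (rw_ k <= tau)%R%:R.
  by rewrite /wb /= e0 b0 !mul1r.
have Ea th1 th2 : wa th1 th2 k.+1 =
    wb th1 k * expR (- (th1 * e k)) * (tau < rw_ k)%R%:R +
    wa th1 th2 k * ((r * e k <= lv k - tau)%R%:R * expR (- (th2 * e k))).
  by rewrite /wa /= e0 b0 !mul1r mulr1.
have Ed th1 th2 : wd th1 th2 k.+1 =
    wd th1 th2 k + wa th1 th2 k * ((lv k - tau < r * e k)%R%:R *
   expR (- (th2 * (Num.max (lv k - tau) 0 / r)))).
  by rewrite /wd /= e0 !mul1r.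
case: IH => [H|[m [mk up st H]]|[m [j [dn H]]]].
- have bel : stage_below k by have [] := H 0 0.
  have [rt|rt] := leP (rw_ k) tau.
    apply: Or31 => th1 th2; have [_ h1 h2 h3] := H th1 th2.
    rewrite Eb Ea Ed h1 h2 h3 rt ltNge rt; split.
    + by move=> j; rewrite ltnS leq_eqVlt => /predU1P[->//|]; exact: bel.
    + by rewrite mulr1 -expRD epochS mulrDr opprD.
    + by rewrite mulr0 mul0r addr0.
    + by rewrite mul0r addr0.
  apply: Or32; exists k; split => //.
    move=> j /andP[h1 h2]; rewrite ltnS leqNgt in h2.
    by rewrite h1 in h2.
  move=> th1 th2; have [_ h1 h2 h3] := H th1 th2.
  rewrite Eb Ea Ed h1 h2 h3 rt leNgt rt; split.
  + by rewrite mulr0.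
  + by rewrite mul0r addr0.
  + by rewrite mulr1 mul0r addr0 -expRD epochS subrr mulr0 subr0 mulrDr opprD.
- have lk := level_above up st mk.
  have [rt|rt] := leP (r * e k) (lv k - tau).
    apply: Or32; exists m; split => //; first exact: ltnW.
      move=> j /andP[mj]; rewrite ltnS leq_eqVlt => /predU1P[->//|jk].
      by apply: st; rewrite mj.
    move=> th1 th2; have [h1 h2 h3] := H th1 th2.
    rewrite Eb Ea Ed h1 h2 h3 rt (ltNge _ (r * e k)) rt; split.
    + by rewrite !mul0r.
    + by rewrite mul0r mulr0 addr0.
    + by rewrite !mul0r add0r mul1r -expRD (epochS k); congr expR; ring.
  apply: Or33; exists m, k; split => // th1 th2; have [h1 h2 h3] := H th1 th2.
  rewrite Eb Ea Ed h1 h2 h3 rt (leNgt (r * e k)) rt; split.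
  + by rewrite !mul0r.
  + by rewrite !mul0r mulr0 addr0.
  + have -> : Num.max (lv k - tau) 0 = lv k - tau by apply/max_idPl; rewrite subr_ge0.
    by rewrite add0r mul1r -expRD; congr expR; ring.
- apply: Or33; exists m, j; split => // th1 th2; have [h1 h2 h3] := H th1 th2.
  rewrite Eb Ea Ed h1 h2 h3; split.
  + by rewrite !mul0r.
  + by rewrite !mul0r addr0.
  + by rewrite mul0r addr0.
Qed.

Variables (th1 th2 : R).
Hypotheses (th10 : 0 <= th1) (th20 : 0 <= th2).

Lemma discount_downcrossing m j : downcrossing m j ->
  expeR (- (th1%:E * D r1 K tau e b) - th2%:E * U r1 K tau e b)%E =
  (expR (- (th1 * epoch e m.+1)
        - th2 * (epoch e j + (lv j - tau) / r - epoch e m.+1)))%:E.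
Proof.
move=> dn; have [_ up _ _] := dn.
by rewrite (D_upcrossing up) (U_downcrossing dn).
Qed.

Lemma discount_ge0_le1 :
  (0 <= expeR (- (th1%:E * D r1 K tau e b) - th2%:E * U r1 K tau e b) <= 1)%E.
Proof.
have D0 : (0 <= D r1 K tau e b)%E.
  rewrite D_raw; apply: le_ereal_inf_tmp => _ [k _ <-]; rewrite lee_fin.
  by apply: sumr_ge0 => i _; rewrite ltW.
have U0 : (0 <= U r1 K tau e b)%E.
  by apply: le_ereal_inf_tmp => _ [s [s0 _] <-]; rewrite lee_fin.
rewrite expeR_ge0 /= -expeR0 ler_expeR.
rewrite -oppeD; last first.
  by apply: ge0_adde_def; rewrite inE mule_ge0 ?lee_fin.
by rewrite oppe_le0 adde_ge0// mule_ge0 ?lee_fin.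
Qed.

End PathAnalysis.

(** Once the undiscounted weights of the first two stages vanish, the excursion
    is over and [wdone] is the discount factor itself; before that the discount
    factor is only known to lie between zero and one. *)
Lemma discount_bounds (R : realType) (r1 K tau th1 th2 : R) (e b : nat -> R) k :
  r1 < 0 -> 0 <= tau -> tau <= K -> 0 <= th1 -> 0 <= th2 ->
  (forall k, 0 < e k) -> (forall k, 0 < b k) ->
  ((wdone `|r1| K tau th1 th2 tau 1 0 e b k)%:E <=
   expeR (- (th1%:E * D r1 K tau e b) - th2%:E * U r1 K tau e b) <=
   (wdone `|r1| K tau th1 th2 tau 1 0 e b k +
    (wbelow `|r1| K tau 0 tau 1 e b k + wabove `|r1| K tau 0 0 tau 1 0 e b k))%R%:E)%E.
Proof.
move=> r10 t0 tK th10 th20 e0 b0; set Z := expeR _.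
have /andP[Z0 Z1] : (0 <= Z <= 1)%E by exact: discount_ge0_le1.
have := @weights_stage R r1 K tau e b tK e0 b0 k.
case=> [H|[m [mk up st H]]|[m [j [dn H]]]].
- have [_ _ _ ->] := H th1 th2; have [_ -> -> _] := H 0 0.
  by rewrite mul0r oppr0 expR0 add0r addr0 Z0.
- have [_ -> _] := H th1 th2; have [-> _ ->] := H 0 0.
  by rewrite !mul0r oppr0 !add0r expR0 Z0.
- have [_ _ ->] := H th1 th2; have [-> -> _] := H 0 0.
  by rewrite /Z (@discount_downcrossing R r1 K tau e b r10 t0 tK e0 b0 th1 th2 m j dn) !addr0 lexx.
Qed.

(** * Value functions and the linear systems *)

Lemma geometric_bound_eq0 (R : realType) (x C rho : R) : 0 <= rho < 1 ->
  (forall k, `|x| <= C * rho ^+ k) -> x = 0.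
Proof.
move=> /andP[r0 r1] h; apply/eqP; rewrite -normr_le0.
have c : C * rho ^+ k @[k --> \oo] --> (0 : R).
  rewrite -[X in _ --> X](mulr0 C); apply: cvgM; first exact: cvg_cst.
  by apply: cvg_expr; rewrite ger0_norm.
apply: (closed_cvg (fun y => `|x| <= y) _ _ _ c).
  exact: closed_ge.
by apply: nearW.
Qed.

Definition clamp (R : realType) (K u : R) : R := Num.max 0 (Num.min u K).

Lemma clamp_id (R : realType) (K u : R) : 0 <= u <= K -> clamp K u = u.
Proof. by move=> /andP[u0 uK]; rewrite /clamp (min_idPl uK) (max_idPr u0). Qed.

Lemma bmf_clamp (R : realType) (K : R) (f : R -> R) : 0 <= K -> continuous f ->
  bounded_measurable (fun u => f (clamp K u)).
Proof.
move=> K0 cf; have [|c _ cM] := @EVT_max R (fun s => `|f s|) 0 K K0.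
  apply: continuous_subspaceT => s.
  by apply: (@continuous_comp _ _ _ f Num.norm); [exact: cf|exact: norm_continuous].
split; last first.
  exists `|f c| => u; apply: cM; rewrite in_itv /= /clamp le_max lexx /= ge_max K0.
  by rewrite ge_min lexx orbT.
apply: (measurableT_comp (continuous_measurable_fun cf)).
apply: measurable_maxr; first exact: measurable_cst.
by apply: measurable_minr => //; exact: measurable_cst.
Qed.

Section Conservation.
Context (R : realType) (n : nat) (T : 'M[R]_n) (alpha : 'cV[R]_n)
  (Pb : R -> 'M[R]_n).
Hypothesis kP : killed_semigroup T Pb.
Hypothesis alpha0 : forall i, 0 <= alpha i 0.
Hypothesis alpha1 : \sum_i alpha i 0 = 1.
Context (d : measure_display) (U : measurableType d) (P : probability U R)
  (E S : nat -> U -> R).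
Context (lambda r K tau : R).
Hypotheses (lam0 : 0 < lambda) (r0 : 0 < r) (t0 : 0 <= tau) (tK : tau <= K).
Hypothesis mX : forall i, measurable_fun setT (driver E S i).
Hypothesis indX : mutually_independent P (driver E S).
Hypothesis tailE : forall k u, 0 <= u ->
  Ex P (fun w => (u < E k w)%R%:R) = expR (- (lambda * u)).
Hypothesis tailS : forall k u, 0 <= u ->
  Ex P (fun w => (u < S k w)%R%:R) = killed_tail alpha Pb u.
Local Notation C := R[i].
Local Notation rc := (real_complex R).

Let K0 : 0 <= K. Proof. exact: le_trans tK. Qed.
Let mE k : measurable_fun setT (E k). Proof. exact: (mX (inl k)). Qed.
Let mS k : measurable_fun setT (S k). Proof. exact: (mX (inr k)). Qed.

Lemma killed_tail_gt0 u : 0 <= u -> 0 < killed_tail alpha Pb u.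
Proof.
move=> u0; have [i ai] : exists i, 0 < alpha i 0.
  apply: contrapT => h; move: alpha1; rewrite big1.
    by move/eqP; rewrite eq_sym oner_eq0.
  move=> i _; apply/eqP; rewrite eq_le alpha0 andbT leNgt; apply/negP => ai.
  by apply: h; exists i.
have row0 j : 0 <= \sum_l Pb u j l by apply: sumr_ge0 => l _; exact: (killed_ge0 kP).
rewrite /killed_tail (bigD1 i)//= ltr_pwDl//; last first.
  by apply: sumr_ge0 => j _; rewrite mulr_ge0.
rewrite mulr_gt0// (bigD1 i)//= ltr_pwDl ?(killed_diag_gt0 kP)//.
by apply: sumr_ge0 => l _; exact: (killed_ge0 kP).
Qed.

Lemma Ex_le_tail (X : U -> R) (u : R) : measurable_fun setT X ->
  Ex P (fun w => (X w <= u)%R%:R) = 1 - Ex P (fun w => (u < X w)%R%:R).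
Proof.
move=> mY; rewrite -[X in _ = X - _](Ex_cst P) -ExB; first last.
- by apply: bmf_bool; exact: measurable_gt.
- exact: bmf_cst.
congr (Ex P _); apply/funext => w; rewrite ltNge.
by case: (X w <= u); rewrite /= ?subrr ?subr0.
Qed.

(** Both tails are positive and the same at every step. *)
Lemma stage_exit_prob : exists rho, [/\ 0 <= rho < 1,
  forall k, Ex P (fun w => (S k w <= tau)%R%:R) <= rho
  & forall k, Ex P (fun w => (r * E k w <= K - tau)%R%:R) <= rho].
Proof.
have t1 := killed_tail_gt0 t0.
pose v := (K - tau) / r.
have v0 : 0 <= v by rewrite divr_ge0 ?subr_ge0// ltW.
have h1 k : Ex P (fun w => (S k w <= tau)%R%:R) = 1 - killed_tail alpha Pb tau.
  by rewrite Ex_le_tail// tailS.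
have h2 k : Ex P (fun w => (r * E k w <= K - tau)%R%:R) = 1 - expR (- (lambda * v)).
  rewrite -(tailE k v0) -Ex_le_tail//; congr (Ex P _); apply/funext => w.
  by rewrite /v ler_pdivlMr// mulrC.
exists (Num.max (1 - killed_tail alpha Pb tau) (1 - expR (- (lambda * v)))).
split; last 2 first.
- by move=> k; rewrite h1 le_max lexx.
- by move=> k; rewrite h2 le_max lexx orbT.
rewrite le_max -(h1 0%N) Ex_ge0 ?ler0n//= gt_max (h1 0%N).
by rewrite !ltrBlDr !ltrDl t1 expR_gt0.
Qed.

(** The equation [phi p = theta] for drift [- r], solved for the transform. *)
Definition is_root (theta : R) (p : C) : Prop :=
  resolvent_arg T p \in unitmx /\
  rc lambda * phase_type_LT alpha T p = rc (lambda + theta) - rc r * p.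

Section Coefficients.
Context (N N' : nat) (th1 th2 : R).
Hypotheses (th10 : 0 <= th1) (th20 : 0 <= th2).
Variables (b p : 'I_N -> C) (c q : 'I_N' -> C) (l0 b0 g0 c0 : R).
Hypotheses (rp : forall k, is_root th1 (p k)) (rq : forall k, is_root th2 (q k)).
Hypothesis cap : cap_defect T c q K = 0.
Hypothesis end_ : expsum c q tau = c0.
Hypothesis bottom : b0 != 0 -> \sum_k b k * p k = 0.
Hypothesis match_ : b0 != 0 -> exit_average T b p tau = exit_average T c q tau.
Hypotheses (b00 : 0 <= b0) (g00 : 0 <= g0).
Hypothesis bl0 : b0 != 0 -> 0 <= l0 <= tau.
Hypothesis gl0 : g0 != 0 -> tau <= l0 <= K.

Let up k : resolvent_arg T (p k) \in unitmx. Proof. by case: (rp k). Qed.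
Let uq k : resolvent_arg T (q k) \in unitmx. Proof. by case: (rq k). Qed.
Let lp k := phase_type_LT alpha T (p k).
Let lq k := phase_type_LT alpha T (q k).

Let f u := expsum b p (clamp K u).
Let g u := expsum c q (clamp K u).
Let f1 u := expsum (fun k => b k * lp k) p (clamp K u).
Let g1 u := expsum (fun k => c k * lq k) q (clamp K u).

(** The hypotheses on the coefficients are the boundary conditions at [K], [tau]
    and [0] and the matching across [tau] for jumps; with them the steps of the
    excursion average the value functions correctly. *)
Lemma value_conservation k :
  Ex P (fun w => wbelow r K tau th1 l0 b0 (E^~ w) (S^~ w) k *
      f (level r K l0 (E^~ w) (S^~ w) k) +
    wabove r K tau th1 th2 l0 b0 g0 (E^~ w) (S^~ w) k *
      g (level r K l0 (E^~ w) (S^~ w) k) +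
    c0 * wdone r K tau th1 th2 l0 b0 g0 (E^~ w) (S^~ w) k) =
  b0 * f l0 + g0 * g l0.
Proof.
have bf : bounded_measurable f by apply: bmf_clamp => //; exact: continuous_expsum.
have bg : bounded_measurable g by apply: bmf_clamp => //; exact: continuous_expsum.
have bf1 : bounded_measurable f1 by apply: bmf_clamp => //; exact: continuous_expsum.
have bg1 : bounded_measurable g1 by apply: bmf_clamp => //; exact: continuous_expsum.
apply: (value_martingale r0 t0 tK th10 th20 b00 g00 bl0 gl0 mX indX bf bg bf1 bg1).
- move=> b0n j u /[dup] ut /andP[u0 ut'].
  have [_ e1] := jump_below kP (mS j) (tailS j) up uq ut tK cap (match_ b0n).
  rewrite /f1 clamp_id ?u0 ?(le_trans ut')// -e1; congr (Ex P _); apply/funext => w.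
  have [s0|_] := ltP 0 (S j w); last by rewrite !mul0r.
  have x0 : 0 <= u + S j w by rewrite addr_ge0// ltW.
  congr (_ * _); rewrite /glue; case: ifPn => xt.
    by rewrite /f clamp_id// x0 (le_trans xt).
  by rewrite /g clamp_id// le_min x0 K0 ge_min lexx orbT.
- move=> b0n j u /[dup] ut /andP[u0 ut'].
  have [_ e1] := step_below lam0 r0 th10 (mE j) (tailE j) (fun k => (rp k).2) u0 (bottom b0n).
  rewrite /f clamp_id ?u0 ?(le_trans ut')// -e1; congr (Ex P _); apply/funext => w.
  have [e0|_] := ltP 0 (E j w); last by rewrite !mul0r.
  rewrite /f1 clamp_id// le_max lexx orbT ge_max K0 andbT.
  by rewrite lerBlDr (le_trans ut')// (le_trans tK)// lerDl mulr_ge0// ltW.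
- move=> j u /andP[tu uK].
  have [_ e1] := jump_above kP (mS j) (tailS j) uq uK cap.
  have u0 : 0 <= u by exact: le_trans tu.
  rewrite /g1 clamp_id ?u0// -e1; congr (Ex P _); apply/funext => w.
  have [s0|_] := ltP 0 (S j w); last by rewrite !mul0r.
  by rewrite /g clamp_id// le_min K0 ge_min lexx orbT addr_ge0// ltW.
- move=> j u /andP[tu uK].
  have [_ e1] := step_above lam0 r0 (mE j) (tailE j) (fun k => (rq k).2) tu end_.
  have u0 : 0 <= u by exact: le_trans tu.
  rewrite /g clamp_id ?u0// -e1; congr (Ex P _); apply/funext => w.
  have [e0|_] := ltP 0 (E j w); last by rewrite !mul0r.
  case: ifPn => // re; rewrite /g1 clamp_id//; apply/andP; split.
    by rewrite subr_ge0 (le_trans re)// lerBlDr lerDl.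
  by rewrite lerBlDr (le_trans uK)// lerDl mulr_ge0// ltW.
Qed.

Hypothesis l0K : 0 <= l0 <= K.

(** The first two stages have geometrically small weight, so in the limit the
    conserved value is the expected payoff. *)
Lemma value_limit : exists M rho, [/\ 0 <= M, 0 <= rho < 1 & forall k,
  `|b0 * expsum b p l0 + g0 * expsum c q l0 -
    c0 * Ex P (fun w => wdone r K tau th1 th2 l0 b0 g0 (E^~ w) (S^~ w) k)|
  <= M * rho ^+ k].
Proof.
have [rho0 [/andP[h1 h2] h3 h4]] := stage_exit_prob.
have [C0 [rho [C00 rho01 decay]]] := weights_decay r0 tK th10 th20 b00 g00 bl0 gl0 mX indX h1 h2 h3 h4.
have bf : bounded_measurable f by apply: bmf_clamp => //; exact: continuous_expsum.
have bg : bounded_measurable g by apply: bmf_clamp => //; exact: continuous_expsum.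
have [_ [Mf fM]] := bf; have [_ [Mg gM]] := bg.
pose M := Num.max Mf Mg.
have M0 : 0 <= M by rewrite /M le_max (le_trans _ (fM 0)).
exists (M * C0), rho; split => //; first exact: mulr_ge0.
move=> k; have cons := value_conservation k.
have [mL _ _ _] := weights_known E S r K tau th1 th2 l0 b0 g0 k.
have [bB bA bD] := weights_bounded r0 tK th10 th20 b00 g00 bl0 gl0 mX k.
have mL' := known_by_measurable mX mL.
pose V w := wbelow r K tau th1 l0 b0 (E^~ w) (S^~ w) k * f (level r K l0 (E^~ w) (S^~ w) k) +
  wabove r K tau th1 th2 l0 b0 g0 (E^~ w) (S^~ w) k * g (level r K l0 (E^~ w) (S^~ w) k).
have bV : bounded_measurable V by apply: bmfD; apply: bmfM => //; exact: bmf_comp.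
rewrite (ExD P bV (bmfZ c0 bD)) ExZ// in cons.
have -> : b0 * expsum b p l0 + g0 * expsum c q l0 = b0 * f l0 + g0 * g l0.
  by rewrite /f /g clamp_id.
rewrite -cons addrK -mulrA.
apply: le_trans (ler_wpM2l M0 (decay k)); rewrite -ExD// -ExZ; last exact: bmfD.
apply: Ex_norm_le => //; first by apply: bmfZ; exact: bmfD.
move=> w; have [w1 w2 _ _ _] :=
  weights_invariant (E^~ w) (S^~ w) r0 tK th10 th20 b00 g00 bl0 gl0 k.
rewrite /V; apply: le_trans (ler_normD _ _) _; rewrite mulrDr !normrM.
rewrite (ger0_norm w1) (ger0_norm w2); apply: lerD; rewrite mulrC ler_wpM2r//.
  by rewrite (le_trans (fM _))// le_max lexx.
by rewrite (le_trans (gM _))// le_max lexx orbT.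
Qed.

End Coefficients.

Section Kernels.
Context (N : nat) (theta : R) (p : 'I_N -> C).
Hypothesis th0 : 0 <= theta.
Hypothesis rp : forall k, is_root theta (p k).

(** Uniqueness below [tau]: with zero payoff above [tau], the value at [tau] is
    the limit of expectations over the event of not having crossed [tau], whose
    probability tends to zero. *)
Lemma lower_kernel (b : 'I_N -> C) :
  \sum_k b k * (p k * cexp (p k * rc tau)) = 0 ->
  \sum_k b k *: exit_transform T (p k) = 0 -> \sum_k b k = 0.
Proof.
move=> bot ex; apply: Re_eq0 => y.
pose b' k := y * b k * cexp (p k * rc tau).
have cc k : cexp (p k * rc tau) * cexp (- p k * rc tau) = 1.
  by rewrite mulrC mulNr cexpN_mul.
have bE : expsum b' p tau = complex.Re (y * \sum_k b k).
  rewrite expsumE mulr_sumr; congr complex.Re; apply: eq_bigr => k _.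
  by rewrite /b' -mulrA cc mulr1.
pose no (i : 'I_0) : C := 0.
have rno (k : 'I_0) : is_root theta (no k) by case: k.
have [|||||||||M [rho [M0 rho01 lim]]] := @value_limit N 0 theta theta th0 th0 b' p no no
  tau 1 0 0 rp rno.
- by rewrite /cap_defect big_ord0.
- by rewrite /expsum big_ord0.
- move=> _; rewrite (eq_bigr (fun k => y * (b k * (p k * cexp (p k * rc tau))))).
    by rewrite -mulr_sumr bot mulr0.
  by move=> k _; rewrite /b'; ring.
- move=> _; rewrite /exit_average big_ord0.
  rewrite (eq_bigr (fun k => y *: (b k *: exit_transform T (p k)))).
    by rewrite -scaler_sumr ex scaler0.
  by move=> k _; rewrite /b' -mulrA cc mulr1 scalerA.
- exact: ler01.
- exact: lexx.
- by move=> _; rewrite t0 lexx.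
- by rewrite eqxx.
- by rewrite t0 tK.
apply: (geometric_bound_eq0 rho01 (C := M)) => k; have := lim k.
by rewrite !mul0r subr0 mul1r addr0 bE.
Qed.

(** Uniqueness above [tau]: start the excursion at the cap [K] with zero payoff
    on reaching [tau]. *)
Lemma upper_kernel (c : 'I_N -> C) : \sum_k c k = 0 ->
  cap_defect T (fun k => c k * cexp (p k * rc tau)) p K = 0 ->
  \sum_k c k * cexp (- p k * rc (K - tau)) = 0.
Proof.
move=> c0 cap; apply: Re_eq0 => y.
pose c' k := y * (c k * cexp (p k * rc tau)).
have cc k : cexp (p k * rc tau) * cexp (- p k * rc tau) = 1.
  by rewrite mulrC mulNr cexpN_mul.
have cE : expsum c' p K = complex.Re (y * \sum_k c k * cexp (- p k * rc (K - tau))).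
  rewrite expsumE mulr_sumr; congr complex.Re; apply: eq_bigr => k _.
  have -> : - p k * rc (K - tau) = p k * rc tau + - p k * rc K by rewrite rmorphB; ring.
  by rewrite cexpD /c' !mulrA.
pose no (i : 'I_0) : C := 0.
have rno (k : 'I_0) : is_root theta (no k) by case: k.
have n0 : (0 : R) != 0 -> False by rewrite eqxx.
have [|||||||||M [rho [M0 rho01 lim]]] := @value_limit 0 N theta theta th0 th0 no no c' p
  K 0 1 0 rno rp.
- rewrite -[RHS](scaler0 _ y) -cap /cap_defect scaler_sumr; apply: eq_bigr => k _.
  by rewrite scalerA /c' !mulrA.
- rewrite expsumE (eq_bigr (fun k => y * c k)); first by rewrite -mulr_sumr c0 mulr0.
  by move=> k _; rewrite /c' -mulrA -(mulrA (c k)) cc mulr1.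
- by move=> /n0.
- by move=> /n0.
- exact: lexx.
- exact: ler01.
- by move=> /n0.
- by rewrite tK lexx.
- by rewrite K0 lexx.
apply: (geometric_bound_eq0 rho01 (C := M)) => k; have := lim k.
by rewrite !mul0r subr0 mul1r add0r cE.
Qed.

End Kernels.

Section ExpectedDiscount.
Context (N N' : nat) (th1 th2 : R).
Hypotheses (th10 : 0 <= th1) (th20 : 0 <= th2).
Variables (b p : 'I_N -> C) (c q : 'I_N' -> C).

(** The path functionals are controlled only where all times and sizes are
    positive. *)
Lemma null_nonpositive : exists2 A : set U, measurable A /\ P A = 0 &
  forall w, ~ A w -> (forall k, 0 < E k w) /\ (forall k, 0 < S k w).
Proof.
have nullP (X : U -> R) : measurable_fun setT X ->
    Ex P (fun w => (0 < X w)%R%:R) = 1 -> P.-negligible [set w | X w <= 0].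
  move=> mX' e1; apply/negligibleP; first exact/measurable_set_bool/measurable_le.
  apply: (etrans (Ex_bool P (measurable_le 0 mX'))).
  by rewrite Ex_le_tail// e1 subrr.
have nE k : P.-negligible [set w | E k w <= 0].
  by apply: nullP; rewrite ?tailE// mulr0 oppr0 expR0.
have nS k : P.-negligible [set w | S k w <= 0].
  apply: nullP => //; rewrite tailS// /killed_tail (killed0 kP) -[RHS]alpha1.
  apply: eq_bigr => i _; rewrite -[RHS]mulr1; congr (_ * _).
  rewrite (bigD1 i)//= big1 ?addr0 => [|j ji]; rewrite mxE ?eqxx//.
  by rewrite eq_sym (negbTE ji).
pose A := \bigcup_k ([set w | E k w <= 0] `|` [set w | S k w <= 0]).
have mA : measurable A.
  apply: bigcupT_measurable => k; apply: measurableU.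
    exact/measurable_set_bool/measurable_le.
  exact/measurable_set_bool/measurable_le.
exists A.
  split=> //; apply/negligibleP => //; apply: negligible_bigcup => k.
  exact: negligibleU.
move=> w nA; split => k; rewrite ltNge; apply/negP => le0; apply: nA; exists k => //.
  by left.
by right.
Qed.

(** The discount factor and the weight [wdone] differ by at most the
    undiscounted weights of the first two stages, so [value_limit] identifies
    the expectation. *)
Lemma expected_discount c0 :
  (forall k, is_root th1 (p k)) -> (forall k, is_root th2 (q k)) ->
  cap_defect T c q K = 0 -> expsum c q tau = c0 ->
  \sum_k b k * p k = 0 -> exit_average T b p tau = exit_average T c q tau ->
  expsum b p tau = c0 * fine (\int[P]_w
    expeR (- (th1%:E * D (- r) K tau (E^~ w) (S^~ w)) -
           th2%:E * Defs.U (- r) K tau (E^~ w) (S^~ w)))%E.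
Proof.
move=> rp rq cap end_ bottom match_.
set Z := (X in fine (integral _ _ X)).
have n0 : (0 : R) != 0 -> False by rewrite eqxx.
have tt : (1 : R) != 0 -> 0 <= tau <= tau by rewrite t0 lexx.
have tn : (0 : R) != 0 -> tau <= tau <= K by move=> /n0.
have t0K : 0 <= tau <= K by rewrite t0 tK.
have [M [rho [M0 /andP[rho0 rho1] lim]]] := value_limit th10 th20 rp rq cap end_
  (fun=> bottom) (fun=> match_) ler01 (lexx _) tt tn t0K.
have [e0 [/andP[h1 h2] h3 h4]] := stage_exit_prob.
have [C0 [rho' [C00 /andP[rho'0 rho'1] decay]]] :=
  weights_decay r0 tK (lexx 0) (lexx 0) ler01 (lexx 0) tt tn mX indX h1 h2 h3 h4.
have [A [mA PA] nA] := null_nonpositive.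
have rE : `|- r| = r by rewrite normrN gtr0_norm.
pose wd k w := wdone r K tau th1 th2 tau 1 0 (E^~ w) (S^~ w) k.
have sand k : `|Ex P (wd k) - fine (\int[P]_w Z w)| <= C0 * rho' ^+ k.
  have [bB bA _] := weights_bounded r0 tK (lexx 0) (lexx 0) ler01 (lexx 0) tt tn mX k.
  have [_ _ bD] := weights_bounded r0 tK th10 th20 ler01 (lexx 0) tt tn mX k.
  have inv w := weights_invariant (E^~ w) (S^~ w) r0 tK th10 th20 ler01 (lexx 0) tt tn k.
  have inv0 w := weights_invariant (E^~ w) (S^~ w) r0 tK (lexx 0) (lexx 0) ler01 (lexx 0)
    tt tn k.
  have := @integral_sandwich _ _ _ P Z (wd k) _ A bD (bmfD bD (bmfD bB bA)) mA PA.
  case/(_ _ _ _ _)/andP.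
  - by move=> w; exact: expeR_ge0.
  - by move=> w; have [] := inv w.
  - move=> w; have [_ _ w3 _ _] := inv w; have [w1 w2 _ _ _] := inv0 w.
    by rewrite addr_ge0// addr_ge0.
  - move=> w /nA[posE posS].
    have := @discount_bounds _ (- r) K tau th1 th2 (E^~ w) (S^~ w) k.
    by rewrite rE oppr_lt0; exact.
  move=> lo up; have := decay k.
  rewrite ExD// in up; last exact: bmfD.
  rewrite ExD// in up.
  by rewrite ler_distlC; move: lo up => /=; lra.
apply/eqP; rewrite -subr_eq0; apply/eqP.
pose m := Num.max rho rho'.
have m01 : 0 <= m < 1 by rewrite /m le_max rho0 gt_max rho1 rho'1.
apply: (geometric_bound_eq0 (C := M + `|c0| * C0) m01) => k.
rewrite -(subrKA (c0 * Ex P (wd k))) -mulrBr.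
apply: le_trans (ler_normD _ _) _; rewrite mulrDl normrM; apply: lerD.
  have := lim k; rewrite mul1r mul0r addr0 => /le_trans; apply.
  by apply: ler_wpM2l => //; apply: lerXn2r; rewrite ?nnegrE// /m le_max ?rho0 ?lexx.
rewrite -mulrA; apply: ler_wpM2l => //; apply: le_trans (sand k) _.
apply: ler_wpM2l => //; apply: lerXn2r; rewrite ?nnegrE// /m le_max ?rho0 ?lexx ?orbT//.
Qed.

End ExpectedDiscount.

Section Distinct.
Context (th : R) (p : 'I_n.+1 -> C).
Hypotheses (th0 : 0 <= th) (dp : distinct_roots (- r) lambda alpha T th p).

Lemma root_of_distinct k : is_root th (p k).
Proof.
case: dp => _ /(_ (p k))[/(_ (ex_intro _ k erefl))[uk pk] _]; split => //.
have -> : rc (lambda + th) = rc lambda + phi (- r) lambda alpha T (p k).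
  by rewrite pk rmorphD.
by rewrite /phi rmorphN; ring.
Qed.

Lemma exit_transform_sum (a : 'I_n.+1 -> C) :
  (forall j, \sum_k a k * h T p k (lift ord0 j) = 0) ->
  \sum_k a k *: exit_transform T (p k) = 0.
Proof.
move=> ah; apply/colP => j; rewrite summxE mxE -[RHS](ah j); apply: eq_bigr => k _.
by rewrite mxE h_exit_transform.
Qed.

Lemma lower_independent (b : 'I_n.+1 -> C) :
  \sum_k b k * (p k * cexp (p k * rc tau)) = 0 ->
  (forall j, \sum_k b k * h T p k (lift ord0 j) = 0) -> forall k, b k = 0.
Proof.
move=> bot bh; apply: (roots_independent _ dp _ bh).
  by rewrite oppr_eq0 gt_eqF.
exact: (lower_kernel th0 root_of_distinct bot (exit_transform_sum bh)).
Qed.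

Hypothesis uT : T \in unitmx.

Let up k : resolvent_arg T (p k) \in unitmx. Proof. by case: (root_of_distinct k). Qed.

Lemma cmx_transform_sum (a : 'I_n.+1 -> C) :
  (forall j, \sum_k a k * cmx T p (K - tau) k j = 0) ->
  \sum_k (a k * cexp (- p k * rc (K - tau)) * p k) *: exit_transform T (p k) = 0.
Proof.
move=> ac; apply: exit_transform_sum => j; rewrite -[RHS](ac j).
by apply: eq_bigr => k _; rewrite mxE; ring.
Qed.

(** [T] maps the resolvent applied to the constant vector to minus the exit
    transform, and is injective; so the columns of [cmx] express the condition
    at the cap [K]. *)
Lemma cap_defect_cmx (a : 'I_n.+1 -> C) :
  (forall j, \sum_k a k * cmx T p (K - tau) k j = 0) ->
  cap_defect T (fun k => a k * cexp (p k * rc tau)) p K = 0.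
Proof.
move=> ac; pose w k := a k * cexp (- p k * rc (K - tau)).
transitivity (\sum_k (w k * p k) *:
    (invmx (resolvent_arg T (p k)) *m (const_mx 1 : 'cV_n))).
  apply: eq_bigr => k _; congr (_ *: _); rewrite /w.
  have -> : - p k * rc (K - tau) = p k * rc tau + - p k * rc K by rewrite rmorphB; ring.
  by rewrite cexpD; ring.
apply: (map_unit_ker uT).
transitivity (- \sum_k (w k * p k) *: exit_transform T (p k)).
  rewrite mulmx_sumr -sumrN; apply: eq_bigr => k _.
  rewrite -scalemxAr -scalerN; congr (_ *: _).
  rewrite mulmxA mulmx_resolvent// mulmxBl mul1mx -scalemxAl resolvent_one//.
  by rewrite addrAC subrr add0r.
by rewrite cmx_transform_sum// oppr0.
Qed.

(** Uniqueness above [tau] provides one more relation between the exit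
    transforms, and applying [T] removes the factors [p k]; the moments then
    determine [a]. *)
Lemma upper_independent (a : 'I_n.+1 -> C) : \sum_k a k = 0 ->
  (forall j, \sum_k a k * cmx T p (K - tau) k j = 0) -> forall k, a k = 0.
Proof.
move=> a0 ac; pose w k := a k * cexp (- p k * rc (K - tau)).
have w0 : \sum_k w k = 0.
  exact: (upper_kernel th0 root_of_distinct a0 (cap_defect_cmx ac)).
have wt : \sum_k w k *: exit_transform T (p k) = 0.
  apply: (map_unit_ker uT); rewrite mulmx_sumr.
  under eq_bigr => k _.
    rewrite -scalemxAr mulmx_exit_transform// scalerBr scalerA.
    over.
  by rewrite sumrB (cmx_transform_sum ac) -scaler_suml w0 scale0r subr0.
move=> k; apply/eqP; have : w k = 0.
  apply: (roots_independent _ dp w0) => [|j]; first by rewrite oppr_eq0 gt_eqF.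
  move/colP/(_ j) : wt; rewrite summxE [RHS]mxE => e; rewrite -[RHS]e.
  by apply: eq_bigr => i _; rewrite mxE h_exit_transform.
by move=> /eqP; rewrite mulf_eq0 (negbTE (cexp_neq0 _)) orbF.
Qed.

End Distinct.

End Conservation.

(** * The transform of the sojourn times *)

Theorem corollary3p1 (R : realType) (d : measure_display)
    (Omega : measurableType d) (P : probability Omega R)
    (n : nat) (alpha : 'cV[R]_n) (T : 'M[R]_n) (B : set R -> \bar R)
    (r1 lambda K tau : R) (E S : nat -> {RV P >-> R})
    (theta1 theta2 : R) (p : R -> 'I_n.+1 -> R[i]) :
  r1 < 0 -> 0 < lambda -> 0 < K -> 0 <= tau <= K ->
  phase_type alpha T B ->
  marked_poisson lambda B E S ->
  0 <= theta1 -> 0 <= theta2 ->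
  (forall q, q = theta1 \/ q = theta2 ->
     distinct_roots r1 lambda alpha T q (p q)) ->
  let e w k := E k w in
  let b w k := S k w in
  let Dw w := D r1 K tau (e w) (b w) in
  let Uw w := U r1 K tau (e w) (b w) in
  let C2 := Csum T (p theta2) (K - tau) in
  exists (z : 'rV[R[i]]_n) (l : R[i]),
    [/\ solves_system T (p theta1) tau z l,
        forall z' l', solves_system T (p theta1) tau z' l' ->
          z' = z /\ l' = l,
        C2 != 0
      & real_complex R (fine
          (\int[P]_w expeR (- (theta1%:E * Dw w) - theta2%:E * Uw w)%E)%E) =
        C2^-1 * \sum_(i < n) z 0 i *
          \sum_(k < n.+1) (-1) ^+ k * c T (p theta2) (K - tau) k *
            h T (p theta2) k (lift ord0 i)].
Proof.
move=> r1n lam0 _ /andP[t0 tK] ptB [lawE lawS ind] th10 th20 roots e b Dw Uw C2.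
have [ptr _] := ptB; have [Pb kP cdf] := phase_type_tail ptB.
have [a0 a1 _ _ _] := ptr; have uT := subgenerator_unit ptr.
pose E' k : Omega -> R := E k; pose S' k : Omega -> R := S k.
have tailE k u : 0 <= u -> Ex P (fun w => (u < E' k w)%R%:R) = expR (- (lambda * u)).
  exact: (exponential_tail lam0 (lawE k)).
have tailS k u : 0 <= u -> Ex P (fun w => (u < S' k w)%R%:R) = killed_tail alpha Pb u.
  move=> u0; apply: tail_of_cdf; first exact: measurable_funPT.
  exact: etrans (lawS k _ (measurable_itv _)) (cdf u u0).
have mX i : measurable_fun setT (driver E' S' i) by case: i => k; exact: measurable_funPT.
have ind' : mutually_independent P (driver E' S') by exact: ind.
have r0 : 0 < - r1 by rewrite oppr_gt0.
pose p1 := p theta1; pose p2 := p theta2.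
have d1 : distinct_roots (- - r1) lambda alpha T theta1 p1.
  by rewrite opprK; apply: roots; left.
have d2 : distinct_roots (- - r1) lambda alpha T theta2 p2.
  by rewrite opprK; apply: roots; right.
pose v := (\col_k (p1 k * cexp (p1 k * real_complex R tau)) : 'cV_n.+1).
pose H := (\matrix_(k, j) h T p1 k (lift ord0 j) : 'M[R[i]]_(n.+1, n)).
(* The unknowns [z], [l] are dual to the coefficients of the value function below
   [tau]: [v] expresses reflection at the bottom, [H] the matching across [tau]. *)
have [|z [l [sys uniq comb]]] := @column_system _ _ v H.
  move=> b0 bv bH.
  apply: (lower_independent kP a0 a1 lam0 r0 t0 tK mX ind' tailE tailS th10 d1).
    by rewrite -[RHS]bv; apply: eq_bigr => k _; rewrite mxE.
  by move=> j; rewrite -[RHS](bH j); apply: eq_bigr => k _; rewrite mxE.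
have HE (z' : 'rV_n) l' k : \sum_j z' 0 j * H k j + v k 0 * l' =
    \sum_j z' 0 j * h T p1 k (lift ord0 j) +
    p1 k * cexp (p1 k * real_complex R tau) * l'.
  by congr (_ + _); [apply: eq_bigr => j _; rewrite mxE | rewrite mxE].
have [C2n sum_a cond_a] := minors_system
  (upper_independent kP a0 a1 lam0 r0 t0 tK mX ind' tailE tailS th20 d2 uT).
(* The weights of the value function above [tau], with payoff [1] at [tau]. *)
pose a (k : 'I_n.+1) := C2^-1 * ((-1) ^+ k * c T p2 (K - tau) k).
rewrite -/(Csum T p2 (K - tau)) in C2n.
have {}sum_a : \sum_k a k = 1 by exact: sum_a.
have {}cond_a j : \sum_k a k * cmx T p2 (K - tau) k j = 0 by exact: cond_a.
exists z, l; split => //.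
- by move=> k; rewrite -HE.
- by move=> z' l' s'; apply: uniq => k; rewrite HE.
pose G j := \sum_k a k * h T p2 k (lift ord0 j).
have [b' [bv bH bsum]] := comb G.
set EZ := fine _.
have key : \sum_k b' k = real_complex R EZ.
  apply/eqP; rewrite -subr_eq0; apply/eqP; apply: Re_eq0 => y.
  have cc q : cexp (q * real_complex R tau) * cexp (- q * real_complex R tau) = 1.
    by rewrite mulrC mulNr cexpN_mul.
  pose cy k := y * a k * cexp (p2 k * real_complex R tau).
  pose bx k := y * b' k * cexp (p1 k * real_complex R tau).
  have cyK k : cy k * cexp (- p2 k * real_complex R tau) = y * a k.
    by rewrite -mulrA cc mulr1.
  have byK k : bx k * cexp (- p1 k * real_complex R tau) = y * b' k.
    by rewrite -mulrA cc mulr1.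
  have cap : cap_defect T cy p2 K = 0.
    apply: (cap_defect_cmx d2 uT) => j.
    transitivity (y * \sum_k a k * cmx T p2 (K - tau) k j); last by rewrite cond_a mulr0.
    by rewrite mulr_sumr; apply: eq_bigr => k _; rewrite -mulrA.
  have end_ : expsum cy p2 tau = complex.Re y.
    rewrite expsumE (eq_bigr (fun k => y * a k)) => [|k _]; last exact: cyK.
    by rewrite -mulr_sumr sum_a mulr1.
  have bottom : \sum_k bx k * p1 k = 0.
    transitivity (y * \sum_k b' k * v k 0); last by rewrite bv mulr0.
    by rewrite mulr_sumr; apply: eq_bigr => k _; rewrite mxE /bx; ring.
  have match_ : exit_average T bx p1 tau = exit_average T cy p2 tau.
    apply/colP => j; rewrite !summxE; transitivity (y * G j).
      rewrite -(bH j) mulr_sumr; apply: eq_bigr => k _.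
      by rewrite [in RHS]mxE mxE byK h_exit_transform -mulrA.
    rewrite /G mulr_sumr; apply: eq_bigr => k _.
    by rewrite mxE cyK h_exit_transform -mulrA.
  have := expected_discount kP a0 a1 lam0 r0 t0 tK mX ind' tailE tailS th10 th20
    (root_of_distinct d1) (root_of_distinct d2) cap end_ bottom match_.
  rewrite opprK -/EZ => val.
  have -> : y * (\sum_k b' k - real_complex R EZ) =
      y * \sum_k b' k - y * real_complex R EZ by rewrite mulrBr.
  rewrite ReB ReMr -val; apply/eqP; rewrite subr_eq0; apply/eqP.
  by rewrite expsumE mulr_sumr; congr complex.Re; apply: eq_bigr => k _; rewrite byK.
rewrite -key bsum mulr_sumr; apply: eq_bigr => i _.
rewrite /G mulrCA; congr (_ * _); rewrite mulr_sumr; apply: eq_bigr => k _.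
by rewrite /a !mulrA.
Qed.
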